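(* Let $\Omega$ be a bounded open set in $\mathbb{R}^n$, $n\ge 5$. Suppose that the Neumann Laplacian $-\Delta_N$ on $\Omega$ has a discrete spectrum $0=\gamma_1\le\gamma_2\le\gamma_3\le\cdots$. Then there exist infinitely many eigenvalues $\{\gamma_{k_j}\}_{j\in\mathbb{N}}$ satisfying Pólya's conjecture, i.e., $$k_j-1\ge \frac{\omega(n)|\Omega|}{(2\pi)^{n}}\,\gamma_{k_j}^{n/2}.$$
   Context: $\Omega$ is a nonempty bounded open subset of $\mathbb{R}^n$, $|\Omega|$ is its Lebesgue measure, $\omega(n)$ is the volume of the unit ball of $\mathbb{R}^n$. Discrete spectrum means the spectrum consists of eigenvalues of finite multiplicity tending to infinity; $\gamma_1\le\gamma_2\le\cdots$ lists them with multiplicity. *)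

(* Defs.v *)
From HB Require Import structures.
From mathcomp Require Import all_boot all_order all_algebra.
From mathcomp Require Import all_classical all_reals all_analysis.

Set Implicit Arguments.
Unset Strict Implicit.
Unset Printing Implicit Defensive.

Import Order.TTheory GRing.Theory Num.Theory.
Import numFieldNormedType.Exports.

Local Open Scope card_scope.
Local Open Scope classical_set_scope.
Local Open Scope ring_scope.

(* 'rV[R]_n carries the product sigma-algebra of the Borel sigma-algebra of R,
   that is, the Borel sigma-algebra of R^n. *)

Definition rV_display : measure_display. Proof. by []. Qed.

Definition rV_coord (R : realType) (n : nat) (i : 'I_n) (v : 'rV[R]_n) :
  measurableTypeR R := v 0 i.

Section rV_measurable.
Context (R : realType) (n : nat).

Let rV_set0 : g_sigma_preimage (@rV_coord R n) set0.
Proof. exact: sigma_algebra0. Qed.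

Let rV_setC A : g_sigma_preimage (@rV_coord R n) A ->
  g_sigma_preimage (@rV_coord R n) (~` A).
Proof. exact: sigma_algebraC. Qed.

Let rV_bigcup (F : (set 'rV[R]_n)^nat) :
  (forall i, g_sigma_preimage (@rV_coord R n) (F i)) ->
  g_sigma_preimage (@rV_coord R n) (\bigcup_i (F i)).
Proof. exact: sigma_algebra_bigcup. Qed.

HB.instance Definition _ := @isMeasurable.Build rV_display 'rV[R]_n
  (g_sigma_preimage (@rV_coord R n)) rV_set0 rV_setC rV_bigcup.

End rV_measurable.

Lemma measurable_rV_coord (R : realType) n (i : 'I_n) :
  measurable_fun [set: 'rV[R]_n] (@rV_coord R n i).
Proof.
move=> _ Y mY; rewrite setTI; apply: sub_sigma_algebra => /=.
rewrite -bigcup_seq/=; exists i => /=; first by rewrite mem_index_enum.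
by exists Y => //; rewrite setTI.
Qed.

Lemma measurable_fun_rV (R : realType) n d (T : measurableType d)
    (f : T -> 'rV[R]_n) :
  (forall i, measurable_fun [set: T] (@rV_coord R n i \o f)) ->
  measurable_fun [set: T] f.
Proof.
move=> mf; suff H : g_sigma_preimage (fun i => @rV_coord R n i \o f)
    `<=` measurable.
  by move=> _ A mA; apply: H; rewrite g_sigma_preimage_comp; exists A.
apply: smallest_sub; first exact: sigma_algebra_measurable.
rewrite -bigcup_seq; apply: bigcup_sub => i _ A [B mB <-]; exact: mf.
Qed.

Lemma measurable_rV_ball (R : realType) n (c : 'rV[R]_n) (e : R) : 0 < e ->
  measurable (ball c e).
Proof.
move=> e0.
rewrite (_ : ball c e =
    \bigcap_(i in [set: 'I_n]) (@rV_coord R n i @^-1` ball (c 0 i) e)).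
  apply: fin_bigcap_measurable; first exact: finite_finset.
  move=> i _.
  rewrite -[X in measurable X]setTI; apply: measurable_rV_coord => //.
  by rewrite ball_itv; exact: measurable_itv.
apply/seteqP; split=> [v [_ Bv] i _|v Bv]; first exact: Bv.
by split=> // i j; rewrite ord1; exact: Bv.
Qed.

(* With measurable_rV_coord, this identifies the sigma-algebra of 'rV[R]_n with
   the one generated by its open sets. *)
Lemma measurable_rV_open (R : realType) n (A : set 'rV[R]_n) :
  open A -> measurable A.
Proof.
move=> oA.
pose B (p : 'rV[rat]_n * nat) : set 'rV[R]_n :=
  ball (\row_i ratr (p.1 0 i) : 'rV[R]_n) (p.2.+1%:R^-1).
rewrite (_ : A = \bigcup_p (if `[< B p `<=` A >] then B p else set0)).
  apply: countable_bigcupT_measurable => // p.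
  case: ifP => // _; apply: measurable_rV_ball.
  by rewrite invr_gt0.
apply/seteqP; split=> [v Av|v [p _]]; last first.
  by case: ifPn => // /asboolP; apply.
have /nbhs_ballP[e /= e0 veA] : nbhs v A by exact: open_nbhs_nbhs.
pose k := Num.truncn (2 / e).
have k0 : 0 < k.+1%:R^-1 :> R by rewrite invr_gt0.
have ke : k.+1%:R^-1 + k.+1%:R^-1 <= e.
  have k2 : k.+1%:R^-1 <= e / 2.
    rewrite -[leRHS]invrK lef_pV2 ?posrE ?invr_gt0 ?divr_gt0// invf_div.
    exact/ltW/truncnS_gt.
  by rewrite [e]splitr lerD.
have vq i : exists q : rat, ball (v 0 i) (k.+1%:R^-1) (ratr q).
  have [|q] := @rat_in_itvoo R (v 0 i - k.+1%:R^-1) (v 0 i + k.+1%:R^-1).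
    by rewrite ltrD2l gtrN.
  by move=> qv; exists q; rewrite ball_itv.
pose q : 'rV[rat]_n := \row_i projT1 (cid (vq i)).
have vBq : ball v (k.+1%:R^-1) (\row_i ratr (q 0 i) : 'rV[R]_n).
  by split=> // i j; rewrite ord1 !mxE; case: cid.
exists (q, k) => //; rewrite ifT; first exact: ball_sym.
apply/asboolP => w /= Bw; apply: veA.
exact/(le_ball ke)/(ball_triangle vBq Bw).
Qed.

Definition rV_cons (R : realType) (n : nat)
  (p : measurableTypeR R * 'rV[R]_n) : 'rV[R]_n.+1 :=
  \row_i oapp (p.2 0) p.1 (unlift ord0 i).

Definition rV_uncons (R : realType) (n : nat) (v : 'rV[R]_n.+1) :
  measurableTypeR R * 'rV[R]_n := (v 0 ord0, \row_i v 0 (lift ord0 i)).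

Lemma rV_consE0 (R : realType) n (p : measurableTypeR R * 'rV[R]_n) :
  rV_cons p 0 ord0 = p.1.
Proof. by rewrite mxE unlift_none. Qed.

Lemma rV_consES (R : realType) n (p : measurableTypeR R * 'rV[R]_n) i :
  rV_cons p 0 (lift ord0 i) = p.2 0 i.
Proof. by rewrite mxE liftK. Qed.

Lemma rV_consK (R : realType) n : cancel (@rV_cons R n) (@rV_uncons R n).
Proof.
case=> x v; rewrite /rV_uncons rV_consE0; congr pair.
by apply/rowP => i; rewrite mxE rV_consES.
Qed.

Lemma rV_unconsK (R : realType) n : cancel (@rV_uncons R n) (@rV_cons R n).
Proof.
move=> v; apply/rowP => i; case: (unliftP ord0 i) => [j ->|->].
  by rewrite rV_consES mxE.
by rewrite rV_consE0.
Qed.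

Lemma measurable_rV_cons (R : realType) n :
  measurable_fun setT (@rV_cons R n).
Proof.
apply: measurable_fun_rV => i; case: (unliftP ord0 i) => [j ->|->].
  rewrite (_ : _ \o _ = @rV_coord R n j \o snd).
    by apply: measurableT_comp => //; exact: measurable_rV_coord.
  by apply/funext => p; rewrite /= /rV_coord rV_consES.
rewrite (_ : _ \o _ = fst) //.
by apply/funext => p; rewrite /= /rV_coord rV_consE0.
Qed.

Lemma measurable_rV_uncons (R : realType) n :
  measurable_fun setT (@rV_uncons R n).
Proof.
apply/measurable_fun_pairP; split; first exact: (@measurable_rV_coord R n.+1).
apply: measurable_fun_rV => i.
rewrite (_ : _ \o _ = @rV_coord R n.+1 (lift ord0 i)).
  exact: measurable_rV_coord.
by apply/funext => v; rewrite /= /rV_coord mxE.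
Qed.

Section lebesgue_rV_step.
Context (R : realType) (n : nat).
Variable mu : {sigma_finite_measure set 'rV[R]_n -> \bar R}.

Definition lebesgue_rV_step : set 'rV[R]_n.+1 -> \bar R :=
  pushforward (@lebesgue_measure R \x mu)%E (@rV_cons R n).

Let mcons := @measurable_rV_cons R n.

Let step0 : lebesgue_rV_step set0 = 0%E.
Proof. by rewrite /lebesgue_rV_step /pushforward preimage_set0 measure0. Qed.

Let step_ge0 A : (0 <= lebesgue_rV_step A)%E.
Proof. by apply: integral_ge0. Qed.

Let step_sigma_additive : semi_sigma_additive lebesgue_rV_step.
Proof. by apply: measure_semi_sigma_additive => //; exact: mcons. Qed.

HB.instance Definition _ := isMeasure.Build _ _ _
  lebesgue_rV_step step0 step_ge0 step_sigma_additive.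

Let step_sigma_finite : sigma_finite setT lebesgue_rV_step.
Proof.
have /sigma_finiteP[F [FT ndF Foo]] := sigma_finiteT (@lebesgue_measure R).
have /sigma_finiteP[G [GT ndG Goo]] := sigma_finiteT mu.
exists (fun k => @rV_uncons R n @^-1` (F k `*` G k)).
  apply/esym; rewrite -subTset => v _.
  have [i _ Fi] : (\bigcup_i F i) (rV_uncons v).1 by rewrite -FT.
  have [j _ Gj] : (\bigcup_i G i) (rV_uncons v).2 by rewrite -GT.
  exists (maxn i j) => //; split.
    by move: Fi; exact/subsetPset/ndF/leq_maxl.
  by move: Gj; exact/subsetPset/ndG/leq_maxr.
move=> k; have [mF Fk] := Foo k; have [mG Gk] := Goo k; split.
  rewrite -[X in measurable X]setTI; apply: measurable_rV_uncons => //.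
  exact: measurableX.
rewrite /lebesgue_rV_step /pushforward -comp_preimage.
rewrite (_ : _ \o _ = id) ?preimage_id; last first.
  by apply/funext => p; exact: rV_consK.
by rewrite product_measure1E// lte_mul_pinfty// ge0_fin_numE.
Qed.

HB.instance Definition _ := Measure_isSigmaFinite.Build _ _ _
  lebesgue_rV_step step_sigma_finite.

End lebesgue_rV_step.

(* Lebesgue measure on R^n, as the n-fold product of Lebesgue measure on R. *)
Fixpoint lebesgue_rV (R : realType) (n : nat) :
    {sigma_finite_measure set 'rV[R]_n -> \bar R} :=
  match n with
  | 0 => \d_ (0 : 'rV[R]_0)
  | m.+1 => lebesgue_rV_step (lebesgue_rV R m)
  end.

(* The norm of 'rV[R]_n in the library is the sup norm, hence the explicit
   Euclidean ball. *)
Definition unit_ball_volume (R : realType) (n : nat) : R :=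
  fine (lebesgue_rV R n [set x : 'rV[R]_n | \sum_i x 0 i ^+ 2 < 1]).

Definition volume (R : realType) (n : nat) (Omega : set 'rV[R]_n) : R :=
  fine (lebesgue_rV R n Omega).

Section neumann_laplacian.
Context (R : realType) (n : nat).
Implicit Types (Omega : set 'rV[R]_n) (u v f phi : 'rV[R]_n -> R)
  (i : 'I_n) (lambda : R).

Local Notation mu := (lebesgue_rV R n).

Definition partial i u : 'rV[R]_n -> R := fun x => 'D_(delta_mx 0 i) u x.

Definition smooth u := forall s : seq 'I_n,
  continuous (foldr partial u s) /\
  forall i x, derivable (foldr partial u s) x (delta_mx 0 i).

Definition test_function Omega phi :=
  [/\ smooth phi, compact (closure [set x | phi x != 0])
    & closure [set x | phi x != 0] `<=` Omega].

(* Elements of L^2(Omega) are represented by functions on R^n whose values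
   outside Omega are irrelevant, identified when they agree a.e. in Omega. *)
Definition L2 Omega u :=
  measurable_fun Omega u /\ mu.-integrable Omega (fun x => (u x ^+ 2)%:E).

Definition weak_partial Omega i u g := forall phi, test_function Omega phi ->
  \int[mu]_(x in Omega) (u x * partial i phi x) =
  - \int[mu]_(x in Omega) (g x * phi x).

(* u belongs to H^1(Omega), with distributional gradient g. *)
Definition H1_grad Omega u (g : 'I_n -> 'rV[R]_n -> R) :=
  L2 Omega u /\ forall i, L2 Omega (g i) /\ weak_partial Omega i u (g i).

(* The graph of the operator of the closed quadratic form
   u |-> \int_Omega |grad u|^2 with form domain H^1(Omega): u is in the domain
   of - Delta_N and - Delta_N u = f. *)
Definition neumann_laplacian Omega u f :=
  L2 Omega f /\ exists2 gu, H1_grad Omega u gu &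
    forall v gv, H1_grad Omega v gv ->
      \sum_i \int[mu]_(x in Omega) (gu i x * gv i x) =
      \int[mu]_(x in Omega) (f x * v x).

(* - Delta_N - lambda is a bijection from its domain onto L^2(Omega) with
   bounded inverse. *)
Definition neumann_resolvent_set Omega : set R := [set lambda |
  (forall f, L2 Omega f ->
     exists u, neumann_laplacian Omega u (fun x => f x + lambda * u x)) /\
  exists C : R, forall u f, L2 Omega f ->
    neumann_laplacian Omega u (fun x => f x + lambda * u x) ->
    \int[mu]_(x in Omega) (u x ^+ 2) <= C * \int[mu]_(x in Omega) (f x ^+ 2)].

Definition neumann_spectrum Omega : set R := ~` neumann_resolvent_set Omega.

Definition neumann_eigenspace Omega lambda : set ('rV[R]_n -> R) :=
  [set u | neumann_laplacian Omega u (fun x => lambda * u x)].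

(* The eigenspace of lambda, as a subspace of L^2(Omega), has dimension d: it
   has a basis e_0, ..., e_(d-1). *)
Definition neumann_multiplicity Omega lambda (d : nat) :=
  exists e : 'I_d -> 'rV[R]_n -> R,
  [/\ forall j, neumann_eigenspace Omega lambda (e j),
      forall c : 'I_d -> R,
        (fun x => \sum_j c j * e j x) = cst 0 %[ae mu in Omega] ->
        forall j, c j = 0
    & forall u, neumann_eigenspace Omega lambda u ->
        exists c : 'I_d -> R, u = (fun x => \sum_j c j * e j x) %[ae mu in Omega]].

(* The Neumann Laplacian has discrete spectrum, listed with multiplicity as
   gamma 1 <= gamma 2 <= ...; gamma 0 is unused. *)
Definition neumann_discrete_spectrum Omega (gamma : nat -> R) :=
  [/\ neumann_spectrum Omega = gamma @` [set k | (1 <= k)%N],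
      forall k l, (1 <= k <= l)%N -> gamma k <= gamma l,
      gamma k @[k --> \oo] --> +oo
    & forall lambda, neumann_spectrum Omega lambda ->
        exists2 d, neumann_multiplicity Omega lambda d &
          [set k | (1 <= k)%N /\ gamma k = lambda] #= `I_d].

End neumann_laplacian.

(* Main.v *)
Require Import Defs.
From HB Require Import structures.
From mathcomp Require Import all_boot all_order all_algebra.
From mathcomp Require Import all_classical all_reals all_analysis.
From mathcomp Require Import measurable_realfun ring lra.
Import Order.TTheory GRing.Theory Num.Theory.
Import numFieldNormedType.Exports.
Local Open Scope classical_set_scope.
Local Open Scope ring_scope.

(** The proof compares two estimates of the Riesz mean
    S(z), the sum of z - gamma k over gamma k < z, for large z.

    Let c = omega(n) |Omega| / (2 pi)^n and let r m be the radius with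
    c (r m)^n = m, so that Polya's inequality for gamma k reads
    gamma k <= (r (k-1))^2.  If it held for finitely many k only, then
    gamma k > (r (k-1))^2 for all large k, and S(z) would be at most the sum of
    z - (r m)^2 over 1 <= m < N, up to an error O(z), N being the number of
    eigenvalues below z.

    For a lower estimate, take orthonormal eigenfunctions e_k and
        F(y) = sum over gamma k < z of (z - gamma k) |<e_k, exp(i y.x)>|^2.
    The Dirichlet energy of exp(i y.x) is |y|^2 |Omega| and its square norm is
    |Omega|.  Removing its projection on the eigenfunctions below z leaves a
    function whose energy is at least z times its square norm (variational), and
    this yields F(y) >= (z - |y|^2) |Omega| (wave_sum_ge).  By Plancherel, the
    integral of F is at most (2 pi)^n S(z).  The shells r (m-1) <= |y| < r m
    all have volume (2 pi)^n / |Omega|, so integrating the bound on F over them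
    reproduces exactly the sum of z - (r m)^2 of the upper estimate.

    What decides is an excess on the side of the lower estimate.  Since Omega
    is bounded, the square root of F is Lipschitz with a constant of order
    sqrt z (wave_sum_lipschitz), so F cannot vanish at once outside the ball
    |y|^2 < z: it stays above a positive constant as long as
    |y| < sqrt z + beta / sqrt z (wave_sum_outer).  That outer shell has volume
    of order z^(n/2 - 1), and for n >= 5 this exceeds the error O(z)
    (riesz_mean_lower, polya_frequently).

    Two ingredients are proved in a form that avoids general theory.
    The Plancherel inequality is Bessel's inequality for the exponentials with
    frequencies in a translate of the lattice (pi / L) Z^n, which are orthogonal
    in a cube [-L, L]^n around Omega (lattice_bessel), averaged over all
    translates (lattice_average).
    The variational principle is derived from the definition of the spectrum by
    solvability alone: H = (1 - Delta_N)^-1 is symmetric on the complete space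
    of functions orthogonal to the eigenfunctions below z, and a symmetric
    operator is bounded above by m0 as soon as every M > m0 has a spectral gap
    just below it and is not an eigenvalue (sym_upper_bound). *)

Set Implicit Arguments.
Unset Strict Implicit.
Unset Printing Implicit Defensive.

(** * Semi-inner products and upper bounds of symmetric operators *)

(** A null vector need not be zero: functions that vanish almost everywhere are
    null for the L^2 product, and no quotient is taken. *)
Record semi_inner (R : realType) (V : lmodType R) (ip : V -> V -> R) := SemiInner {
  ipC : forall u v, ip u v = ip v u;
  ip_linear : forall a u v w, ip (a *: u + v) w = a * ip u w + ip v w;
  ip_ge0 : forall u, 0 <= ip u u }.

Section semi_inner_theory.
Context (R : realType) (V : lmodType R) (ip : V -> V -> R).
Hypothesis ipP : semi_inner ip.
Implicit Types (u v w : V) (a : R).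

Lemma ip0l w : ip 0 w = 0.
Proof.
have := ip_linear ipP 1 0 0 w; rewrite scale1r addr0 mul1r => /esym/eqP.
by rewrite -subr_eq0 addrK => /eqP.
Qed.

Lemma ipDl u v w : ip (u + v) w = ip u w + ip v w.
Proof. by rewrite -[u in LHS]scale1r (ip_linear ipP) mul1r. Qed.

Lemma ipZl a u w : ip (a *: u) w = a * ip u w.
Proof. by rewrite -[_ *: _]addr0 (ip_linear ipP) ip0l addr0. Qed.

Lemma ipNl u w : ip (- u) w = - ip u w.
Proof. by rewrite -scaleN1r ipZl mulN1r. Qed.

Lemma ipBl u v w : ip (u - v) w = ip u w - ip v w.
Proof. by rewrite ipDl ipNl. Qed.

Lemma ip0r w : ip w 0 = 0. Proof. by rewrite (ipC ipP) ip0l. Qed.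

Lemma ipDr u v w : ip w (u + v) = ip w u + ip w v.
Proof. by rewrite (ipC ipP) ipDl !(ipC ipP w). Qed.

Lemma ipZr a u w : ip w (a *: u) = a * ip w u.
Proof. by rewrite (ipC ipP) ipZl (ipC ipP w). Qed.

Lemma ipNr u w : ip w (- u) = - ip w u.
Proof. by rewrite (ipC ipP) ipNl (ipC ipP w). Qed.

Lemma ipBr u v w : ip w (u - v) = ip w u - ip w v.
Proof. by rewrite ipDr ipNr. Qed.

Lemma ip_suml (I : Type) (r : seq I) (P : pred I) (F : I -> V) w :
  ip (\sum_(i <- r | P i) F i) w = \sum_(i <- r | P i) ip (F i) w.
Proof. by apply: (big_morph (ip^~ w)) => [u v|]; rewrite ?ip0l ?ipDl. Qed.

Lemma ip_sumr (I : Type) (r : seq I) (P : pred I) (F : I -> V) w :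
  ip w (\sum_(i <- r | P i) F i) = \sum_(i <- r | P i) ip w (F i).
Proof. by rewrite (ipC ipP) ip_suml; apply: eq_bigr => i _; rewrite (ipC ipP). Qed.

Lemma ip_sqrB u v : ip (u - v) (u - v) = ip u u - 2 * ip u v + ip v v.
Proof. rewrite !(ipBl, ipBr) (ipC ipP v u); ring. Qed.

Lemma ip_sqrD u v : ip (u + v) (u + v) = ip u u + 2 * ip u v + ip v v.
Proof. rewrite !(ipDl, ipDr) (ipC ipP v u); ring. Qed.

Lemma cauchy_schwarz u v : ip u v ^+ 2 <= ip u u * ip v v.
Proof.
have H t : 0 <= ip u u - 2 * t * ip u v + t ^+ 2 * ip v v.
  have := ip_ge0 ipP (u - t *: v).
  by rewrite ip_sqrB !ipZr !ipZl expr2 !mulrA.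
have [v0|v0] := eqVneq (ip v v) 0.
  rewrite v0 mulr0; have [->|uv0] := eqVneq (ip u v) 0; first by rewrite expr0n.
  have := H ((ip u u + 1) / (2 * ip u v)); rewrite v0 mulr0 addr0.
  have -> : 2 * ((ip u u + 1) / (2 * ip u v)) * ip u v = ip u u + 1 by field.
  by rewrite opprD addNKr oppr_ge0 ler10.
have v1 : 0 < ip v v by rewrite lt_def v0 (ip_ge0 ipP).
have := H (ip u v / ip v v).
have -> : ip u u - 2 * (ip u v / ip v v) * ip u v + (ip u v / ip v v) ^+ 2 * ip v v
  = (ip u u * ip v v - ip u v ^+ 2) / ip v v by field.
by rewrite pmulr_lge0 ?invr_gt0// subr_ge0.
Qed.

Lemma ip_null u v : ip u u = 0 -> ip u v = 0.
Proof.
move=> u0; have := cauchy_schwarz u v; rewrite u0 mul0r => H.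
by apply/eqP; rewrite -sqrf_eq0 eq_le H sqr_ge0.
Qed.

Lemma ip_sqrD_le u v : ip (u + v) (u + v) <= 2 * ip u u + 2 * ip v v.
Proof.
have := ip_ge0 ipP (u - v); rewrite ip_sqrB ip_sqrD; lra.
Qed.

Lemma ip_weak_eq u v : (forall w, ip u w = ip v w) -> ip u u = ip v v.
Proof. by move=> H; rewrite H (ipC ipP) H. Qed.

End semi_inner_theory.

Section symmetric_map.
Context (R : realType) (V : lmodType R) (ip : V -> V -> R).
Hypothesis ipP : semi_inner ip.
Variable D : V -> V.
Hypothesis Dsym : forall u v, ip (D u) v = ip u (D v).

Lemma sym_linear a u v w : ip (D (a *: u + v)) w = a * ip (D u) w + ip (D v) w.
Proof. by rewrite !Dsym (ip_linear ipP). Qed.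

Lemma sym_shift c : forall u v, ip (D u - c *: u) v = ip u (D v - c *: v).
Proof.
by move=> u v; rewrite (ipBl ipP) (ipBr ipP) Dsym (ipZl ipP) (ipZr ipP).
Qed.

Lemma psd_form : (forall u, 0 <= ip (D u) u) -> semi_inner (fun u v => ip (D u) v).
Proof.
move=> D0; split => //; first by move=> u v; rewrite Dsym (ipC ipP).
by move=> a u v w; rewrite sym_linear.
Qed.

(** The Cauchy-Schwarz inequality of the form <D u, v>, applied to u and D u. *)
Lemma psd_sqr_le B : (forall u, 0 <= ip (D u) u) ->
  (forall u, ip (D u) u <= B * ip u u) ->
  forall u, ip (D u) (D u) <= B * ip (D u) u.
Proof.
move=> D0 DB u; set q := ip (D u) (D u).
have q0 : 0 <= q by exact: ip_ge0 ipP _.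
have [->|qn0] := eqVneq q 0.
  have := D0 u; rewrite le_eqVlt => /predU1P[<-|]; first by rewrite mulr0.
  move=> Du0; rewrite (pmulr_lge0 _ Du0).
  have u0 : 0 < ip u u.
    rewrite lt_def (ip_ge0 ipP) andbT; apply/eqP => u0.
    by move: Du0; rewrite Dsym (ip_null ipP) ?ltxx.
  by rewrite -(pmulr_lge0 _ u0) (le_trans (D0 u) (DB u)).
have qp : 0 < q by rewrite lt_def qn0.
have := cauchy_schwarz (psd_form D0) u (D u); rewrite -/q => H.
rewrite -(ler_pM2l qp) -expr2 (le_trans H)// mulrC [leRHS]mulrA ler_wpM2r//.
by rewrite mulrC DB.
Qed.

(** For a nonnegative D, a lower bound on |D u| gives one on <D u, u>, because
    |D u|^2 <= B <D u, u>. *)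
Lemma psd_coercive B b : (forall u, 0 <= ip (D u) u) ->
  (forall u, ip (D u) u <= B * ip u u) -> 0 < b ->
  (forall u, b * ip u u <= ip (D u) (D u)) ->
  exists2 c, 0 < c & forall u, c * ip u u <= ip (D u) u.
Proof.
move=> D0 DB b0 Db; have B0 : 0 < Num.max B 1 by rewrite lt_max ltr01 orbT.
exists (b / Num.max B 1); first by rewrite divr_gt0.
move=> u; rewrite mulrAC ler_pdivrMr// mulrC (mulrC _ (Num.max _ _)).
rewrite mulrC (le_trans (Db u))//.
rewrite (le_trans (psd_sqr_le D0 DB u))// ler_wpM2r// le_max lexx //.
Qed.

End symmetric_map.

Section gap.
Context (R : realType) (V : lmodType R) (ip : V -> V -> R).
Hypothesis ipP : semi_inner ip.

(** If a gap around 0 in the spectrum of K reached only to k < d, then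
    K^2 - k^2 = (K - k) (K + k) would be nonnegative and bounded below in norm,
    hence coercive, and the gap could be enlarged. *)
Lemma sym_gap (K : V -> V) B d : (forall u v, ip (K u) v = ip u (K v)) ->
  (forall u, ip (K u) (K u) <= B * ip u u) -> 0 < d ->
  (forall t, `|t| < d ->
     exists2 b, 0 < b & forall u, b * ip u u <= ip (K u - t *: u) (K u - t *: u)) ->
  forall u, d ^+ 2 * ip u u <= ip (K u) (K u).
Proof.
move=> Ksym KB d0 Kb.
pose S := [set s : R | forall u, s * ip u u <= ip (K u) (K u)].
apply: contrapT => nd.
have S0 : S 0 by move=> u; rewrite mul0r (ip_ge0 ipP).
have Sdown s t : S s -> t <= s -> S t.
  by move=> Ss ts u; apply: le_trans (Ss u); rewrite ler_wpM2r// (ip_ge0 ipP).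
have Sub : ubound S (d ^+ 2).
  by move=> s Ss; rewrite leNgt; apply/negP => /ltW ds; exact/nd/(Sdown s).
have Ssup : has_sup S by split; [exists 0|exists (d ^+ 2)].
set s := sup S.
have s0 : 0 <= s by apply: ub_le_sup S0; exists (d ^+ 2).
have Ss : S s.
  move=> u; rewrite leNgt; apply/negP => H.
  have u0 : 0 < ip u u.
    rewrite lt_def (ip_ge0 ipP) andbT; apply/eqP => u0.
    by move: H; rewrite u0 mulr0 ltNge (ip_ge0 ipP).
  move: H; rewrite -ltr_pdivrMr// => /(sup_gt (proj1 Ssup))[t St].
  by rewrite ltr_pdivrMr// ltNge St.
have sd : s < d ^+ 2.
  rewrite lt_neqAle; apply/andP; split; last by apply: ge_sup => //; exists 0.
  by apply/eqP => sE; apply: nd; rewrite -sE.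
pose k := Num.sqrt s.
have kk : k ^+ 2 = s by rewrite sqr_sqrtr.
have k0 : 0 <= k by rewrite sqrtr_ge0.
have kd : k < d by rewrite -(ltr_pXn2r (ltn0Sn 1)) ?nnegrE ?(ltW d0)// kk.
have [b1 b10 H1] := Kb k ltac:(by rewrite ger0_norm).
have [b2 b20 H2] := Kb (- k) ltac:(by rewrite normrN ger0_norm).
pose L u := K (K u) - s *: u.
have Lsym u v : ip (L u) v = ip u (L v).
  by rewrite (ipBl ipP) (ipBr ipP) !Ksym (ipZl ipP) (ipZr ipP).
have LE u : ip (L u) u = ip (K u) (K u) - s * ip u u.
  by rewrite (ipBl ipP) Ksym (ipZl ipP).
have L0 u : 0 <= ip (L u) u by rewrite LE subr_ge0.
have LB u : ip (L u) u <= B * ip u u.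
  by rewrite LE lerBlDr (le_trans (KB u))// lerDl mulr_ge0// (ip_ge0 ipP).
have Lb u : (b1 * b2) * ip u u <= ip (L u) (L u).
  pose w := K u - (- k) *: u.
  have -> : ip (L u) (L u) = ip (K w - k *: w) (K w - k *: w).
    apply: (ip_weak_eq ipP) => x; rewrite !(ipBl ipP) !Ksym !(ipZl ipP) /w.
    rewrite !(ipBl ipP) !Ksym !(ipZl ipP) -kk; ring.
  by rewrite -mulrA (le_trans _ (H1 w))// ler_pM2l.
have [c c0 Lc] := psd_coercive ipP Lsym L0 LB (mulr_gt0 b10 b20) Lb.
have : S (s + c) by move=> u; rewrite mulrDl addrC -lerBrDr -LE.
move=> Ssc; have : s + c <= s by apply: ub_le_sup Ssc; exists (d ^+ 2).
by rewrite gerDl leNgt c0.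
Qed.

Definition complete_ip := forall w : nat -> V,
  (forall e : R, 0 < e -> exists N, forall m k, (N <= m)%N -> (N <= k)%N ->
     ip (w m - w k) (w m - w k) <= e) ->
  exists x, forall e : R, 0 < e -> exists N, forall k, (N <= k)%N ->
     ip (w k - x) (w k - x) <= e.

(** The gap of D - s/2 gives |D u|^2 >= s <D u, u>, which is <D v, v> >= s |v|^2
    for v = D u.  It remains to see that the range of D is dense.  With
    E = 1 - D / B, the vector v - E^(2k) v lies in this range, and E^(2k) v
    tends to a vector fixed by E^2, which is null because D is injective. *)
Lemma psd_gap (D : V -> V) B s : complete_ip ->
  (forall u v, ip (D u) v = ip u (D v)) -> (forall u, 0 <= ip (D u) u) ->
  0 < B -> (forall u, ip (D u) u <= B * ip u u) -> 0 < s ->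
  (forall t, 0 < t < s ->
     exists2 b, 0 < b & forall u, b * ip u u <= ip (D u - t *: u) (D u - t *: u)) ->
  (forall u, ip (D u) (D u) = 0 -> ip u u = 0) ->
  forall u, s * ip u u <= ip (D u) u.
Proof.
move=> Vc Dsym D0 B0 DB s0 Ds Dker.
have Dsq := psd_sqr_le ipP Dsym D0 DB.
(* |D u - (s / 2) u| >= (s / 2) |u|, squared and expanded *)
have DD u : s * ip (D u) u <= ip (D u) (D u).
  pose K u := D u - (s / 2) *: u.
  have Ksym := sym_shift ipP Dsym (s / 2).
  have KB u' : ip (K u') (K u') <= (2 * (B * B) + 2 * (s / 2) ^+ 2) * ip u' u'.
    rewrite (le_trans (ip_sqrD_le ipP _ _))// [leRHS]mulrDl lerD//.
      rewrite -mulrA ler_pM2l// (le_trans (Dsq u'))// -mulrA ler_pM2l//.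
    by rewrite (ipNl ipP) (ipNr ipP) (ipZl ipP) (ipZr ipP); lra.
  have s20 : 0 < s / 2 by rewrite divr_gt0.
  have Kb t : `|t| < s / 2 -> exists2 b, 0 < b &
      forall u, b * ip u u <= ip (K u - t *: u) (K u - t *: u).
    rewrite ltr_norml => /andP[t1 t2].
    have [|b b0 Hb] := Ds (s / 2 + t); first by apply/andP; split; lra.
    by exists b => // x; rewrite (le_trans (Hb x))// /K scalerDl opprD addrA.
  have := sym_gap Ksym KB s20 Kb u.
  rewrite /K (ip_sqrB ipP) !(ipZl ipP) !(ipZr ipP); nra.
(* The hypothesis says v = D u up to a null vector. *)
have ranD u v : (forall w, ip v w = ip (D u) w) -> s * ip v v <= ip (D v) v.
  move=> vD; have v0 := ip_ge0 ipP v.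
  have [v00|vn0] := eqVneq (ip v v) 0; first by rewrite v00 mulr0.
  have vp : 0 < ip v v by rewrite lt_def vn0.
  have := cauchy_schwarz (psd_form ipP Dsym D0) u v.
  rewrite -vD => cs; have := DD u.
  have -> : ip (D u) (D u) = ip v v by apply: (ip_weak_eq ipP) => w; rewrite vD.
  move=> H; rewrite -(ler_pM2r vp) -mulrA -expr2.
  rewrite (le_trans (ler_wpM2l (ltW s0) cs))// mulrA [leRHS]mulrC ler_wpM2r//.
pose E u := u - B^-1 *: D u.
have Esym u v : ip (E u) v = ip u (E v).
  by rewrite (ipBl ipP) (ipBr ipP) (ipZl ipP) (ipZr ipP) Dsym.
have EE u : ip (E u) u = ip u u - B^-1 * ip (D u) u.
  by rewrite (ipBl ipP) (ipZl ipP).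
have E0 u : 0 <= ip (E u) u by rewrite EE subr_ge0 mulrC ler_pdivrMr// mulrC.
have E1 u : ip (E u) u <= 1 * ip u u.
  by rewrite EE mul1r gerBl mulr_ge0// invr_ge0 ltW.
have Esq u : ip (E u) (E u) <= ip (E u) u.
  by rewrite (le_trans (psd_sqr_le ipP Esym E0 E1 u))// mul1r.
move=> v; pose w k := iter k (E \o E) v; pose b k := ip (iter k E v) (iter k E v).
have itE m k : ip (iter m E v) (iter k E v) = ip (iter (m + k) E v) v.
  elim: k m => [|k IH] m; first by rewrite addn0.
  by rewrite -addSnnS -IH/= Esym.
have wE k : w k = iter k.*2 E v.
  by rewrite /w; elim: k => //= k ->.
(* Even powers make the inner products of the iterates values of the single
   monotone sequence b, so that convergence of b makes w a Cauchy sequence. *)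
have wip m k : ip (w m) (w k) = b (m + k)%N.
  by rewrite !wE /b !itE addnn doubleD.
have bdec k : b k.+1 <= b k.
  by rewrite /b/= (le_trans (Esq _))// (le_trans (E1 _))// mul1r.
have b0 k : 0 <= b k by exact: ip_ge0 ipP _.
have bmono m k : (m <= k)%N -> b k <= b m.
  move=> mk; rewrite -(subnK mk); elim: (k - m)%N => [|i IH]; rewrite ?add0n// addSn.
  exact: le_trans (bdec _) IH.
have bcvg : exists l, forall e, 0 < e ->
    exists N, forall k, (N <= k)%N -> l <= b k <= l + e.
  exists (inf (range b)) => e e0.
  have hb : has_inf (range b).
    by split; [exists (b 0%N); exists 0%N|exists 0 => _ [k _ <-]].
  have [_ [N _ <-] H] := inf_adherent e0 hb.
  exists N => k Nk; apply/andP; split; last by rewrite (le_trans (bmono _ _ Nk))// ltW.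
  by apply: ge_inf; [case: hb|exists k].
have [x wx] : exists x, forall e : R, 0 < e -> exists N, forall k, (N <= k)%N ->
     ip (w k - x) (w k - x) <= e.
  apply: Vc => e e0; have [l bl] := bcvg.
  have [|N HN] := bl (e / 2); first by rewrite divr_gt0.
  exists N => m k Nm Nk; rewrite (ip_sqrB ipP) !wip.
  have /andP[_ h1] := HN (m + m)%N (leq_trans Nm (leq_addr _ _)).
  have /andP[_ h2] := HN (k + k)%N (leq_trans Nk (leq_addr _ _)).
  have /andP[h3 _] := HN (m + k)%N (leq_trans Nm (leq_addr _ _)).
  lra.
have E2 u : ip (E (E u)) (E (E u)) <= ip u u.
  rewrite (le_trans (Esq _))// (le_trans (E1 _))// mul1r.
  by rewrite (le_trans (Esq _))// (le_trans (E1 _))// mul1r.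
have xfix : ip (E (E x) - x) (E (E x) - x) = 0.
  apply/eqP; rewrite eq_le (ip_ge0 ipP) andbT; apply/ler_addgt0Pl => e e0.
  have [|N HN] := wx (e / 4); first by rewrite divr_gt0.
  have h1 := HN _ (leqnn N); have h2 := HN _ (leqnSn N).
  rewrite addr0 (_ : E (E x) - x = (E (E x) - w N.+1) + (w N.+1 - x)); last first.
    by rewrite addrA subrK.
  rewrite (le_trans (ip_sqrD_le ipP _ _))//.
  have -> : ip (E (E x) - w N.+1) (E (E x) - w N.+1) =
            ip (E (E (w N - x))) (E (E (w N - x))).
    transitivity (ip (- E (E (w N - x))) (- E (E (w N - x)))).
      apply: (ip_weak_eq ipP) => y; rewrite (ipNl ipP) (ipBl ipP).
      by rewrite (_ : w N.+1 = E (E (w N)))// !Esym (ipBl ipP) opprB.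
    by rewrite (ipNl ipP) (ipNr ipP) opprK.
  have := E2 (w N - x); lra.
have xx : ip (E (E x)) x = ip x x.
  by apply/eqP; rewrite -subr_eq0 -(ipBl ipP) (ip_null ipP).
have x0 : ip x x = 0.
  apply: Dker; apply/eqP; rewrite eq_le (ip_ge0 ipP) andbT.
  rewrite (le_trans (Dsq x))// pmulr_rle0//.
  have := Esq x; rewrite -Esym xx EE => H.
  have : B^-1 * ip (D x) x <= 0 by lra.
  by rewrite pmulr_rle0 ?invr_gt0.
have w0 e : 0 < e -> exists N, forall k, (N <= k)%N -> ip (w k) (w k) <= e.
  move=> e0; have [N HN] := wx e e0; exists N => k /HN.
  by rewrite (ip_sqrB ipP) x0 (ipC ipP) (ip_null ipP _ x0) mulr0 subr0 addr0.
have wran k : exists u, forall y, ip (v - w k) y = ip (D u) y.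
  rewrite wE; elim: k.*2 => [|j [u Hu]].
    by exists 0 => y; rewrite subrr (ip0l ipP) Dsym (ip0l ipP).
  exists (B^-1 *: iter j E v + u) => y.
  rewrite (sym_linear ipP Dsym) -Hu /= !(ipBl ipP) (ipZl ipP); ring.
apply/ler_addgt0Pl => e e0.
have DN := ip_ge0 ipP (D v); have vN := ip_ge0 ipP v.
(* The inequality holds for v - y; all terms that involve y together are at most
   e, because those linear in y are controlled through Cauchy-Schwarz by M. *)
pose M := ip (D v) (D v) + s ^+ 2 * ip v v + 1.
have M0 : 0 < M by rewrite /M ltr_wpDl// addr_ge0// mulr_ge0// sqr_ge0.
have [|N HN] := w0 (Num.min (e / 2 / B) (e ^+ 2 / (64 * M))).
  by rewrite lt_min !divr_gt0// ?exprn_gt0// mulr_gt0.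
have := HN _ (leqnn N); rewrite le_min => /andP[h1 h2].
have [u Hu] := wran N; have := ranD u _ Hu.
set y := w N in h1 h2 *.
have -> : ip (D (v - y)) (v - y) = ip (D v) v - 2 * ip (D v) y + ip (D y) y.
  by rewrite (ip_sqrB (psd_form ipP Dsym D0)).
rewrite (ip_sqrB ipP).
have smallip (z : V) : ip z z <= M -> `|ip z y| <= e / 8.
  move=> zM; rewrite -(ler_pXn2r (ltn0Sn 1)) ?nnegrE//; last by rewrite divr_ge0// ltW.
  rewrite real_normK ?num_real// (le_trans (cauchy_schwarz ipP z y))//.
  rewrite (le_trans (ler_pM (ip_ge0 ipP _) (ip_ge0 ipP _) zM h2))//.
  by rewrite le_eqVlt; apply/orP; left; apply/eqP; field; rewrite gt_eqF.
have a1 : `|ip (D v) y| <= e / 8.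
  by apply: smallip; rewrite /M -addrA lerDl addr_ge0// mulr_ge0// sqr_ge0.
have a2 : `|ip (s *: v) y| <= e / 8.
  by apply: smallip; rewrite /M (ipZl ipP) (ipZr ipP) mulrA -expr2; lra.
have a3 : ip (D y) y <= e / 2.
  by rewrite (le_trans (DB y))// mulrC -ler_pdivlMr.
move: a1 a2; rewrite (ipZl ipP) !ler_norml => /andP[a1 a1'] /andP[a2 a2'].
have yN : 0 <= s * ip y y by rewrite mulr_ge0 ?(ip_ge0 ipP)// ltW.
lra.
Qed.

(** Let M be the least upper bound of H that is at least m0.  If m0 < M, then
    M - H is nonnegative and injective with a spectral gap above 0, so by psd_gap
    it is at least d > 0, contrary to the choice of M. *)
Theorem sym_upper_bound (H : V -> V) m0 : complete_ip -> 0 < m0 ->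
  (forall u v, ip (H u) v = ip u (H v)) -> (forall u, 0 <= ip (H u) u) ->
  (forall u, ip (H u) u <= ip u u) ->
  (forall M, m0 < M -> exists2 d, 0 < d & forall t, M - d < t < M ->
     exists2 b, 0 < b & forall u, b * ip u u <= ip (H u - t *: u) (H u - t *: u)) ->
  (forall M u, m0 < M -> ip (H u - M *: u) (H u - M *: u) = 0 -> ip u u = 0) ->
  forall u, ip (H u) u <= m0 * ip u u.
Proof.
move=> Vc m00 Hsym H0 H1 Hgap Hker.
pose S := [set M : R | m0 <= M /\ forall u, ip (H u) u <= M * ip u u].
have hS : has_inf S.
  split; last by exists m0 => M [].
  exists (m0 + 1); split; first by rewrite lerDl.
  move=> u; rewrite (le_trans (H1 u))// mulrDl mul1r lerDr mulr_ge0 ?(ltW m00)//.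
  exact: ip_ge0 ipP _.
set M := inf S.
have mM : m0 <= M by apply: lb_le_inf; [case: hS|move=> ? []].
have SM u : ip (H u) u <= M * ip u u.
  rewrite leNgt; apply/negP => L.
  have u0 : 0 < ip u u.
    rewrite lt_def (ip_ge0 ipP) andbT; apply/eqP => u0.
    by move: L; rewrite u0 mulr0 Hsym (ip_null ipP)// ltxx.
  move: L; rewrite -ltr_pdivlMr// => /(inf_lt (proj1 hS))[t [_ tu]].
  by rewrite ltr_pdivlMr// ltNge tu.
move: mM; rewrite le_eqVlt => /predU1P[->//|mM].
have [d d0 Hd] := Hgap M mM.
have Mp : 0 < M by exact: lt_trans mM.
pose D u := M *: u - H u.
have Dsym u v : ip (D u) v = ip u (D v).
  by rewrite (ipBl ipP) (ipBr ipP) Hsym (ipZl ipP) (ipZr ipP).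
have DE u : ip (D u) u = M * ip u u - ip (H u) u by rewrite (ipBl ipP) (ipZl ipP).
have opp (x : V) : ip x x = ip (- x) (- x) by rewrite (ipNl ipP) (ipNr ipP) opprK.
have : forall u, d * ip u u <= ip (D u) u.
  apply: (@psd_gap D M) => //.
  - by move=> u; rewrite DE subr_ge0.
  - by move=> u; rewrite DE gerBl.
  - move=> t /andP[t0 td]; have [|b b0 Hb] := Hd (M - t).
      by apply/andP; split; lra.
    exists b => // u; rewrite (le_trans (Hb u))// opp le_eqVlt; apply/orP; left.
    apply/eqP; congr (ip _ _); rewrite /D scalerBl !opprB;
      by rewrite addrAC.
  - move=> u; rewrite opp opprB; exact: Hker.
move=> HdD.
have : S (Num.max m0 (M - d)).
  split; first by rewrite le_max lexx.
  move=> u; have := HdD u; rewrite DE => h.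
  have : ip (H u) u <= (M - d) * ip u u by rewrite mulrBl; lra.
  move/le_trans; apply; rewrite ler_wpM2r ?(ip_ge0 ipP)// le_max lexx orbT//.
move=> /(ge_inf (proj2 hS)); rewrite -/M leNgt gt_max mM/= ltrBlDr ltrDl d0//.
Qed.

End gap.

(** * Linear subspaces, Bessel inequality and orthonormalization *)

Definition lin_closed (R : realType) (V : lmodType R) (W : set V) :=
  W 0 /\ forall a u v, W u -> W v -> W (a *: u + v).

Lemma lin_closed_sum (R : realType) (V : lmodType R) (W : set V) d
    (c : nat -> R) (e : nat -> V) : lin_closed W ->
  (forall j, (j < d)%N -> W (e j)) -> W (\sum_(j < d) c j *: e j).
Proof.
move=> [W0 WD]; elim: d => [|d IH] We; first by rewrite big_ord0.
rewrite big_ord_recr/= addrC; apply: WD; first exact: We.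
by apply: IH => j jd; apply: We; exact: leqW.
Qed.

Section orthonormal.
Context (R : realType) (V : lmodType R) (ip : V -> V -> R).
Hypothesis ipP : semi_inner ip.

(** Expand |B u - \sum_i ip u (e i) *: e i|^2 >= 0. *)
Lemma bessel_le (I : finType) (e : I -> V) B (u : V) : 0 < B ->
  (forall c : I -> R, ip (\sum_i c i *: e i) (\sum_i c i *: e i) <=
                      B * \sum_i c i ^+ 2) ->
  \sum_i ip u (e i) ^+ 2 <= B * ip u u.
Proof.
move=> B0 He; set S := \sum_i _.
pose c i := ip u (e i).
have := ip_ge0 ipP (B *: u - \sum_i c i *: e i).
rewrite (ip_sqrB ipP) !(ipZl ipP) (ipZr ipP) (ip_sumr ipP).
under eq_bigr do rewrite (ipZr ipP) -expr2.
have := He c; rewrite -/S -/(c _) => H1 H2.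
have : 0 <= B * (B * ip u u - S).
  by rewrite -/S in H2; rewrite /S /c in H1 H2 *; nra.
by rewrite pmulr_rge0// subr_ge0.
Qed.

Lemma bessel_orthogonal (I : finType) (e : I -> V) B (u : V) : 0 < B ->
  (forall i j, ip (e i) (e j) = B * (i == j)%:R) ->
  \sum_i ip u (e i) ^+ 2 <= B * ip u u.
Proof.
move=> B0 on; apply: bessel_le => // c.
rewrite (ip_suml ipP) le_eqVlt; apply/orP; left; apply/eqP.
rewrite mulr_sumr; apply: eq_bigr => i _; rewrite (ip_sumr ipP) (bigD1 i)//=.
rewrite big1 => [|j ji]; rewrite (ipZr ipP) (ipZl ipP) on.
  by rewrite addr0 eqxx mulr1 expr2 mulrC -!mulrA mulrC -mulrA.
by rewrite eq_sym (negbTE ji) !mulr0.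
Qed.

Lemma bessel (I : finType) (e : I -> V) (u : V) :
  (forall i j, ip (e i) (e j) = (i == j)%:R) ->
  \sum_i ip u (e i) ^+ 2 <= ip u u.
Proof.
move=> on; rewrite -[leRHS]mul1r; apply: bessel_orthogonal => // i j.
by rewrite mul1r.
Qed.

(** Freeness is required modulo null vectors, and equality of spans is expressed
    through the linear subspaces W that contain the vectors. *)
Lemma gram_schmidt (d : nat) (e : nat -> V) :
  (forall c : nat -> R,
     ip (\sum_(j < d) c j *: e j) (\sum_(j < d) c j *: e j) = 0 ->
     forall j, (j < d)%N -> c j = 0) ->
  exists o : nat -> V,
  [/\ forall i j, (i < d)%N -> (j < d)%N -> ip (o i) (o j) = (i == j)%:R,
      forall W, lin_closed W -> (forall j, (j < d)%N -> W (e j)) ->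
         forall j, (j < d)%N -> W (o j)
    & forall W, lin_closed W -> (forall j, (j < d)%N -> W (o j)) ->
         forall j, (j < d)%N -> W (e j)].
Proof.
elim: d => [|d IH] free; first by exists (fun=> 0).
have [|o [on oe eo]] := IH.
  move=> c c0 j jd; have := free (fun i => if (i < d)%N then c i else 0).
  rewrite big_ord_recr/= ltnn scale0r addr0.
  have -> : \sum_(i < d) (if (i < d)%N then c i else 0) *: e i =
            \sum_(i < d) c i *: e i.
    by apply: eq_bigr => i _; rewrite ltn_ord.
  by move=> /(_ c0 j (ltnW jd)); rewrite jd.
pose p := \sum_(j < d) ip (e d) (o j) *: o j; pose r := e d - p.
have rn0 : ip r r != 0.
  apply/eqP => r0.
  have [c pE] : exists c : nat -> R, p = \sum_(j < d) c j *: e j.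
    apply: (@lin_closed_sum _ _
      [set v | exists c : nat -> R, v = \sum_(j < d) c j *: e j] d
      (fun j => ip (e d) (o j)) o).
      split; first by exists (fun=> 0); rewrite big1// => i _; rewrite scale0r.
      move=> a _ _ [c1 ->] [c2 ->]; exists (fun j => a * c1 j + c2 j).
      rewrite scaler_sumr -big_split/=; apply: eq_bigr => i _.
      by rewrite scalerDl scalerA.
    apply: oe.
      split; first by exists (fun=> 0); rewrite big1// => i _; rewrite scale0r.
      move=> a _ _ [c1 ->] [c2 ->]; exists (fun j => a * c1 j + c2 j).
      rewrite scaler_sumr -big_split/=; apply: eq_bigr => i _.
      by rewrite scalerDl scalerA.
    move=> j jd; exists (fun i => (i == j)%:R).
    rewrite (bigD1 (Ordinal jd))//= eqxx scale1r big1 ?addr0// => i.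
    by rewrite -val_eqE/= => /negbTE ->; rewrite scale0r.
  have := free (fun i => if (i < d)%N then - c i else 1).
  rewrite big_ord_recr/= ltnn scale1r.
  have -> : \sum_(i < d) (if (i < d)%N then - c i else 1) *: e i = - p.
    by rewrite pE -sumrN; apply: eq_bigr => i _; rewrite ltn_ord scaleNr.
  rewrite addrC -/r => /(_ r0 d (ltnSn d)); rewrite ltnn => /eqP.
  by rewrite oner_eq0.
have rp : 0 < ip r r by rewrite lt_def rn0 (ip_ge0 ipP).
pose s := Num.sqrt (ip r r).
have s0 : 0 < s by rewrite sqrtr_gt0.
have ro j : (j < d)%N -> ip r (o j) = 0.
  move=> jd; rewrite (ipBl ipP) (ip_suml ipP) (bigD1 (Ordinal jd))//=.
  rewrite (ipZl ipP) on// eqxx mulr1 big1 ?addr0 ?subrr// => i.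
  rewrite -val_eqE/= => ij; rewrite (ipZl ipP) on// (negbTE ij) mulr0//.
pose o' i := if (i < d)%N then o i else s^-1 *: r.
have o'd : o' d = s^-1 *: r by rewrite /o' ltnn.
have o'i i : (i < d)%N -> o' i = o i by rewrite /o' => ->.
have ltSP i : (i < d.+1)%N -> i = d \/ (i < d)%N.
  by rewrite ltnS leq_eqVlt => /predU1P.
exists o'; split.
- move=> i j /ltSP[->|id] /ltSP[->|jd].
  + rewrite o'd (ipZl ipP) (ipZr ipP) eqxx -(sqr_sqrtr (ltW rp)) -/s.
    by rewrite -[RHS]/(1 : R); field; rewrite gt_eqF.
  + by rewrite o'd o'i// (ipZl ipP) ro// mulr0 eq_sym (ltn_eqF jd).
  + by rewrite o'd o'i// (ipZr ipP) (ipC ipP) ro// mulr0 (ltn_eqF id).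
  + by rewrite !o'i// on.
- move=> W Wc We; have Wo := oe W Wc (fun j jd => We j (leqW jd)).
  move=> j /ltSP[->|jd]; last by rewrite o'i//; exact: Wo.
  have Wp : W p by apply: (lin_closed_sum (fun j => ip (e d) (o j)) Wc Wo).
  have Wr : W r.
    by rewrite /r addrC -scaleN1r; apply: (proj2 Wc) => //; exact: We.
  by rewrite o'd -[_ *: _]addr0; apply: (proj2 Wc) => //; case: Wc.
- move=> W Wc Wo'.
  have Wo j : (j < d)%N -> W (o j).
    by move=> jd; rewrite -o'i//; apply: Wo'; exact: leqW.
  move=> j /ltSP[->|jd]; last exact: eo.
  rewrite -(subrK p (e d)) -/r -[r]scale1r -(mulfV (lt0r_neq0 s0)) -scalerA -o'd.
  apply: (proj2 Wc); first exact: Wo'.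
  exact: (lin_closed_sum (fun j => ip (e d) (o j)) Wc Wo).
Qed.

End orthonormal.

(** * Lebesgue measure and integration on R^n *)

Lemma lebesgue_measure_affine (R : realType) (r c : R) (A : set R) : 0 < r ->
  measurable A ->
  (r%:E * lebesgue_measure ((fun x => (r * x + c)%R) @^-1` A) = lebesgue_measure A)%E.
Proof.
move=> r0 mA; pose T (x : measurableTypeR R) : measurableTypeR R := r * x + c.
have mT : measurable_fun setT T.
  by apply: measurable_funD => //; apply: measurable_funM.
pose rn := NngNum (ltW r0).
rewrite [RHS](@lebesgue_measure_unique R (mscale rn
  (measure_function_pushforward__canonical__measure_function_Measure
     (@lebesgue_measure R) mT)))//.
move=> _ [[a b] _ <-]/=; rewrite /mscale/= /pushforward.
rewrite (_ : _ @^-1` _ = `](a - c) / r, (b - c) / r]%classic); last first.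
  apply/seteqP; split => x /=; rewrite !in_itv/= /T ltr_pdivrMr// ler_pdivlMr//.
    by rewrite ltrBlDr lerBrDr mulrC.
  by rewrite ltrBlDr lerBrDr mulrC.
rewrite !lebesgue_measure_itv/= !lte_fin ltr_pM2r ?invr_gt0// ltrD2r.
case: ifPn => _; last by rewrite mule0.
by rewrite -!EFinB -EFinM; congr EFin; field; rewrite gt_eqF.
Qed.

Section rV.
Context (R : realType).

Lemma measurable_rV_affine n (r : R) (a : 'rV[R]_n) :
  measurable_fun setT (fun v : 'rV[R]_n => r *: v + a).
Proof.
apply: measurable_fun_rV => i.
rewrite (_ : _ \o _ = fun v => r * rV_coord i v + a 0 i); last first.
  by apply/funext => v; rewrite /rV_coord/= !mxE.
apply: measurable_funD => //; apply: measurable_funM => //.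
exact: measurable_rV_coord.
Qed.

Lemma lebesgue_rV_affine n (r : R) (a : 'rV[R]_n) (A : set 'rV[R]_n) : 0 < r ->
  measurable A ->
  ((r ^+ n)%:E * lebesgue_rV R n ((fun v => r *: v + a)%R @^-1` A)
   = lebesgue_rV R n A)%E.
Proof.
move=> r0; elim: n a A => [|n IH] a A mA.
  rewrite expr0 mul1e/=; congr (dirac _ _).
  by apply/seteqP; split => x /=; rewrite [_ + _]thinmx0 [x]thinmx0.
pose a0 := a 0 ord0; pose a' : 'rV[R]_n := \row_i a 0 (lift ord0 i).
pose T (p : measurableTypeR R * 'rV[R]_n) : measurableTypeR R * 'rV[R]_n :=
  (r * p.1 + a0, r *: p.2 + a').
have mT : measurable_fun setT T.
  apply/measurable_fun_pairP; split.
    by apply: measurable_funD => //; apply: measurable_funM.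
  exact: (measurableT_comp (measurable_rV_affine r a') measurable_snd).
have rn0 : 0 <= r ^+ n.+1 by rewrite exprn_ge0// ltW.
have mcA : measurable (@rV_cons R n @^-1` A).
  by rewrite -[X in measurable X]setTI; exact: measurable_rV_cons.
have TE : @rV_cons R n @^-1` ((fun v => r *: v + a) @^-1` A) =
    T @^-1` (@rV_cons R n @^-1` A).
  apply/seteqP; split => -[x v] /=;
  rewrite (_ : rV_cons (T (x, v)) = r *: rV_cons (x, v) + a)//;
  by apply/rowP => i; case: (unliftP ord0 i) => [j ->|->];
    rewrite !mxE ?unlift_none ?liftK/= ?mxE.
rewrite /= /lebesgue_rV_step /pushforward TE.
rewrite [RHS](@product_measure_unique _ _ _ _ R _ (lebesgue_rV R n) (mscale (NngNum rn0)
  (measure_function_pushforward__canonical__measure_function_Measure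
     (lebesgue_measure \x lebesgue_rV R n)%E mT)))//.
move=> X Y mX mY.
transitivity ((r ^+ n.+1)%:E * (lebesgue_measure \x lebesgue_rV R n)
  (((fun x => (r * x + a0)%R) @^-1` X) `*`
   ((fun v => (r *: v + a')%R) @^-1` Y)))%E => //.
rewrite product_measure1E//; last 2 first.
- rewrite -[X in measurable X]setTI.
  have : measurable_fun setT (fun x : measurableTypeR R => r * x + a0).
    by apply: measurable_funD => //; apply: measurable_funM.
  by apply.
- by rewrite -[X in measurable X]setTI; apply: measurable_rV_affine.
rewrite exprS EFinM muleACA; congr (_ * _)%E; last exact: IH.
exact: lebesgue_measure_affine.
Qed.

Lemma measurable_rV_box n (I : set R) : measurable I ->
  measurable [set v : 'rV[R]_n | forall i, I (v 0 i)].
Proof.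
move=> mI; rewrite (_ : [set _ | _] =
    \bigcap_(i in [set: 'I_n]) (@rV_coord R n i @^-1` I)).
  apply: fin_bigcap_measurable; first exact: finite_finset.
  move=> i _; rewrite -[X in measurable X]setTI.
  exact: measurable_rV_coord.
by apply/seteqP; split => v Hv i; [move=> _|]; exact: Hv.
Qed.

Lemma lebesgue_rV_box n (I : set R) (l : R) : measurable I ->
  lebesgue_measure I = l%:E ->
  lebesgue_rV R n [set v | forall i, I (v 0 i)] = (l ^+ n)%:E.
Proof.
move=> mI Il; elim: n => [|n IH].
  by rewrite /= diracE expr0 mem_set// => -[].
rewrite /= /lebesgue_rV_step /pushforward.
rewrite (_ : _ @^-1` _ = I `*` [set v : 'rV[R]_n | forall i, I (v 0 i)]).
  rewrite product_measure1E//; last exact: measurable_rV_box.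
  rewrite exprS EFinM; congr (_ * _)%E => //.
apply/seteqP; split => -[x v] /=.
  move=> H; split; first by have := H ord0; rewrite rV_consE0.
  by move=> i; have := H (lift ord0 i); rewrite rV_consES.
move=> [Ix Iv] i; case: (unliftP ord0 i) => [j ->|->].
  by rewrite rV_consES; exact: Iv.
by rewrite rV_consE0.
Qed.

Lemma lebesgue_rV_translate n (a : 'rV[R]_n) (A : set 'rV[R]_n) : measurable A ->
  lebesgue_rV R n ((fun v => v + a)%R @^-1` A) = lebesgue_rV R n A.
Proof.
move=> mA; rewrite -[RHS](lebesgue_rV_affine a ltr01 mA) expr1n mul1e.
by congr (lebesgue_rV _ _ _); apply/seteqP; split => v /=; rewrite scale1r.
Qed.

Lemma measurable_rV_translate n (a : 'rV[R]_n) :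
  measurable_fun setT (fun v : 'rV[R]_n => v + a).
Proof.
have := measurable_rV_affine 1 a.
by rewrite (_ : (fun v => 1 *: v + a) = (fun v => v + a))//; apply/funext => v;
  rewrite scale1r.
Qed.

Lemma Rintegral_rV_translate n (a : 'rV[R]_n) (f : 'rV[R]_n -> R) :
  measurable_fun setT f ->
  (lebesgue_rV R n).-integrable setT (EFin \o (fun v => f (v + a))) ->
  \int[lebesgue_rV R n]_v f (v + a) = \int[lebesgue_rV R n]_v f v.
Proof.
move=> mf fi; rewrite /Rintegral; congr fine.
have mT := measurable_rV_translate a.
transitivity (\int[pushforward (lebesgue_rV R n) (fun v => (v + a)%R)]_v (f v)%:E)%E.
  by rewrite (integral_pushforward mT)//=; exact/measurable_EFinP.
by apply: eq_measure_integral => A mA _; exact: lebesgue_rV_translate.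
Qed.

Lemma measurable_sqr_norm n :
  measurable_fun setT (fun v : 'rV[R]_n => \sum_i v 0 i ^+ 2).
Proof.
apply: measurable_sum => i; apply: measurable_funX.
exact: (@measurable_rV_coord R n i).
Qed.

Lemma measurable_rV_euclid_ball n (s : R) :
  measurable [set v : 'rV[R]_n | \sum_i v 0 i ^+ 2 < s].
Proof.
rewrite (_ : [set _ | _] = (fun v : 'rV[R]_n => \sum_i v 0 i ^+ 2) @^-1` `]-oo, s[).
  by rewrite -[X in measurable X]setTI; exact: measurable_sqr_norm.
by apply/seteqP; split => v; rewrite /= in_itv.
Qed.

Lemma lebesgue_rV_euclid_ball n (r : R) : 0 < r ->
  lebesgue_rV R n [set v | \sum_i v 0 i ^+ 2 < r ^+ 2] =
  ((r ^+ n)%:E * lebesgue_rV R n [set v | \sum_i v 0 i ^+ 2 < 1]%R)%E.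
Proof.
move=> r0; rewrite -(lebesgue_rV_affine 0 r0 (@measurable_rV_euclid_ball n _)).
congr (_ * lebesgue_rV _ _ _)%E; apply/seteqP.
have E (v : 'rV[R]_n) : \sum_i (r *: v + 0) 0 i ^+ 2 = r ^+ 2 * \sum_i v 0 i ^+ 2.
  by rewrite mulr_sumr; apply: eq_bigr => i _; rewrite !mxE addr0 exprMn.
split => v /=; by rewrite E gtr_pMr// exprn_gt0.
Qed.

Definition rV_box n (I : set R) : set 'rV[R]_n := [set v | forall i, I (v 0 i)].

Arguments rV_box : clear implicits.

Definition rV_tail n (v : 'rV[R]_n.+1) : 'rV[R]_n := \row_i v 0 (lift ord0 i).

Lemma rV_tail_cons n p : rV_tail (@rV_cons R n p) = p.2.
Proof. by apply/rowP => i; rewrite mxE rV_consES. Qed.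

Section product.
Variables (n : nat) (I : set R) (f : R -> R) (g : 'rV[R]_n -> R).
Hypotheses (mI : measurable I)
  (fi : lebesgue_measure.-integrable I (EFin \o f))
  (gi : (lebesgue_rV R n).-integrable (rV_box n I) (EFin \o g)).

Let f' : measurableTypeR R -> R := f \_ I.
Let g' := g \_ (rV_box n I).
Let h (p : measurableTypeR R * 'rV[R]_n) : \bar R := (f' p.1 * g' p.2)%:E.
Let F (v : 'rV[R]_n.+1) : R := f (v 0 ord0) * g (rV_tail v).

Let mb : measurable (rV_box n I). Proof. exact: measurable_rV_box. Qed.

Let f'i : lebesgue_measure.-integrable setT (EFin \o f').
Proof. by move/integrable_mkcond : fi; rewrite restrict_EFin; exact. Qed.

Let g'i : (lebesgue_rV R n).-integrable setT (EFin \o g').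
Proof. by move/integrable_mkcond : gi; rewrite restrict_EFin; exact. Qed.

Let mh : measurable_fun setT h.
Proof.
apply/measurable_EFinP; apply: measurable_funM.
  apply: (@measurableT_comp _ _ _ _ _ _ f') => //.
  by apply/measurable_EFinP; exact: measurable_int f'i.
apply: (@measurableT_comp _ _ _ _ _ _ g') => //.
by apply/measurable_EFinP; exact: measurable_int g'i.
Qed.

Let hi : (lebesgue_measure \x lebesgue_rV R n)%E.-integrable setT h.
Proof.
apply/integrable12ltyP => //.
have /integrableP[_ g'oo] := g'i.
have /integrableP[mf' f'oo] := f'i.
have mg' := measurable_int _ g'i.
rewrite (eq_integral (fun x => `|(f' x)%:E| *
   \int[lebesgue_rV R n]_y `|(g' y)%:E|))%E; last first.
  move=> x _; rewrite -ge0_integralZl//; last exact: measurableT_comp.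
  by apply: eq_integral => y _; rewrite /h/= normrM EFinM.
rewrite ge0_integralZr//; [|exact: measurableT_comp|exact: integral_ge0].
by rewrite lte_mul_pinfty// ?ge0_fin_numE// integral_ge0.
Qed.

Let patchE : ((EFin \o F) \_ (rV_box n.+1 I)) \o @rV_cons R n = h.
Proof.
apply/funext => -[x v]; rewrite /h /f' /g' [LHS]/= !patchE/=.
have -> : (rV_cons (x, v) \in rV_box n.+1 I) = (x \in I) && (v \in rV_box n I).
  apply/idP/andP; rewrite !inE.
    move=> H; split; first by have := H ord0; rewrite rV_consE0.
    by move=> i; have := H (lift ord0 i); rewrite rV_consES.
  move=> [Ix Iv] i; case: (unliftP ord0 i) => [j ->|->].
    by rewrite rV_consES; exact: Iv.
  by rewrite rV_consE0.
rewrite /F rV_consE0 rV_tail_cons.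
by case: (x \in I); case: (v \in _); rewrite /= ?mul0r ?mulr0.
Qed.

Let mF : measurable_fun setT ((EFin \o F) \_ (rV_box n.+1 I)).
Proof.
rewrite (_ : _ \_ _ = h \o @rV_uncons R n).
  by apply: measurableT_comp => //; exact: measurable_rV_uncons.
by rewrite -patchE; apply/funext => v /=; rewrite rV_unconsK.
Qed.

Lemma integrable_rV_box_mul :
  (lebesgue_rV R n.+1).-integrable (rV_box n.+1 I) (EFin \o F).
Proof.
apply/integrable_mkcond; first exact: measurable_rV_box.
apply: (@integrable_pushforward _ _ _ _ _ (@rV_cons R n)) => //.
  exact: measurable_rV_cons.
by rewrite preimage_setT patchE.
Qed.

Lemma Rintegral_rV_box_mul :
  \int[lebesgue_rV R n.+1]_(v in rV_box n.+1 I) F v =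
  (\int[lebesgue_measure]_(x in I) f x) *
  \int[lebesgue_rV R n]_(v in rV_box n I) g v.
Proof.
rewrite /Rintegral integral_mkcond.
transitivity (fine (\int[(lebesgue_measure \x lebesgue_rV R n)%E]_p h p)%E).
  congr fine; have := @integral_pushforward _ _ _ _ _ _ (@measurable_rV_cons R n)
    (lebesgue_measure \x lebesgue_rV R n)%E setT _ mF.
  by rewrite preimage_setT patchE; apply.
rewrite -integral12_prod_meas1//.
rewrite [in LHS](eq_integral (fun x => (f' x)%:E *
   \int[lebesgue_rV R n]_y (g' y)%:E))%E; last first.
  by move=> x _; exact: (integralZl measurableT g'i (f' x)).
have /fineK gE := integrable_fin_num measurableT g'i.
have /fineK fE := integrable_fin_num measurableT f'i.
rewrite -gE (integralZr measurableT f'i) -fE -EFinM /=.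
by rewrite [X in _ = fine X * _]integral_mkcond [X in _ = _ * fine X]integral_mkcond
  !restrict_EFin.
Qed.

End product.
End rV.
Arguments rV_box {R} n I.

(** * The space of square integrable functions *)

Record subspace (R : realType) (V : lmodType R) := Subspace {
  sset :> set V; ssetP : lin_closed sset }.

Section sub_of.
Context (R : realType) (V : lmodType R) (W : subspace V).

Definition subspace_pred : {pred V} := [pred v | `[< sset W v >]].

Lemma subspace_submod : submod_closed subspace_pred.
Proof.
have [W0 WD] := ssetP W; split; first exact/asboolP.
by move=> a u v /asboolP Wu /asboolP Wv; apply/asboolP/WD.
Qed.

HB.instance Definition _ := GRing.isSubmodClosed.Build R V subspace_pred
  subspace_submod.

(** A subspace as a module of its own, so that the abstract results on
    semi-inner products apply to it. *)
Record sub_of := SubOf { sval_of : V; _ : sval_of \in subspace_pred }.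

HB.instance Definition _ := [isSub for sval_of].
HB.instance Definition _ := [Choice of sub_of by <:].
HB.instance Definition _ := [SubChoice_isSubLmodule of sub_of by <:].

Lemma sub_ofP (u : sub_of) : sset W (sval_of u).
Proof. by case: u => u /= /asboolP. Qed.

Definition mk_sub (v : V) (Wv : sset W v) : sub_of := SubOf (asboolT Wv).

Lemma sub_of_inj (u v : sub_of) : sval_of u = sval_of v -> u = v.
Proof. exact: val_inj. Qed.

Lemma sub_ofD (u v : sub_of) : sval_of (u + v) = sval_of u + sval_of v.
Proof. exact: (raddfD (\val : sub_of -> V)). Qed.

Lemma sub_ofB (u v : sub_of) : sval_of (u - v) = sval_of u - sval_of v.
Proof. exact: (raddfB (\val : sub_of -> V)). Qed.

Lemma sub_ofZ a (u : sub_of) : sval_of (a *: u) = a *: sval_of u.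
Proof. by rewrite -[LHS]/(\val (a *: u)) linearZ. Qed.

Lemma sub_of_linear a (u v : sub_of) :
  sval_of (a *: u + v) = a *: sval_of u + sval_of v.
Proof. by rewrite sub_ofD sub_ofZ. Qed.

Lemma sub_of_sum (I : Type) (r : seq I) (P : pred I) (F : I -> sub_of) :
  sval_of (\sum_(i <- r | P i) F i) = \sum_(i <- r | P i) sval_of (F i).
Proof. exact: (raddf_sum (\val : sub_of -> V)). Qed.

End sub_of.

Section square_integrable.
Context d (T : measurableType d) (R : realType) (mu : {measure set T -> \bar R}).
Variable D : set T.
Hypothesis mD : measurable D.
Implicit Types u v : T -> R.

Definition sqint u := measurable_fun D u /\ mu.-integrable D (fun x => (u x ^+ 2)%:E).

Definition l2 u v : R := \int[mu]_(x in D) (u x * v x).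

Lemma sqint_mul u v : sqint u -> sqint v ->
  mu.-integrable D (fun x => (u x * v x)%:E).
Proof.
move=> [mu' iu] [mv iv].
apply: (le_integrable mD _ _ (integrableD mD iu iv)).
  by apply/measurable_EFinP; exact: measurable_funM.
move=> x _ /=; rewrite lee_fin normrM.
rewrite [leRHS]ger0_norm ?addr_ge0 ?sqr_ge0//.
rewrite -[u x ^+ 2]real_normK ?num_real// -[v x ^+ 2]real_normK ?num_real//.
have := sqr_ge0 (`|u x| - `|v x|); have := normr_ge0 (u x); have := normr_ge0 (v x).
nra.
Qed.

Lemma sqint_closed : lin_closed (sqint : set (T -> R)).
Proof.
split.
  split; first exact: measurable_cst.
  rewrite (_ : (fun x => _) = cst 0%E); first exact: integrable0.
  by apply/funext => x /=; rewrite expr0n.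
move=> a u v [mu' iu] [mv iv]; have mw : measurable_fun D (a *: u + v).
  by apply: measurable_funD => //; apply: measurable_funM.
split => //.
have := integrableD mD (integrableZl mD (2 * a ^+ 2) iu) (integrableZl mD 2 iv).
apply: le_integrable => //.
  by apply/measurable_EFinP; exact: measurable_funX.
move=> x _ /=; rewrite lee_fin ger0_norm ?sqr_ge0//.
rewrite [leRHS]ger0_norm; last first.
  have := sqr_ge0 (a * u x); have := sqr_ge0 (v x); lra.
have := sqr_ge0 (a * u x - v x).
rewrite [(_ + _) x](_ : _ = a * u x + v x)//; nra.
Qed.

Definition sqint_space : subspace (T -> R) := Subspace sqint_closed.

Definition l2sub (u v : sub_of sqint_space) : R :=
  l2 (sval_of u) (sval_of v).

Lemma l2_semi_inner : semi_inner l2sub.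
Proof.
split.
- by move=> u v; apply: eq_Rintegral => x _; rewrite mulrC.
- move=> a u v w; rewrite /l2sub /l2 sub_ofD sub_ofZ.
  have uw := sqint_mul (sub_ofP u) (sub_ofP w).
  have vw := sqint_mul (sub_ofP v) (sub_ofP w).
  rewrite -(RintegralZl _ mD uw) -RintegralD//; last exact: (integrableZl mD a uw).
  by apply: eq_Rintegral => x _; rewrite mulrA -mulrDl.
- by move=> u; apply: Rintegral_ge0 => x _; rewrite -expr2 sqr_ge0.
Qed.

Lemma integral_sqr u : sqint u ->
  (\int[mu]_(x in D) (u x ^+ 2)%:E)%E = (l2 u u)%:E.
Proof.
move=> [mu' iu]; rewrite /l2 /Rintegral fineK; last first.
  by apply: integrable_fin_num => //; apply: eq_integrable iu => // x _; rewrite expr2.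
by apply: eq_integral => x _; rewrite expr2.
Qed.

Section complete.
Variable w : nat -> T -> R.
Hypothesis sw : forall k, sqint (w k).
Hypothesis cw : forall e : R, 0 < e -> exists N, forall m k, (N <= m)%N ->
  (N <= k)%N -> l2 (w m - w k) (w m - w k) <= e.

Let sB m k : sqint (w m - w k).
Proof.
have [_ WD] := sqint_closed.
by rewrite addrC -scaleN1r; apply: WD.
Qed.

(** Along a subsequence y with |y_(j+1) - y_j|^2 <= 4^-j, the function
    H = \sum_j 2^j (y_(j+1) - y_j)^2 has a finite integral.  Where H is finite
    the increments are summable, since 2 |t| <= 2^j t^2 + 2^-j, so y converges
    almost everywhere; Fatou's lemma bounds the distance to the limit. *)
Lemma riesz_fischer : exists2 x, sqint x &
  forall e : R, 0 < e -> exists N, forall k, (N <= k)%N ->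
    l2 (w k - x) (w k - x) <= e.
Proof.
have ch j : exists N, forall m k, (N <= m)%N -> (N <= k)%N ->
  l2 (w m - w k) (w m - w k) <= 2^-1 ^+ (2 * j).
  by apply: cw; rewrite exprn_gt0// invr_gt0.
pose M j := projT1 (cid (ch j)).
have MP j m k : (M j <= m)%N -> (M j <= k)%N ->
  l2 (w m - w k) (w m - w k) <= 2^-1 ^+ (2 * j).
  by move=> *; apply: (projT2 (cid (ch j))).
pose p j := (\sum_(i < j.+1) (M i).+1)%N.
have Mp j : (M j <= p j)%N by rewrite /p big_ord_recr/= (leq_trans (leqnSn _))// leq_addl.
have pp j : (p j < p j.+1)%N by rewrite /p [leqRHS]big_ord_recr/= addnS ltnS leq_addr.
have jp j : (j <= p j)%N by elim: j => // j /leq_ltn_trans; apply; exact: pp.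
pose y j := w (p j).
have yd j : l2 (y j.+1 - y j) (y j.+1 - y j) <= 2^-1 ^+ (2 * j).
  by apply: MP; rewrite // (leq_trans (Mp j))// ltnW.
pose h j (x : T) : \bar R := (2 ^+ j * (y j.+1 x - y j x) ^+ 2)%:E.
have my j : measurable_fun D (y j) by case: (sw (p j)).
have mh j : measurable_fun D (h j).
  apply/measurable_EFinP; apply: measurable_funM => //; apply: measurable_funX.
  exact: measurable_funB.
have h0 j x : D x -> (0 <= h j x)%E.
  by move=> _; rewrite lee_fin mulr_ge0// sqr_ge0.
pose H x := (\sum_(0 <= j <oo) h j x)%E.
have H0 x : D x -> (0 <= H x)%E by move=> Dx; apply: nneseries_ge0 => j _ _; exact: h0.
have mH : measurable_fun D H by apply: ge0_emeasurable_sum => // j x Dx _; exact: h0.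
have HI : (\int[mu]_(x in D) H x < +oo)%E.
  rewrite integral_nneseries//.
  apply: (@le_lt_trans _ _ (\sum_(0 <= j <oo) ((2^-1 ^+ j : R)%:E))%E); last first.
    have -> : (\sum_(0 <= j <oo) ((2^-1 ^+ j : R)%:E))%E = 2%:E.
      apply/cvg_lim => //.
      rewrite (_ : (fun n => _) = EFin \o series (geometric 1 2^-1)); last first.
        apply/funext => n /=; rewrite sumEFin; congr EFin.
        by apply: eq_bigr => i _; rewrite /= mul1r.
      apply: cvg_EFin; first exact: nearW.
      have := @cvg_geometric_series R 1 2^-1.
      rewrite (_ : 1 / (1 - 2^-1) = 2 :> R); last by field.
      by apply; rewrite ger0_norm ?invr_ge0// invf_lt1// ltr1n.
    by rewrite ltry.
  apply: lee_nneseries => //.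
    by move=> j _ _; apply: integral_ge0 => x; exact: h0.
  move=> j _; rewrite (eq_integral (fun x => (2 ^+ j)%:E *
      (((y j.+1 - y j) x) ^+ 2)%:E)%E)//.
  have s1 : sqint (y j.+1 - y j) by exact: sB.
  rewrite integralZl//; last by case: s1.
  rewrite integral_sqr// -EFinM lee_fin.
  rewrite (le_trans (ler_wpM2l _ (yd j)))//.
  by rewrite mulnC exprM expr2 mulrA -exprMn divff ?expr1n ?mul1r.
have Hi : mu.-integrable D H.
  by apply/integrableP; split => //; rewrite (eq_integral H)// => x /set_mem Dx;
    rewrite gee0_abs// H0.
pose f x := fine (limn_esup (fun j => (y j x)%:E)).
have mf : measurable_fun D f.
  apply: (measurableT_comp (f := fine)); first exact: fine_measurable.
  by apply: measurable_fun_limn_esup => j; apply/measurable_EFinP.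
have yf x : D x -> H x \is a fin_num -> y ^~ x @ \oo --> f x.
  move=> Dx Hfin.
  have cd : cvgn (series (fun j => `|y j.+1 x - y j x|)).
    apply: nondecreasing_is_cvgn.
      by apply: nondecreasing_series => j _ _.
    exists (fine (H x) + 2) => _ [n _ <-].
    apply: (@le_trans _ _ (\sum_(0 <= j < n) (2 ^+ j * (y j.+1 x - y j x) ^+ 2 + 2^-1 ^+ j))).
      apply: ler_sum => j _; set t := _ - _.
      rewrite -[t ^+ 2]real_normK ?num_real//.
      have e0 : 0 < (2 : R) ^+ j by rewrite exprn_gt0.
      rewrite exprVn.
      have : 0 <= (2 ^+ j * `|t| - 1) ^+ 2 / 2 ^+ j.
        by rewrite divr_ge0 ?sqr_ge0 ?ltW.
      have -> : (2 ^+ j * `|t| - 1) ^+ 2 / 2 ^+ j = 2 ^+ j * `|t| ^+ 2 + (2 ^+ j)^-1 - 2 * `|t|.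
        by field; rewrite gt_eqF.
      have := normr_ge0 t; lra.
    rewrite big_split/= lerD//.
      rewrite -lee_fin fineK// -sumEFin.
      by apply: nneseries_lim_ge => *; exact: h0.
    have -> : \sum_(0 <= j < n) (2^-1 : R) ^+ j = 2 * (1 - 2^-1 ^+ n).
      elim: n => [|n IH]; first by rewrite big_geq// expr0 subrr mulr0.
      by rewrite big_nat_recr//= IH exprS; field.
    by rewrite ger_pMr// gerBl exprn_ge0// invr_ge0.
  have cy : cvgn (y ^~ x).
    have /cvg_ex[l sl] := normed_cvg cd.
    apply/cvg_ex; exists (y 0%N x + l).
    rewrite (_ : y ^~ x = (fun n => y 0%N x + series (fun j => y j.+1 x - y j x) n)).
      by apply: cvgD => //; exact: cvg_cst.
    apply/funext => n; rewrite /series/= telescope_sumr// addrC subrK//.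
  rewrite /f; move/cvg_ex : cy => [l yl].
  have /cvg_limn_einf_sup[_ ->] : EFin \o (y ^~ x) @ \oo --> l%:E.
    by apply: cvg_EFin => //; exact: nearW.
  exact: yl.
have Hae : {ae mu, forall x, D x -> H x \is a fin_num}.
  exact: integrable_ae.
have est e : 0 < e -> exists N, forall k, (N <= k)%N ->
   (\int[mu]_(x in D) ((w k x - f x) ^+ 2)%:E <= e%:E)%E.
  move=> e0; have [N HN] := cw e0; exists N => k Nk.
  pose g j x : \bar R := ((w k x - y j x) ^+ 2)%:E.
  have mg j : measurable_fun D (g j).
    apply/measurable_EFinP; apply: measurable_funX; apply: measurable_funB => //.
    by case: (sw k).
  rewrite (ae_eq_integral (fun x => limn_einf (g ^~ x)))//; last 3 first.
  - apply/measurable_EFinP; apply: measurable_funX; apply: measurable_funB => //.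
    by case: (sw k).
  - rewrite (_ : (fun x => _) = (fun x => - limn_esup (fun j => - g j x))%E).
      apply: measurableT_comp => //; apply: measurable_fun_limn_esup => j.
      exact: measurableT_comp.
    apply/funext => x; rewrite -[X in limn_einf X](_ : -%E \o (fun j => - g j x)%E = _).
      by rewrite limn_einfN.
    by apply/funext => j /=; rewrite opprK.
  - move: Hae; apply: filterS => x Hx Dx.
    have /cvg_limn_einf_sup[-> _]// : g ^~ x @ \oo --> ((w k x - f x) ^+ 2)%:E.
    apply: cvg_EFin; first exact: nearW.
    apply: (@continuous_cvg _ _ _ _ _ _ (fun t : R => (w k x - t) ^+ 2)).
      apply: (@continuous_comp _ _ _ (fun t : R => w k x - t) (fun t => t ^+ 2)).
        by apply: continuousB => //; exact: cvg_cst.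
      exact: exprn_continuous.
    exact: (yf x Dx (Hx Dx)).
  apply: le_trans (fatou mu mD mg _) _.
    by move=> j x _; rewrite lee_fin sqr_ge0.
  rewrite limn_einf_lim; apply: lime_le; first exact: is_cvg_einfs.
  exists N => // j /= Nj; apply: (@le_trans _ _ (\int[mu]_(x in D) g j x)%E).
    by apply: ereal_inf_lbound; exists j => /=.
  rewrite (integral_sqr (sB k (p j))) lee_fin; apply: HN => //.
  exact: leq_trans Nj (jp j).
have mwf k : measurable_fun D (w k - f).
  by apply: measurable_funB => //; case: (sw k).
have swf : exists k, sqint (w k - f).
  have [N /(_ _ (leqnn N)) HN] := est 1 ltr01; exists N; split => //.
  apply/integrableP; split.
    by apply/measurable_EFinP; exact: measurable_funX.
  apply: (@le_lt_trans _ _ 1%:E); last by rewrite ltry.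
  apply: le_trans HN; rewrite le_eqVlt; apply/orP; left; apply/eqP.
  by apply: eq_integral => x _; rewrite gee0_abs ?lee_fin ?sqr_ge0.
have [WD0 WD] := sqint_closed.
have sf : sqint f.
  have [k skf] := swf; rewrite -[f](subKr (w k)) addrC -scaleN1r.
  by apply: WD.
exists f => // e e0; have [N HN] := est e e0; exists N => k /HN.
have skf : sqint (w k - f) by rewrite addrC -scaleN1r; apply: WD.
by rewrite (integral_sqr skf) lee_fin.
Qed.

End complete.
End square_integrable.

(** * Orthogonality of exponentials in a cube *)

Section trig.
Context (R : realType).

Lemma sin_int_pi (k : int) : sin (k%:~R * pi) = 0 :> R.
Proof.
have H (m : nat) : sin (m%:R * pi) = 0 :> R.
  elim: m => [|m IH]; first by rewrite mul0r sin0.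
  by rewrite -addn1 natrD mulrDl mul1r sinDpi IH oppr0.
case: k => m; first exact: H.
by rewrite NegzE mulrNz mulNr sinN -pmulrn H oppr0.
Qed.

Definition dot n (y x : 'rV[R]_n) : R := \sum_i y 0 i * x 0 i.

Lemma measurable_dot n (y : 'rV[R]_n) : measurable_fun setT (dot y).
Proof.
apply: measurable_sum => i; apply: measurable_funM => //.
exact: (@measurable_rV_coord R n i).
Qed.

Lemma dot_recl n (y x : 'rV[R]_n.+1) :
  dot y x = y 0 ord0 * x 0 ord0 + dot (rV_tail y) (rV_tail x).
Proof.
by rewrite /dot big_ord_recl; congr (_ + _); apply: eq_bigr => i _; rewrite !mxE.
Qed.

Lemma measurable_cos_comp d (T : measurableType d) (f : T -> R) :
  measurable_fun setT f -> measurable_fun setT (fun x => cos (f x)).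
Proof.
exact: measurableT_comp (continuous_measurable_fun (@continuous_cos R)).
Qed.

Lemma measurable_sin_comp d (T : measurableType d) (f : T -> R) :
  measurable_fun setT f -> measurable_fun setT (fun x => sin (f x)).
Proof.
exact: measurableT_comp (continuous_measurable_fun (@continuous_sin R)).
Qed.

Lemma bounded_integrable d (T : measurableType d)
    (mu : {measure set T -> \bar R}) (D : set T) (f : T -> R) (M : R) :
  measurable D -> (mu D < +oo)%E -> measurable_fun D f ->
  (forall x, D x -> `|f x| <= M) -> mu.-integrable D (EFin \o f).
Proof.
move=> mD Doo mf fM; apply: measurable_bounded_integrable => //.
exists M; split; first exact: num_real.
by move=> N MN x Dx; rewrite /= (le_trans (fM x Dx))// ltW.
Qed.

Variable L : R.
Hypothesis L0 : 0 < L.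

Let I : set R := `[- L, L]%classic.

Lemma lebesgue_cube1 : lebesgue_measure I = (2 * L)%:E.
Proof.
rewrite lebesgue_measure_itv/= lte_fin ifT; last by rewrite gtrN.
by rewrite -EFinB opprK mulr_natl mulr2n.
Qed.

Lemma lebesgue_cube n : lebesgue_rV R n (rV_box n I) = ((2 * L) ^+ n)%:E.
Proof. by apply: lebesgue_rV_box; [exact: measurable_itv|exact: lebesgue_cube1]. Qed.

Lemma lebesgue_cube_lty n : (lebesgue_rV R n (rV_box n I) < +oo)%E.
Proof. by rewrite lebesgue_cube ltry. Qed.

Lemma integrable_cube_cos1 (a : R) :
  lebesgue_measure.-integrable I (EFin \o (fun x => cos (a * x))).
Proof.
apply: (@bounded_integrable _ _ _ _ _ 1); first exact: measurable_itv.
- by rewrite /= lebesgue_cube1 ltry.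
- by apply: measurable_funTS; apply: measurable_cos_comp; exact: mulrl_measurable.
- by move=> x _; exact: cos_max.
Qed.

Lemma integrable_cube_sin1 (a : R) :
  lebesgue_measure.-integrable I (EFin \o (fun x => sin (a * x))).
Proof.
apply: (@bounded_integrable _ _ _ _ _ 1); first exact: measurable_itv.
- by rewrite /= lebesgue_cube1 ltry.
- by apply: measurable_funTS; apply: measurable_sin_comp; exact: mulrl_measurable.
- by move=> x _; exact: sin_max.
Qed.

Lemma integral_primitive (F f : R -> R) :
  (forall x, is_derive x (1 : R) F (f x)) -> continuous f ->
  \int[lebesgue_measure]_(x in I) f x = F L - F (- L).
Proof.
move=> Ff cf; have cF : continuous F.
  move=> x; apply: differentiable_continuous; apply/derivable1_diffP.
  by have [] := Ff x.
rewrite /Rintegral (@continuous_FTC2 _ _ F)//.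
- by rewrite gtrN.
- exact: continuous_subspaceT.
- split; first by move=> x _; have [] := Ff x.
  + exact: cvg_at_right_filter (cF _).
  + exact: cvg_at_left_filter (cF _).
- by move=> x _; rewrite derive1E; have [_ ->] := Ff x.
Qed.

Lemma integral_cube_cos1 (k : int) :
  \int[lebesgue_measure]_(x in I) cos (pi / L * k%:~R * x) =
  if k == 0 then 2 * L else 0.
Proof.
case: eqP => [->|/eqP k0].
  under eq_Rintegral do rewrite mulr0 mul0r cos0.
  rewrite Rintegral_cst; last exact: measurable_itv.
  by rewrite mul1r; exact: (congr1 fine lebesgue_cube1).
set a := pi / L * k%:~R.
have a0 : a != 0.
  by rewrite !mulf_eq0 invr_eq0 intr_eq0 (gt_eqF L0) (gt_eqF (pi_gt0 R)) (negbTE k0).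
have dF (x : R) : is_derive x (1 : R) (fun x => a^-1 * sin (a * x)) (cos (a * x)).
  by apply: is_derive_eq; rewrite /GRing.scale/= !mulr1 mulrCA mulVf// mulr1.
rewrite (@integral_primitive _ (fun x => cos (a * x)) dF).
  have aL : a * L = k%:~R * pi by rewrite /a; field; rewrite gt_eqF.
  by rewrite mulrN sinN aL sin_int_pi oppr0 mulr0 subr0.
move=> x; apply: continuous_comp; last exact: continuous_cos.
exact: mulrl_continuous.
Qed.

Lemma integral_cube_sin1 (k : int) :
  \int[lebesgue_measure]_(x in I) sin (pi / L * k%:~R * x) = 0.
Proof.
have [->|k0] := eqVneq k 0.
  under eq_Rintegral do rewrite mulr0 mul0r sin0.
  by rewrite Rintegral_cst ?mul0r//; exact: measurable_itv.
set a := pi / L * k%:~R.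
have a0 : a != 0.
  by rewrite !mulf_eq0 invr_eq0 intr_eq0 (gt_eqF L0) (gt_eqF (pi_gt0 R)) (negbTE k0).
have dF (x : R) : is_derive x (1 : R) (fun x => - a^-1 * cos (a * x)) (sin (a * x)).
  apply: is_derive_eq; rewrite /GRing.scale/= !mulr1.
  by field; exact: a0.
rewrite (@integral_primitive _ (fun x => sin (a * x)) dF).
  by rewrite mulrN cosN subrr.
move=> x; apply: continuous_comp; last exact: continuous_sin.
exact: mulrl_continuous.
Qed.

(** By induction on the dimension: the addition formulas split cos (y.x) and
    sin (y.x) into products of functions of the first coordinate and of the other
    ones. *)
Lemma cube_orthogonality n (y : 'rV[R]_n) :
  (forall i, exists k : int, y 0 i = pi / L * k%:~R) ->
  [/\ (lebesgue_rV R n).-integrable (rV_box n I) (EFin \o (fun x => cos (dot y x))),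
      (lebesgue_rV R n).-integrable (rV_box n I) (EFin \o (fun x => sin (dot y x))),
      \int[lebesgue_rV R n]_(x in rV_box n I) cos (dot y x) =
        (if y == 0 then (2 * L) ^+ n else 0)
    & \int[lebesgue_rV R n]_(x in rV_box n I) sin (dot y x) = 0].
Proof.
have mI : measurable I by exact: measurable_itv.
elim: n y => [|n IH] y yk.
  have mb : measurable (rV_box 0 I) by exact: measurable_rV_box.
  split.
  - apply: (@bounded_integrable _ _ _ _ _ 1) => //.
    + exact: lebesgue_cube_lty.
    + apply: measurable_funTS; apply: measurable_cos_comp; exact: measurable_dot.
    + by move=> x _; exact: cos_max.
  - apply: (@bounded_integrable _ _ _ _ _ 1) => //.
    + exact: lebesgue_cube_lty.
    + apply: measurable_funTS; apply: measurable_sin_comp; exact: measurable_dot.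
    + by move=> x _; exact: sin_max.
  - rewrite ifT; last by apply/eqP; exact: thinmx0.
    under eq_Rintegral do rewrite /dot big_ord0 cos0.
    by rewrite Rintegral_cst// mul1r; exact: (congr1 fine (lebesgue_cube 0)).
  - under eq_Rintegral do rewrite /dot big_ord0 sin0.
    by rewrite Rintegral_cst// mul0r.
have [k yk0] := yk ord0.
have [|ci si cE sE] := IH (rV_tail y).
  by move=> i; have [l yl] := yk (lift ord0 i); exists l; rewrite mxE.
pose c0 x := cos (y 0 ord0 * x); pose s0 x := sin (y 0 ord0 * x).
have c0i := integrable_cube_cos1 (y 0 ord0).
have s0i := integrable_cube_sin1 (y 0 ord0).
have mb : measurable (rV_box n.+1 I) by exact: measurable_rV_box.
have cc := integrable_rV_box_mul mI c0i ci.
have cs := integrable_rV_box_mul mI c0i si.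
have sc := integrable_rV_box_mul mI s0i ci.
have ss := integrable_rV_box_mul mI s0i si.
have cosE (x : 'rV[R]_n.+1) : cos (dot y x) =
    cos (y 0 ord0 * x 0 ord0) * cos (dot (rV_tail y) (rV_tail x)) -
    sin (y 0 ord0 * x 0 ord0) * sin (dot (rV_tail y) (rV_tail x)).
  by rewrite dot_recl cosD.
have sinE (x : 'rV[R]_n.+1) : sin (dot y x) =
    sin (y 0 ord0 * x 0 ord0) * cos (dot (rV_tail y) (rV_tail x)) +
    cos (y 0 ord0 * x 0 ord0) * sin (dot (rV_tail y) (rV_tail x)).
  by rewrite dot_recl sinD.
have y0E : (y == 0) = (k == 0) && (rV_tail y == 0).
  have kE : (y 0 ord0 == 0) = (k == 0).
    by rewrite yk0 !mulf_eq0 invr_eq0 intr_eq0 (gt_eqF L0) (gt_eqF (pi_gt0 R)).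
  rewrite -kE; apply/eqP/andP => [->|[/eqP y00 /eqP yt]].
    by rewrite mxE; split=> //; apply/eqP/rowP => i; rewrite !mxE.
  apply/rowP => i; case: (unliftP ord0 i) => [j ->|->]; last by rewrite y00 mxE.
  by move/rowP : yt => /(_ j); rewrite !mxE.
split.
- apply: eq_integrable (integrableB mb cc ss) => // x _ /=.
  by rewrite -EFinB -cosE.
- apply: eq_integrable (integrableD mb sc cs) => // x _ /=.
  by rewrite -EFinD -sinE.
- under eq_Rintegral do rewrite cosE.
  rewrite (RintegralB mb cc ss) [X in X - _](Rintegral_rV_box_mul mI c0i ci).
  rewrite [X in _ - X](Rintegral_rV_box_mul mI s0i si) cE sE mulr0 subr0.
  rewrite yk0 integral_cube_cos1 y0E.
  by do 2 case: eqP => _ /=; rewrite ?mul0r ?mulr0// exprS.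
- under eq_Rintegral do rewrite sinE.
  rewrite (RintegralD mb sc cs) [X in X + _](Rintegral_rV_box_mul mI s0i ci).
  rewrite [X in _ + X](Rintegral_rV_box_mul mI c0i si) cE sE mulr0 addr0.
  by rewrite yk0 integral_cube_sin1 mul0r.
Qed.

End trig.

(** * Integration by parts and plane waves *)

Section rV_calculus.
Context (R : realType) (n : nat).
Implicit Types (f : 'rV[R]_n -> R) (x : 'rV[R]_n) (i : 'I_n).
Local Notation mu := (lebesgue_rV R n).

Lemma rV_entry_le_norm x i : `|x 0 i| <= `|x|.
Proof.
have /mapP[j Hj ->] : `|x 0 i| \in [seq `|x y.1 y.2| | y : 'I_1 * 'I_n].
  by apply/mapP; exists (ord0, i) => //=; rewrite mem_enum.
by rewrite [leRHS]/Num.Def.normr /= mx_normrE; apply/bigmax_geP; right => /=; exists j.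
Qed.

Lemma continuous_rV_measurable f : continuous f -> measurable_fun setT f.
Proof.
move=> /continuousP cf; apply: (measurability _ (RGenOpens.measurableE R)).
move=> _ [_ [a [b ->] <-]]; rewrite setTI; apply: measurable_rV_open.
exact/cf/interval_open.
Qed.

Lemma is_derive_line i f x t :
  (forall x, derivable f x (delta_mx 0 i)) ->
  is_derive t (1 : R) (fun s : R => f (s *: delta_mx 0 i + x))
    (partial i f (t *: delta_mx 0 i + x)).
Proof.
move=> df; set e := delta_mx 0 i; set g := fun s : R => _; set y := t *: e + x.
have E : (fun h => h^-1 *: ((g \o shift t) (h *: (1 : R)) - g t)) =
         (fun h => h^-1 *: ((f \o shift y) (h *: e) - f y)).
  apply/funext => h; rewrite /g /y /=; congr (_ *: (f _ - _)).
  by rewrite [h *: (1 : R)]mulr1 scalerDl addrA.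
apply: DeriveDef; first by rewrite /derivable E; exact: df.
by rewrite /derive E.
Qed.

Lemma bounded_rV_box (K : set 'rV[R]_n) : bounded_set K ->
  exists2 M, 0 < M & K `<=` rV_box n `[- M, M]%classic.
Proof.
move=> [M [_ HM]]; exists (`|M| + 1); first by rewrite ltr_wpDl.
move=> x Kx i /=; rewrite in_itv/= -ler_norml.
rewrite (le_trans (rV_entry_le_norm _ _))// HM//.
by rewrite (le_lt_trans (ler_norm M))// ltrDl.
Qed.

Lemma compact_support_bounded f (K : set 'rV[R]_n) : compact K ->
  continuous f -> (forall x, ~ K x -> f x = 0) ->
  exists2 C, 0 <= C & forall x, `|f x| <= C.
Proof.
move=> cK cf f0; have : compact (f @` K).
  by apply: continuous_compact => //; exact: continuous_subspaceT.
move=> /compact_bounded[M [_ HM]]; exists (`|M| + 1); first by rewrite addr_ge0.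
move=> x; have [Kx|/f0 ->] := pselect (K x); last by rewrite normr0 addr_ge0.
by apply: (HM (`|M| + 1)); [rewrite (le_lt_trans (ler_norm M))// ltrDl|exists x].
Qed.

Lemma partial_support i f (K : set 'rV[R]_n) : closed K ->
  (forall x, ~ K x -> f x = 0) -> forall x, ~ K x -> partial i f x = 0.
Proof.
move=> clK f0 x Kx; have oK : open (~` K) by exact: closed_openC.
have fK : \forall y \near x, f y = 0.
  by apply: filterS (open_nbhs_nbhs (conj oK Kx)) => y; exact: f0.
by rewrite /partial (near_eq_derive (g := cst 0)) ?derive_cst.
Qed.

(** By translation invariance the integral of every difference quotient is 0,
    and the quotients converge boundedly to the derivative. *)
Lemma integral_partial_eq0 i f (K : set 'rV[R]_n) : compact K ->
  continuous f -> (forall x, derivable f x (delta_mx 0 i)) ->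
  continuous (partial i f) -> (forall x, ~ K x -> f x = 0) ->
  \int[mu]_x partial i f x = 0.
Proof.
move=> cK cf df cdf f0; set e : 'rV[R]_n := delta_mx 0 i.
have clK : closed K by apply: compact_closed => //; exact: norm_hausdorff.
have df0 j := @partial_support j f K clK f0.
have [C C0 HC] := compact_support_bounded cK cdf (df0 i).
have [C' C'0 HC'] := compact_support_bounded cK cf f0.
have [M M0 HM] := bounded_rV_box (compact_bounded cK).
(* The translates of f by vectors of length at most 1 all vanish outside B. *)
pose L := M + 1; have L0 : 0 < L by rewrite addr_gt0.
pose B := rV_box n `[- L, L]%classic.
have mB : measurable B by apply: measurable_rV_box; exact: measurable_itv.
have Boo : (mu B < +oo)%E by exact: lebesgue_cube_lty.
have outB (h : R) x : 0 <= h <= 1 -> ~ B x -> f (h *: e + x) = 0.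
  move=> /andP[h0 h1] Bx; apply: f0 => /HM H; apply: Bx => j.
  have := H j; rewrite /= !in_itv/= !mxE ?eqxx/=.
  by rewrite /L; case: (j == i) => /=; rewrite ?mulr1 ?mulr0 ?add0r; lra.
pose h (k : nat) : R := k.+1%:R^-1.
have h0 k : 0 < h k by rewrite invr_gt0.
have h1 k : 0 <= h k <= 1 by rewrite ltW//= invf_le1// ler1n.
pose D k x : R := (h k)^-1 * (f (h k *: e + x) - f x).
have cT (a : R) : measurable_fun setT (fun x => f (a *: e + x)).
  have := measurableT_comp (continuous_rV_measurable cf) (measurable_rV_translate (a *: e)).
  by congr measurable_fun; apply/funext => x /=; rewrite addrC.
have mf := continuous_rV_measurable cf.
have mD k : measurable_fun setT (D k).
  by apply: measurable_funM => //; apply: measurable_funB.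
have bi (g : 'rV[R]_n -> R) c : measurable_fun setT g -> (forall x, `|g x| <= c) ->
    (forall x, ~ B x -> g x = 0) -> mu.-integrable setT (EFin \o g).
  move=> mg gc g0; have : mu.-integrable B (EFin \o g).
    by apply: (@bounded_integrable _ _ _ _ _ _ c) => //; exact: measurable_funTS.
  move/(integrable_mkcond _ mB); congr integrable; apply/funext => x.
  by rewrite patchE; case: ifPn => // /negP; rewrite in_setE => /g0 /= ->.
have fi (a : R) : 0 <= a <= 1 -> mu.-integrable setT (EFin \o (fun x => f (a *: e + x))).
  by move=> a01; apply: (bi _ C') => // x; exact: outB.
have fi0 : mu.-integrable setT (EFin \o f).
  apply: (bi _ C') => // x Bx; rewrite -[x](add0r x) -(scale0r e) outB// lexx ler01//.
have D0 k : (\int[mu]_x (D k x)%:E = 0)%E.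
  have E : \int[mu]_x D k x = 0.
    rewrite /D RintegralZl//; last first.
      by apply: eq_integrable (integrableB measurableT (fi _ (h1 k)) fi0) => // x _ /=;
        rewrite EFinB.
    rewrite RintegralB//; last exact: fi.
    rewrite -[X in _ * (_ - X)](Rintegral_rV_translate (a := h k *: e))//; last first.
      by apply: eq_integrable (fi _ (h1 k)) => // x _ /=; rewrite addrC.
    under [X in _ * (_ - X)]eq_Rintegral do rewrite addrC.
    by rewrite subrr mulr0.
  rewrite -[LHS]fineK; first by rewrite -/(Rintegral _ _ _) E.
  apply: integrable_fin_num => //.
  have := integrableZl measurableT (h k)^-1 (integrableB measurableT (fi _ (h1 k)) fi0).
  by apply: eq_integrable => // x _ /=; rewrite EFinM EFinB.
have Dcvg x : (fun k => D k x) @ \oo --> partial i f x.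
  have hd : h @ \oo --> 0^'.
    have hc : h @ \oo --> (0 : R) by exact: cvg_harmonic.
    move=> A A0; have A0' : nbhs (0 : R) [set x | x != 0 -> A x] by exact: A0.
    have : \forall k \near \oo, h k != 0 -> A (h k) by exact: hc _ A0'.
    change ((\forall k \near \oo, h k != 0 -> A (h k)) -> \forall k \near \oo, A (h k)).
    by apply: filterS => k; apply; rewrite (gt_eqF (h0 k)).
  exact: (cvg_comp _ _ hd (df x)).
have DC k x : `|D k x| <= C.
  have [c _ E] : exists2 c, c \in `]0, h k[%R &
      f (h k *: e + x) - f (0 *: e + x) = partial i f (c *: e + x) * (h k - 0).
    apply: (@MVT _ (fun s => f (s *: e + x)) (fun s => partial i f (s *: e + x))) => //.
      by move=> t _; exact: is_derive_line.
    apply: continuous_subspaceT => t; apply: differentiable_continuous.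
    by apply/derivable1_diffP; have [] := is_derive_line x t df.
  rewrite /D; move: E; rewrite scale0r add0r subr0 => ->.
  by rewrite mulrCA mulVf ?gt_eqF// mulr1.
have gi : mu.-integrable setT ((EFin \o cst C) \_ B).
  by apply/(integrable_mkcond _ mB)/(@bounded_integrable _ _ _ _ _ _ C) => // x _;
    rewrite /= ger0_norm.
have mDk k : measurable_fun setT (fun x => (D k x)%:E).
  by apply/measurable_EFinP; exact: mD.
have mdf : measurable_fun setT (fun x => (partial i f x)%:E).
  by apply/measurable_EFinP; exact: continuous_rV_measurable.
have [||_ _ H] := @dominated_convergence _ _ R mu setT measurableT
  (fun k x => (D k x)%:E) (fun x => (partial i f x)%:E) ((EFin \o cst C) \_ B)
  mDk mdf _ gi.
- by apply: aeW => x _; apply: cvg_EFin; [exact: nearW|exact: Dcvg].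
- apply: aeW => x k _; rewrite patchE; case: ifPn => [_|/negP]; first by rewrite lee_fin.
  rewrite in_setE => Bx; rewrite /D outB// -[X in f X](add0r x) -(scale0r e) outB//.
    by rewrite subrr mulr0 abse0.
  by rewrite lexx ler01.
rewrite /Rintegral; suff -> : (\int[mu]_x (partial i f x)%:E = 0)%E by [].
move: H; rewrite (_ : (fun k => _) = cst 0%E); last by apply/funext => k; exact: D0.
by move=> H; apply: (cvg_unique _ H (cvg_cst _)).
Qed.

End rV_calculus.

Section plane_waves.
Context (R : realType) (n : nat).
Implicit Types (f g : 'rV[R]_n -> R) (x y : 'rV[R]_n) (i : 'I_n).
Local Notation mu := (lebesgue_rV R n).

Lemma is_derive_dir f x v d :
  is_derive (0 : R) (1 : R) (fun h : R => f (h *: v + x)) d -> is_derive x v f d.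
Proof.
set g := fun h : R => _ => -[dg dE].
have E : (fun h => h^-1 *: ((g \o shift 0) (h *: (1 : R)) - g 0)) =
         (fun h => h^-1 *: ((f \o shift x) (h *: v) - f x)).
  apply/funext => h; rewrite /g /=.
  by rewrite [h *: (1 : R)]mulr1 addr0 scale0r add0r.
apply: DeriveDef; first by rewrite /derivable -E; exact: dg.
by rewrite /derive -E.
Qed.

Lemma dotZD y (h : R) v x : dot y (h *: v + x) = h * dot y v + dot y x.
Proof.
rewrite /dot mulr_sumr -big_split; apply: eq_bigr => i _ /=.
by rewrite !mxE mulrDr mulrCA.
Qed.

Lemma dot_delta y i : dot y (delta_mx 0 i) = y 0 i.
Proof.
rewrite /dot (bigD1 i)//= mxE !eqxx mulr1 big1 ?addr0// => j ji.
by rewrite mxE (negbTE ji) andbF mulr0.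
Qed.

Lemma is_derive_cos_dot y x i :
  is_derive x (delta_mx 0 i) (fun x => cos (dot y x)) (- y 0 i * sin (dot y x)).
Proof.
apply: is_derive_dir.
under eq_fun do rewrite dotZD dot_delta.
apply: is_derive_eq; rewrite /GRing.scale/= mul0r add0r.
ring.
Qed.

Lemma is_derive_sin_dot y x i :
  is_derive x (delta_mx 0 i) (fun x => sin (dot y x)) (y 0 i * cos (dot y x)).
Proof.
apply: is_derive_dir.
under eq_fun do rewrite dotZD dot_delta.
apply: is_derive_eq; rewrite /GRing.scale/= mul0r add0r.
ring.
Qed.

Lemma continuous_dot y : continuous (dot y).
Proof.
rewrite (_ : dot y = \sum_i (fun x => y 0 i * x 0 i)); last first.
  by apply/funext => x; rewrite fct_sumE.
apply: (big_ind (fun f : 'rV[R]_n -> R => continuous f)).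
- exact: cst_continuous.
- by move=> f g cf cg x; exact: (continuousD (cf x) (cg x)).
- move=> i _ x.
  exact: (continuousM (@cst_continuous _ _ (y 0 i) x) (@coord_continuous R 1 n 0 i x)).
Qed.

Lemma continuous_cos_dot y : continuous (fun x => cos (dot y x)).
Proof.
by move=> x; apply: continuous_comp; [exact: continuous_dot|exact: continuous_cos].
Qed.

Lemma continuous_sin_dot y : continuous (fun x => sin (dot y x)).
Proof.
by move=> x; apply: continuous_comp; [exact: continuous_dot|exact: continuous_sin].
Qed.

Variable Omega : set 'rV[R]_n.
Hypothesis mOmega : measurable Omega.
Hypothesis fOmega : (mu Omega < +oo)%E.

Lemma bounded_L2 f C : measurable_fun setT f -> (forall x, `|f x| <= C) ->
  L2 Omega f.
Proof.
move=> mf fC; split; first exact: measurable_funTS.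
apply: (@bounded_integrable _ _ _ _ _ _ (C ^+ 2)) => //.
  by apply: measurable_funX; exact: measurable_funTS.
move=> x _; rewrite normrX lerXn2r// ?nnegrE//; exact: le_trans (fC x).
Qed.

Lemma test_function_L2 phi i : test_function Omega phi ->
  L2 Omega phi /\ L2 Omega (partial i phi).
Proof.
move=> [sm cK KO]; have [cphi dphi] := sm [::]; have [cdphi _] := sm [:: i].
have phi0 x : ~ closure [set x | phi x != 0] x -> phi x = 0.
  by move=> Kx; apply/eqP; apply: contra_notT Kx => phix; exact: subset_closure.
have clK := @closed_closure _ [set x | phi x != 0].
have [C _ HC] := compact_support_bounded cK cphi phi0.
have [C' _ HC'] := compact_support_bounded cK cdphi (@partial_support _ _ i _ _ clK phi0).
split; [exact: (bounded_L2 (continuous_rV_measurable cphi) HC)|].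
exact: (bounded_L2 (continuous_rV_measurable cdphi) HC').
Qed.

(** The integral over Omega of the derivative of f phi vanishes, as its support
    is a compact subset of Omega. *)
Lemma bounded_weak_partial f g (C C' : R) i : continuous f -> continuous g ->
  (forall x, `|f x| <= C) -> (forall x, `|g x| <= C') ->
  (forall x, is_derive x (delta_mx 0 i) f (g x)) ->
  weak_partial Omega i f g.
Proof.
move=> cf cg fC gC fg phi tphi.
have [sm cK KO] := tphi; have [cphi dphi] := sm [::]; have [cdphi _] := sm [:: i].
have [L2phi L2dphi] := test_function_L2 i tphi.
have L2f := bounded_L2 (continuous_rV_measurable cf) fC.
have L2g := bounded_L2 (continuous_rV_measurable cg) gC.
have i1 := sqint_mul mOmega L2f L2dphi.
have i2 := sqint_mul mOmega L2g L2phi.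
apply/eqP; rewrite -subr_eq0 opprK -(RintegralD mOmega i1 i2); apply/eqP.
set K := closure _ in cK KO.
have phi0 x : ~ K x -> phi x = 0.
  by move=> Kx; apply/eqP; apply: contra_notT Kx => phix; exact: subset_closure.
have clK : closed K by exact: closed_closure.
pose psi := f * phi.
have psiE x : partial i psi x = f x * partial i phi x + g x * phi x.
  have [dfx fgx] := fg x; have dpx : derivable phi x (delta_mx 0 i) by exact: dphi.
  by rewrite /partial /psi deriveM// fgx /GRing.scale/= [phi x * _]mulrC.
have dpsi x : derivable psi x (delta_mx 0 i).
  by have [dfx _] := fg x; apply: derivableM => //; exact: dphi.
have psi0 x : ~ K x -> psi x = 0 by move=> /phi0 p0; rewrite /psi /GRing.mul/= p0 mulr0.
have cdpsi : continuous (partial i psi).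
  rewrite (_ : partial i psi = fun x => f x * partial i phi x + g x * phi x).
    by move=> x; exact: (continuousD (continuousM (cf x) (cdphi x)) (continuousM (cg x) (cphi x))).
  by apply/funext.
have cpsi : continuous psi by move=> x; exact: (continuousM (cf x) (cphi x)).
rewrite -(integral_partial_eq0 cK cpsi dpsi cdpsi psi0) Rintegral_mkcond.
apply: eq_Rintegral => x _; rewrite patchE; case: ifPn => [_|/negP]; first by rewrite psiE.
rewrite in_setE => Ox; rewrite (@partial_support _ _ i _ _ clK psi0)// => /KO; exact: Ox.
Qed.

Lemma H1_cos_dot y : H1_grad Omega (fun x => cos (dot y x))
  (fun i x => - y 0 i * sin (dot y x)).
Proof.
have bs i x : `|- y 0 i * sin (dot y x)| <= `|y 0 i|.
  by rewrite normrM normrN ler_piMr// sin_max.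
have cs i : continuous (fun x => - y 0 i * sin (dot y x)).
  by move=> x; exact: (continuousM (@cst_continuous _ _ (- y 0 i) x) (@continuous_sin_dot y x)).
split.
  apply: (@bounded_L2 _ 1) => [|x]; last exact: cos_max.
  exact: continuous_rV_measurable (@continuous_cos_dot y).
move=> i; split.
  exact: (bounded_L2 (continuous_rV_measurable (cs i)) (bs i)).
apply: (bounded_weak_partial (C := 1) (C' := `|y 0 i|)) => //.
- exact: continuous_cos_dot.
- by move=> x; exact: cos_max.
- by move=> x; exact: is_derive_cos_dot.
Qed.

Lemma H1_sin_dot y : H1_grad Omega (fun x => sin (dot y x))
  (fun i x => y 0 i * cos (dot y x)).
Proof.
have bs i x : `|y 0 i * cos (dot y x)| <= `|y 0 i|.
  by rewrite normrM ler_piMr// cos_max.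
have cs i : continuous (fun x => y 0 i * cos (dot y x)).
  by move=> x; exact: (continuousM (@cst_continuous _ _ (y 0 i) x) (@continuous_cos_dot y x)).
split.
  apply: (@bounded_L2 _ 1) => [|x]; last exact: sin_max.
  exact: continuous_rV_measurable (@continuous_sin_dot y).
move=> i; split.
  exact: (bounded_L2 (continuous_rV_measurable (cs i)) (bs i)).
apply: (bounded_weak_partial (C := 1) (C' := `|y 0 i|)) => //.
- exact: continuous_sin_dot.
- by move=> x; exact: sin_max.
- by move=> x; exact: is_derive_sin_dot.
Qed.

Lemma H1_lin_closed : lin_closed
  [set U : ('rV[R]_n -> R) * ('I_n -> 'rV[R]_n -> R) | H1_grad Omega U.1 U.2].
Proof.
have [L20 L2D] := sqint_closed mu mOmega.
split.
  split => // i; split => // phi tphi.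
  have Z (q : 'rV[R]_n -> R) : \int[mu]_(x in Omega) (0 * q x) = 0.
    by under eq_Rintegral do rewrite mul0r; rewrite Rintegral_cst// mul0r.
  by rewrite [LHS]Z [X in - X]Z oppr0.
move=> a [u gu] [v gv] [/= Lu Hu] [/= Lv Hv]; split; first exact: L2D.
move=> i; have [Lgu wu] := Hu i; have [Lgv wv] := Hv i.
split; first exact: L2D.
move=> phi tphi; have [Lphi Ldphi] := test_function_L2 i tphi.
have E p q r : L2 Omega p -> L2 Omega q -> L2 Omega r ->
   \int[mu]_(x in Omega) ((a *: p + q) x * r x) =
   a * \int[mu]_(x in Omega) (p x * r x) + \int[mu]_(x in Omega) (q x * r x).
  move=> Lp Lq Lr.
  have pr := sqint_mul mOmega Lp Lr; have qr := sqint_mul mOmega Lq Lr.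
  rewrite -(RintegralZl _ mOmega pr) -RintegralD//; last exact: (integrableZl mOmega a pr).
  by apply: eq_Rintegral => x _; rewrite mulrA -mulrDl.
by rewrite (E u v)// (E (gu i) (gv i))// wu// wv// mulrN opprD.
Qed.

End plane_waves.

(** * A Plancherel inequality through lattices of exponentials *)

Lemma semi_inner_pair (R : realType) (V : lmodType R) (ip : V -> V -> R) :
  semi_inner ip -> semi_inner (fun u v : V * V => ip u.1 v.1 + ip u.2 v.2).
Proof.
move=> ipP; split.
- by move=> u v; rewrite !(ipC ipP (fst u)) !(ipC ipP (snd u)).
- by move=> a u v w; rewrite /= !(ip_linear ipP) mulrDr addrACA.
- by move=> u; rewrite addr_ge0// (ip_ge0 ipP).
Qed.

Section lattice.
Context (R : realType) (n : nat).
Local Notation mu := (lebesgue_rV R n).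
Implicit Types (x y s : 'rV[R]_n).

Lemma dotB y y' x : dot (y - y') x = dot y x - dot y' x.
Proof.
by rewrite /dot -sumrB; apply: eq_bigr => i _; rewrite !mxE mulrBl.
Qed.

Variables (L : R) (Omega : set 'rV[R]_n).
Hypotheses (L0 : 0 < L) (mOmega : measurable Omega)
  (OmegaL : Omega `<=` rV_box n `[- L, L]%classic).

Definition lattice_point m s (l : {ffun 'I_n -> 'I_m}) : 'rV[R]_n :=
  \row_i (s 0 i + pi / L * (l i)%:R).

Lemma lattice_point_diff m s (l k : {ffun 'I_n -> 'I_m}) :
  (forall i, exists z : int,
    (lattice_point s l - lattice_point s k) 0 i = pi / L * z%:~R) /\
  (lattice_point s l - lattice_point s k == 0) = (l == k).
Proof.
have E i : (lattice_point s l - lattice_point s k) 0 i =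
    pi / L * ((l i)%:Z - (k i)%:Z)%:~R.
  by rewrite !mxE intrB -!pmulrn; ring.
split; first by move=> i; exists ((l i)%:Z - (k i)%:Z).
apply/eqP/eqP => [H|->]; last by rewrite subrr.
apply/ffunP => i; apply/val_inj => /=.
have := E i; rewrite H mxE => /esym/eqP.
rewrite !mulf_eq0 invr_eq0 intr_eq0 (gt_eqF L0) (gt_eqF (pi_gt0 R))/= subr_eq0.
by move=> /eqP[].
Qed.

Let B := rV_box n `[- L, L]%classic.
Let mB : measurable B.
Proof. by apply: measurable_rV_box; exact: measurable_itv. Qed.
Let Boo : (mu B < +oo)%E. Proof. exact: lebesgue_cube_lty. Qed.

Let sc y : sqint mu B (fun x => cos (dot y x)).
Proof.
apply: (@bounded_L2 _ _ _ mB Boo _ 1) => [|x]; last exact: cos_max.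
exact: continuous_rV_measurable (@continuous_cos_dot _ _ y).
Qed.

Let ss y : sqint mu B (fun x => sin (dot y x)).
Proof.
apply: (@bounded_L2 _ _ _ mB Boo _ 1) => [|x]; last exact: sin_max.
exact: continuous_rV_measurable (@continuous_sin_dot _ _ y).
Qed.

Let V := sub_of (sqint_space mu mB).
Let C y : V := mk_sub (W := sqint_space mu mB) (sc y).
Let S y : V := mk_sub (W := sqint_space mu mB) (ss y).

(** Complex exponentials are encoded as pairs of real functions: exp(i y.x) is
    (cos, sin) and i exp(i y.x) is (- sin, cos).  For y in a translate of
    (pi / L) Z^n these are orthogonal in the cube, and u extended by 0 is the pair
    (u, 0). *)
Lemma lattice_bessel m s u : L2 Omega u ->
  \sum_(l : {ffun 'I_n -> 'I_m})
    (l2 mu Omega u (fun x => cos (dot (lattice_point s l) x)) ^+ 2 +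
     l2 mu Omega u (fun x => sin (dot (lattice_point s l) x)) ^+ 2)
  <= (2 * L) ^+ n * l2 mu Omega u u.
Proof.
move=> [mu' iu]; pose w : 'rV[R]_n -> R := u \_ Omega.
have OB : B `&` Omega = Omega by apply/setIidPr.
have sw : sqint mu B w.
  split; first by apply/(measurable_restrict _ mOmega mB); rewrite OB.
  rewrite (_ : (fun x => _) = (fun x => (u x ^+ 2)%:E) \_ Omega).
    by apply/(integrable_restrict mu mOmega mB); rewrite OB.
  apply/funext => x; rewrite /w !patchE; case: ifP => // _.
  by rewrite expr0n.
have wE v : l2 mu B w v = l2 mu Omega u v.
  rewrite /l2 -[in RHS]OB Rintegral_mkcondr; apply: eq_Rintegral => x _.
  by rewrite /w !patchE; case: ifP => // _; rewrite mul0r.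
have wwE : l2 mu B w w = l2 mu Omega u u.
  rewrite wE; apply: eq_Rintegral => x Ox; by rewrite /w patchE Ox.
pose U : V := mk_sub (W := sqint_space mu mB) sw.
pose ip := @l2sub _ _ _ mu B mB.
have ipP : semi_inner ip := @l2_semi_inner _ _ _ mu B mB.
pose e (bl : bool * {ffun 'I_n -> 'I_m}) : V * V :=
  let y := lattice_point s bl.2 in
  if bl.1 then (C y, S y) else (- S y, C y).
have B0 : 0 < (2 * L) ^+ n by rewrite exprn_gt0// mulr_gt0.
have CC (l k : {ffun 'I_n -> 'I_m}) : ip (C (lattice_point s l)) (C (lattice_point s k)) +
    ip (S (lattice_point s l)) (S (lattice_point s k)) = (2 * L) ^+ n * (l == k)%:R.
  have [h1 h2] := lattice_point_diff s l k.
  have [_ _ cE sE] := cube_orthogonality L0 h1.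
  rewrite /ip /l2sub /l2 -(RintegralD mB (sqint_mul mB (sc _) (sc _)) (sqint_mul mB (ss _) (ss _))).
  under eq_Rintegral do rewrite -cosB -dotB.
  by rewrite cE h2; case: (l == k); rewrite ?mulr1 ?mulr0.
have SC (l k : {ffun 'I_n -> 'I_m}) : ip (S (lattice_point s l)) (C (lattice_point s k)) -
    ip (C (lattice_point s l)) (S (lattice_point s k)) = 0.
  have [h1 h2] := lattice_point_diff s l k.
  have [_ _ cE sE] := cube_orthogonality L0 h1.
  rewrite /ip /l2sub /l2 -(RintegralB mB (sqint_mul mB (ss _) (sc _)) (sqint_mul mB (sc _) (ss _))).
  by under eq_Rintegral do rewrite -sinB -dotB.
have := bessel_orthogonal (semi_inner_pair ipP) (e := e) (U, 0) B0.
rewrite /= (ip0l ipP) addr0 [ip U U]wwE => H.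
apply: le_trans (H _); last first.
  move=> [b l] [b' k]; rewrite xpair_eqE /e/=.
  case: b; case: b' => /=; rewrite ?(ipNl ipP) ?(ipNr ipP) ?opprK ?mulr0.
  - exact: CC.
  - by rewrite addrC SC.
  - by rewrite addrC -opprB SC oppr0.
  - by rewrite addrC CC.
rewrite big_split/= addrC.
rewrite (eq_bigl (fun=> true))// -(pair_bigA _ (fun b l => (ip U (e (b, l)).1 + ip 0 (e (b, l)).2) ^+ 2))/=.
rewrite big_bool/= addrC lerD//.
  by apply: ler_sum => l _; rewrite (ip0l ipP) addr0 le_eqVlt -wE eqxx.
by apply: ler_sum => l _; rewrite (ip0l ipP) addr0 (ipNr ipP) sqrrN le_eqVlt -wE eqxx.
Qed.

End lattice.

Section lattice_average.
Context (R : realType) (n : nat).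
Local Notation mu := (lebesgue_rV R n).
Implicit Types (x s : 'rV[R]_n).
Variable L : R.
Hypothesis L0 : 0 < L.
Let h := pi / L.
Let h0 : 0 < h. Proof. by rewrite divr_gt0// pi_gt0. Qed.

Let shift m (l : {ffun 'I_n -> 'I_m}) : 'rV[R]_n := \row_i (h * (l i)%:R).

Let lattice_pointE m s (l : {ffun 'I_n -> 'I_m}) : lattice_point L s l = s + shift l.
Proof. by apply/rowP => i; rewrite !mxE. Qed.

Lemma lattice_cover M : exists a m, forall x, rV_box n `[- M, M]%classic x ->
  exists l : {ffun 'I_n -> 'I_m}, rV_box n `[a, a + h[%classic (x - shift l).
Proof.
pose K := (Num.truncn (M / h)).+1.
have KM : M < K%:R * h by rewrite -ltr_pdivrMr// truncnS_gt.
exists (- (K%:R * h)), (2 * K)%N => x Mx.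
have bnd i : 0 <= (x 0 i + K%:R * h) / h < (2 * K)%:R.
  have /= := Mx i; rewrite in_itv/= => /andP[m1 m2].
  rewrite divr_ge0 ?(ltW h0)//=; last by lra.
  by rewrite ltr_pdivrMr// natrM; lra.
pose t i := (x 0 i + K%:R * h) / h.
have tl i : (Num.truncn (t i) < 2 * K)%N.
  by have /andP[t0 t1] := bnd i; rewrite truncn_lt_nat.
exists [ffun i => Ordinal (tl i)] => i /=; rewrite in_itv/= !mxE ffunE/=.
have /andP[t0 _] := bnd i.
have /andP[e1 e2] := truncn_itv t0; rewrite -/(t i) in e1 e2.
have xE : x 0 i = h * t i - K%:R * h by rewrite /t; field; rewrite gt_eqF.
rewrite xE; move: e2; rewrite -addn1 natrD => e2.
apply/andP; split.
  by have := ler_wpM2l (ltW h0) e1; lra.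
have : h * t i < h * ((Num.truncn (t i))%:R + 1) by rewrite ltr_pM2l.
lra.
Qed.

(** Integrate the hypothesis over s in one cell C of the lattice, whose volume is
    h^n: the translates of C by the lattice points cover the box, so the
    integrals of the indicators add up to at least mu (A j). *)
Lemma lattice_average (J : finType) (c : J -> R) (A : J -> set 'rV[R]_n) M T :
  (forall j, 0 <= c j) -> (forall j, measurable (A j)) ->
  (forall j, A j `<=` rV_box n `[- M, M]%classic) ->
  (forall m s, \sum_(l : {ffun 'I_n -> 'I_m}) \sum_j
     c j * \1_(A j) (lattice_point L s l) <= T) ->
  (\sum_j (c j)%:E * mu (A j) <= (T * h ^+ n)%:E)%E.
Proof.
move=> c0 mA AM HT; have [a [m cov]] := lattice_cover M.
pose C := rV_box n `[a, a + h[%classic : set 'rV[R]_n.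
have mC : measurable C by apply: measurable_rV_box; exact: measurable_itv.
have CE : mu C = (h ^+ n)%:E.
  apply: lebesgue_rV_box; first exact: measurable_itv.
  by rewrite lebesgue_measure_itv/= lte_fin ltrDl h0 -EFinB addrAC subrr add0r.
pose I : finType := {ffun 'I_n -> 'I_m}.
have mT (v : 'rV[R]_n) (B : set 'rV[R]_n) : measurable B ->
    measurable ((fun s => s + v) @^-1` B).
  by move=> mB; rewrite -[X in measurable X]setTI; exact: measurable_rV_translate.
have step j : (mu (A j) <= \sum_(l : I) \int[mu]_(s in C)
    (\1_(A j) (s + shift l))%:E)%E.
  pose B (l : I) := A j `&` ((fun s => s - shift l) @^-1` C).
  have mB l : measurable (B l) by apply: measurableI => //; exact: mT.
  apply: (@le_trans _ _ (\sum_(l : I) mu (B l))%E).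
    have -> : (\sum_(l : I) mu (B l) = \sum_(l : I) \int[mu]_x (\1_(B l) x)%:E)%E.
      by apply: eq_bigr => l _; rewrite integral_indic// setIT.
    rewrite -[X in mu X]setIT -(integral_indic _ measurableT (mA j)).
    rewrite -ge0_integral_sum//; last by move=> l; exact/measurable_EFinP.
    apply: ge0_le_integral => //.
    - exact/measurable_EFinP.
    - by apply: emeasurable_sum => l; exact/measurable_EFinP.
    - move=> x _; rewrite sumEFin lee_fin [leLHS]indicE; have [Ax|Ax] := boolP (x \in A j); last first.
        by rewrite sumr_ge0.
      have [l Cl] := cov x (AM j x (set_mem Ax)).
      rewrite (bigD1 l)//= indicE mem_set; last by split => //; exact: set_mem.
      by rewrite lerDl sumr_ge0.
  apply: lee_sum => l _; rewrite -(lebesgue_rV_translate (shift l) (mB l)).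
  rewrite (eq_integral (fun s => (\1_((fun s => s + shift l) @^-1` A j) s)%:E))//.
  rewrite integral_indic//; last exact: mT.
  rewrite le_eqVlt; apply/orP; left; apply/eqP; congr (mu _).
  apply/seteqP; split => v [Av Cv]; split => //.
    by change (C (v + shift l - shift l)) in Cv; rewrite addrK in Cv.
  by change (C (v + shift l - shift l)); rewrite addrK.
have mI (l : I) j : measurable_fun setT (fun s => \1_(A j) (lattice_point L s l) : R).
  rewrite (_ : (fun s => _) = \1_((fun s => s + shift l) @^-1` A j)).
    by apply: measurable_indic; exact: mT.
  by apply/funext => s; rewrite lattice_pointE.
pose G (l : I) j s := (c j * \1_(A j) (lattice_point L s l))%:E.
have mG l j : measurable_fun C (G l j).
  by apply/measurable_EFinP/measurable_funTS; apply: measurable_funM.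
have G0 l j s : C s -> (0 <= G l j s)%E by move=> _; rewrite lee_fin mulr_ge0.
have Gs0 l s : C s -> (0 <= \sum_j G l j s)%E by move=> Cs; apply: sume_ge0 => j _; exact: G0.
have mGs l : measurable_fun C (fun s => \sum_j G l j s)%E.
  by apply: emeasurable_sum => j; exact: mG.
apply: (@le_trans _ _ (\int[mu]_(s in C) (\sum_(l : I) \sum_j G l j s))%E); last first.
  rewrite EFinM -CE -integral_cst//; apply: ge0_le_integral => //.
  - by move=> s Cs; apply: sume_ge0 => l _; exact: Gs0.
  - exact: emeasurable_sum.
  - move=> s _; have := HT m s; rewrite -lee_fin; apply: le_trans.
    rewrite le_eqVlt; apply/orP; left; apply/eqP.
    by rewrite -sumEFin; apply: eq_bigr => l _; rewrite -sumEFin.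
rewrite ge0_integral_sum//.
rewrite [leRHS](eq_bigr (fun l => \sum_j \int[mu]_(s in C) G l j s)%E); last first.
  by move=> l _; apply: ge0_integral_sum => // j s; exact: G0.
rewrite exchange_big/=; apply: lee_sum => j _.
rewrite (eq_bigr (fun l : I => (c j)%:E * \int[mu]_(s in C) (\1_(A j) (s + shift l))%:E)%E).
  rewrite -ge0_sume_distrr; last by move=> l _; apply: integral_ge0.
  by apply: lee_wpmul2l; [rewrite lee_fin|exact: step].
move=> l _; rewrite -ge0_integralZl//.
  by apply: eq_integral => s _; rewrite /G EFinM lattice_pointE.
apply/measurable_EFinP/measurable_funTS.
by have := mI l j; under eq_fun do rewrite lattice_pointE.
by rewrite lee_fin.
Qed.

End lattice_average.

(** * The Neumann Laplacian and its resolvent *)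

Section l2_hilbert.
Context d (T : measurableType d) (R : realType) (mu : {measure set T -> \bar R}).
Variables (D : set T) (mD : measurable D).
Local Notation V := (sub_of (sqint_space mu mD)).
Local Notation ip := (@l2sub _ _ _ mu D mD).

Lemma l2_complete : complete_ip ip.
Proof.
move=> w cw.
have [x sx Hx] : exists2 x, sqint mu D x & forall e : R, 0 < e ->
    exists N, forall k, (N <= k)%N ->
    l2 mu D (sval_of (w k) - x) (sval_of (w k) - x) <= e.
  apply: riesz_fischer => [//|k|e e0]; first exact: (sub_ofP (w k)).
  have [N HN] := cw e e0; exists N => m k Nm Nk.
  by have := HN m k Nm Nk; rewrite /l2sub sub_ofB.
exists (mk_sub (W := sqint_space mu mD) sx) => e e0.
have [N HN] := Hx e e0; exists N => k Nk.
by have := HN k Nk; rewrite /l2sub sub_ofB.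
Qed.

Lemma l2_null_ae (u : V) : ip u u = 0 -> sval_of u = cst 0 %[ae mu in D].
Proof.
move=> u0; have su := sub_ofP u.
have mu2 : measurable_fun D (fun x => (sval_of u x ^+ 2)%:E).
  by case: su => _ /integrableP[].
have : (\int[mu]_(x in D) `|(sval_of u x ^+ 2)%:E|)%E = 0%E.
  rewrite (eq_integral (fun x => (sval_of u x ^+ 2)%:E)).
    by rewrite integral_sqr// -/(l2sub u u) u0.
  by move=> x _; rewrite gee0_abs// lee_fin sqr_ge0.
move/(ae_eq_integral_abs mu mD mu2); apply: filterS => x /= H Dx.
by have [/eqP] := H Dx; rewrite sqrf_eq0 => /eqP.
Qed.

Lemma l2_ae_eq (u v w : V) : sval_of u = sval_of v %[ae mu in D] ->
  ip w u = ip w v.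
Proof.
move=> uv; rewrite /l2sub /l2 /Rintegral; congr fine.
have mw := (sub_ofP w).1; have mu' := (sub_ofP u).1; have mv := (sub_ofP v).1.
apply: ae_eq_integral => //; [exact/measurable_EFinP/measurable_funM..|].
by move: uv; apply: filterS => x H Dx; rewrite (H Dx).
Qed.

End l2_hilbert.

Lemma pair_fct_linear (R : realType) (T I : Type) (a : R)
    (p q : (T -> R) * (I -> T -> R)) i :
  (a *: p + q).2 i = a *: p.2 i + q.2 i.
Proof. exact: erefl. Qed.

Section form_domain.
Context (R : realType) (n : nat) (Omega : set 'rV[R]_n).
Local Notation mu := (lebesgue_rV R n).
Hypotheses (mOmega : measurable Omega) (fOmega : (mu Omega < +oo)%E).

(** Pairs rather than functions alone, so that the gradient is a linear map by
    construction. *)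
Definition H1_space : subspace (('rV[R]_n -> R) * ('I_n -> 'rV[R]_n -> R))%type :=
  Subspace (H1_lin_closed mOmega fOmega).

Local Notation V := (sub_of (sqint_space mu mOmega)).
Local Notation F := (sub_of H1_space).
Local Notation ip := (@l2sub _ _ _ mu Omega mOmega).
Let ipP : semi_inner ip := @l2_semi_inner _ _ _ mu Omega mOmega.

Definition H1_L2 (U : F) : V := mk_sub (W := sqint_space mu mOmega) (sub_ofP U).1.

Definition H1_d i (U : F) : V :=
  mk_sub (W := sqint_space mu mOmega) ((sub_ofP U).2 i).1.

Lemma H1_L2E U : sval_of (H1_L2 U) = (sval_of U).1.
Proof. by []. Qed.

Lemma H1_dE i U : sval_of (H1_d i U) = (sval_of U).2 i.
Proof. by []. Qed.

Lemma H1_L2_linear a U Z : H1_L2 (a *: U + Z) = a *: H1_L2 U + H1_L2 Z.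
Proof.
apply: (@sub_of_inj _ _ _ (H1_L2 (a *: U + Z)) (a *: H1_L2 U + H1_L2 Z)).
rewrite H1_L2E (sub_of_linear a U Z) (sub_of_linear a (H1_L2 U) (H1_L2 Z)).
by rewrite !H1_L2E.
Qed.

Lemma H1_d_linear i a U Z : H1_d i (a *: U + Z) = a *: H1_d i U + H1_d i Z.
Proof.
apply: (@sub_of_inj _ _ _ (H1_d i (a *: U + Z)) (a *: H1_d i U + H1_d i Z)).
rewrite H1_dE (sub_of_linear a U Z) (sub_of_linear a (H1_d i U) (H1_d i Z)).
by rewrite !H1_dE; exact: pair_fct_linear.
Qed.

Definition dirichlet (U Z : F) : R := \sum_i ip (H1_d i U) (H1_d i Z).

Lemma dirichlet_semi_inner : semi_inner dirichlet.
Proof.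
split.
- by move=> U Z; apply: eq_bigr => i _; rewrite (ipC ipP).
- move=> a U Z X; rewrite /dirichlet mulr_sumr -big_split/=.
  by apply: eq_bigr => i _; rewrite H1_d_linear (ip_linear ipP).
- by move=> U; apply: sumr_ge0 => i _; exact: (ip_ge0 ipP).
Qed.

Definition neumann_graph (u f : V) :=
  exists2 U : F, H1_L2 U = u & forall Z : F, dirichlet U Z = ip f (H1_L2 Z).

Lemma neumann_graphP u f : neumann_graph u f <-> neumann_laplacian Omega (sval_of u) (sval_of f).
Proof.
split.
  move=> [U Uu HU]; split; first exact: (sub_ofP f).
  exists (sval_of U).2; first by rewrite -Uu; exact: (sub_ofP U).
  move=> v gv Hv; pose Z : F := mk_sub (W := H1_space) (v := (v, gv)) Hv.
  exact: (HU Z).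
move=> [_ [gu Hu HU]]; exists (mk_sub (W := H1_space) (v := (sval_of u, gu)) Hu).
  exact: sub_of_inj.
by move=> Z; exact: (HU (sval_of Z).1 (sval_of Z).2 (sub_ofP Z)).
Qed.

Lemma neumann_graph_sym u f v g : neumann_graph u f -> neumann_graph v g -> ip f v = ip u g.
Proof.
move=> [U <- HU] [Z <- HZ]; rewrite -HU (ipC dirichlet_semi_inner) HZ.
by rewrite (ipC ipP).
Qed.

Lemma neumann_graph_ge0 u f : neumann_graph u f -> 0 <= ip f u.
Proof. by move=> [U <- HU]; rewrite -HU; exact: ip_ge0 dirichlet_semi_inner _. Qed.

(** The graph only depends on the class of f modulo null functions. *)
Lemma neumann_graph_null u f g : neumann_graph u f -> ip (f - g) (f - g) = 0 ->
  neumann_graph u g.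
Proof.
move=> [U Uu HU] fg; exists U => // Z.
by apply/eqP; rewrite HU -subr_eq0 -(ipBl ipP) (ip_null ipP).
Qed.

Lemma neumann_graph_linear a u f v g : neumann_graph u f -> neumann_graph v g ->
  neumann_graph (a *: u + v) (a *: f + g).
Proof.
move=> [U <- HU] [Z <- HZ]; exists (a *: U + Z); first exact: H1_L2_linear.
by move=> X; rewrite (ip_linear dirichlet_semi_inner) HU HZ (ip_linear ipP).
Qed.

Lemma neumann_graph0 : neumann_graph 0 0.
Proof.
exists 0; first exact: sub_of_inj.
by move=> Z; rewrite (ip0l dirichlet_semi_inner) (ip0l ipP).
Qed.

Lemma resolventP lambda : neumann_resolvent_set Omega lambda <->
  (forall f : V, exists u : V, neumann_graph u (f + lambda *: u)) /\
  exists C : R, forall u f : V, neumann_graph u (f + lambda *: u) -> ip u u <= C * ip f f.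
Proof.
have sqE (u : V) : \int[mu]_(x in Omega) (sval_of u x ^+ 2) = ip u u.
  by apply: eq_Rintegral => x _; rewrite expr2.
split=> [[H1 [C H2]]|[H1 [C H2]]]; split.
- move=> f; have [u Hu] := H1 _ (sub_ofP f).
  have su : L2 Omega u by case: Hu => _ [gu [Lu _] _].
  exists (mk_sub (W := sqint_space mu mOmega) su); apply/neumann_graphP.
  by rewrite sub_ofD sub_ofZ.
- exists C => u f /neumann_graphP; rewrite sub_ofD sub_ofZ => H.
  by rewrite -!sqE; apply: H2; [exact: (sub_ofP f)|exact: H].
- move=> f Lf; have [u /neumann_graphP] := H1 (mk_sub (W := sqint_space mu mOmega) Lf).
  by rewrite sub_ofD sub_ofZ => H; exists (sval_of u).
- exists C => u f Lf H.
  have su : L2 Omega u by case: (H) => _ [gu [Lu _] _].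
  have := H2 (mk_sub (W := sqint_space mu mOmega) su)
             (mk_sub (W := sqint_space mu mOmega) Lf).
  rewrite -!sqE; apply; apply/neumann_graphP.
  by rewrite sub_ofD sub_ofZ.
Qed.

Section resolvent.
Hypothesis resN1 : neumann_resolvent_set Omega (-1).

Lemma exists_inverse : exists H : V -> V, forall f, neumann_graph (H f) (f - H f).
Proof.
have /resolventP[ex _] := resN1.
have [H HH] := choice ex; exists H => f.
by have := HH f; rewrite scaleN1r.
Qed.

Variable H : V -> V.
Hypothesis HP : forall f, neumann_graph (H f) (f - H f).

Lemma inverse_sym u v : ip (H u) v = ip u (H v).
Proof.
have := neumann_graph_sym (HP u) (HP v); rewrite (ipBl ipP) (ipBr ipP); lra.
Qed.

Lemma inverse_sqr_le u : ip (H u) (H u) <= ip (H u) u.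
Proof. by have := neumann_graph_ge0 (HP u); rewrite (ipBl ipP) (ipC ipP u); lra. Qed.

Lemma inverse_ge0 u : 0 <= ip (H u) u.
Proof. exact: le_trans (ip_ge0 ipP _) (inverse_sqr_le u). Qed.

Lemma inverse_le1 u : ip (H u) u <= ip u u.
Proof.
have := ip_ge0 ipP (u - H u); rewrite (ip_sqrB ipP) (ipC ipP u).
have := inverse_sqr_le u; lra.
Qed.

(** With f = H u - t u, the function H u solves the resolvent equation at
    t^-1 - 1 with right-hand side - t^-1 f, so H u is bounded by f, and then so is
    u = t^-1 (H u - f). *)
Lemma inverse_bounded_below t : t != 0 -> neumann_resolvent_set Omega (t^-1 - 1) ->
  exists2 b, 0 < b & forall u, b * ip u u <= ip (H u - t *: u) (H u - t *: u).
Proof.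
move=> t0 /resolventP[_ [C HC]].
have C0 : 0 <= `|C| by [].
have t2 : 0 < t ^+ 2 by rewrite exprn_even_gt0.
have t4 : 0 < t ^+ 4 by rewrite exprn_even_gt0.
pose K := 2 * `|C| / t ^+ 4 + 2 / t ^+ 2 + 1.
have K0 : 0 < K.
  by rewrite ltr_wpDl// addr_ge0// divr_ge0 ?(ltW t2) ?(ltW t4)// mulr_ge0.
exists K^-1; first by rewrite invr_gt0.
move=> u; pose f := H u - t *: u.
have lf : neumann_graph (H u) ((- t^-1) *: f + (t^-1 - 1) *: H u).
  rewrite (_ : _ + _ = u - H u); first exact: HP.
  rewrite /f scalerBr scalerA mulNr mulVf// scalerBl !scaleNr !scale1r opprK.
  by rewrite addrA [- _ + u]addrC subrK.
have E1 : ip (H u) (H u) <= C * ((t ^+ 2)^-1 * ip f f).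
  have := HC _ _ lf; rewrite (ipZl ipP) (ipZr ipP).
  by have -> : - t^-1 * (- t^-1 * ip f f) = (t ^+ 2)^-1 * ip f f by field.
have E2 : ip (H u) (H u) <= `|C| / t ^+ 2 * ip f f.
  rewrite (le_trans E1)// -[leRHS]mulrA ler_wpM2r ?ler_norm//.
  by rewrite mulr_ge0 ?(ip_ge0 ipP)// invr_ge0 sqr_ge0.
have uE : u = t^-1 *: (H u - f).
  by rewrite /f opprB addrC subrK scalerA mulVf// scale1r.
have E3 : ip u u <= (t ^+ 2)^-1 * (2 * ip (H u) (H u) + 2 * ip f f).
  rewrite {1 2}uE (ipZl ipP) (ipZr ipP) mulrA -expr2 exprVn ler_wpM2l ?invr_ge0 ?sqr_ge0//.
  have := ip_sqrD_le ipP (H u) (- f).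
  by rewrite [X in _ <= _ + 2 * X](ipNl ipP) [X in _ <= _ + 2 * - X](ipNr ipP) opprK.
rewrite -/f mulrC ler_pdivrMr// mulrC (le_trans E3)//.
apply: (@le_trans _ _ ((t ^+ 2)^-1 * (2 * (`|C| / t ^+ 2 * ip f f) + 2 * ip f f))).
  by rewrite ler_wpM2l ?invr_ge0 ?sqr_ge0// lerD2r ler_pM2l.
have -> : (t ^+ 2)^-1 * (2 * (`|C| / t ^+ 2 * ip f f) + 2 * ip f f) = (K - 1) * ip f f.
  by rewrite /K; field.
by rewrite ler_wpM2r ?(ip_ge0 ipP)// gerBl.
Qed.

End resolvent.
End form_domain.

(** * Orthonormal eigenfunctions *)

Section eigenbasis.
Context (R : realType) (n : nat) (Omega : set 'rV[R]_n).
Local Notation mu := (lebesgue_rV R n).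
Hypotheses (mOmega : measurable Omega) (fOmega : (mu Omega < +oo)%E).
Local Notation V := (sub_of (sqint_space mu mOmega)).
Local Notation F := (sub_of (H1_space mOmega fOmega)).
Local Notation ip := (@l2sub _ _ _ mu Omega mOmega).
Local Notation Lap := (neumann_graph fOmega).
Let ipP : semi_inner ip := @l2_semi_inner _ _ _ mu Omega mOmega.

Lemma lin_closed_eigen lambda : lin_closed [set v : V | Lap v (lambda *: v)].
Proof.
split; first by rewrite /= scaler0; exact: neumann_graph0.
move=> a u v /= lu lv; have := neumann_graph_linear a lu lv.
by rewrite scalerDr !scalerA mulrC.
Qed.

Lemma lin_closed_orth (u : V) : lin_closed [set v : V | ip u v = 0].
Proof.
split; first exact: (ip0r ipP).
by move=> a v w /= uv uw; rewrite (ipDr ipP) (ipZr ipP) uv uw mulr0 addr0.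
Qed.

Lemma eigen_orthonormal lambda d :
  neumann_multiplicity Omega lambda d ->
  exists o : nat -> V,
  [/\ forall j, (j < d)%N -> Lap (o j) (lambda *: o j),
      forall i j, (i < d)%N -> (j < d)%N -> ip (o i) (o j) = (i == j)%:R
    & forall u, Lap u (lambda *: u) ->
        (forall j, (j < d)%N -> ip u (o j) = 0) -> ip u u = 0].
Proof.
move=> [e [eE efree espan]].
have Le j : L2 Omega (e j) by case: (eE j) => _ [gu [Lu _] _].
pose es (j : nat) : V := if insub j is Some i
  then mk_sub (W := sqint_space mu mOmega) (Le i) else 0.
have esE (i : 'I_d) : sval_of (es i) = e i by rewrite /es valK.
have sumE (c : nat -> R) : sval_of (\sum_(j < d) c j *: es j) =
    (fun x => \sum_(j < d) c j * e j x).
  rewrite sub_of_sum; apply/funext => x; rewrite fct_sumE; apply: eq_bigr => i _.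
  by rewrite (sub_ofZ (c i) (es i)) esE.
have [|o [on oe eo]] := gram_schmidt ipP (d := d) (e := es).
  move=> c c0 j jd; have := l2_null_ae c0; rewrite sumE => H.
  exact: (efree (fun i : 'I_d => c i) H (Ordinal jd)).
have esl j : (j < d)%N -> Lap (es j) (lambda *: es j).
  move=> jd; apply/neumann_graphP; rewrite sub_ofZ -[j]/(nat_of_ord (Ordinal jd)) esE.
  exact: eE.
exists o; split => //.
  by move=> j jd; apply: (oe _ (lin_closed_eigen lambda)).
move=> u lu uo.
have [c uc] : exists c : 'I_d -> R,
    sval_of u = (fun x => \sum_j c j * e j x) %[ae mu in Omega].
  by apply: espan; rewrite /neumann_eigenspace/=; move/neumann_graphP : lu; rewrite sub_ofZ.
pose c' j := if insub j is Some i then c i else 0.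
have c'E (i : 'I_d) : c' i = c i by rewrite /c' valK.
have -> : ip u u = ip u (\sum_(j < d) c' j *: es j).
  apply: l2_ae_eq; rewrite sumE.
  by under [X in _ = X %[ae _ in _]]eq_fun do under eq_bigr do rewrite c'E.
apply: (lin_closed_sum c' (lin_closed_orth u)) => j jd.
by apply: (eo _ (lin_closed_orth u)).
Qed.

Variable gamma : nat -> R.
Hypothesis hgamma : neumann_discrete_spectrum Omega gamma.

(** The indices k with gamma k = lambda are in bijection with an orthonormal
    basis of the eigenspace of lambda; eigenfunctions of distinct eigenvalues are
    orthogonal by symmetry. *)
Lemma eigenbasis : exists e : nat -> V,
  [/\ forall k, (1 <= k)%N -> Lap (e k) (gamma k *: e k),
      forall j k, (1 <= j)%N -> (1 <= k)%N -> ip (e j) (e k) = (j == k)%:R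
    & forall lambda u, neumann_spectrum Omega lambda -> Lap u (lambda *: u) ->
        (forall k, (1 <= k)%N -> gamma k = lambda -> ip u (e k) = 0) -> ip u u = 0].
Proof.
have [specE mono goo mult] := hgamma.
pose lev lambda := [set k | (1 <= k)%N /\ gamma k = lambda].
have ch lambda : exists E : nat -> V, neumann_spectrum Omega lambda ->
  [/\ forall k, lev lambda k -> Lap (E k) (lambda *: E k),
      forall j k, lev lambda j -> lev lambda k -> ip (E j) (E k) = (j == k)%:R
    & forall u, Lap u (lambda *: u) -> (forall k, lev lambda k -> ip u (E k) = 0) ->
        ip u u = 0].
  have [sl|nsl] := pselect (neumann_spectrum Omega lambda); last by exists (fun=> 0).
  have [d dm /card_set_bijP[f [fl fi fs]]] := mult lambda sl.
  have [b [oL oN oS]] := eigen_orthonormal dm.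
  exists (b \o f) => _; split.
  - by move=> k /fl fk; exact: oL.
  - move=> j k lj lk; rewrite /= oN; [|exact: fl|exact: fl].
    congr (nat_of_bool _)%:R; apply/eqP/eqP => [|->//].
    by apply: fi; rewrite inE.
  - move=> u lu uo; apply: oS => // j jd.
    by have [k lk <-] := fs j jd; exact: uo.
have [E EP] := choice ch.
have sg k : (1 <= k)%N -> neumann_spectrum Omega (gamma k).
  by move=> k1; rewrite specE; exists k.
exists (fun k => E (gamma k) k); split.
- by move=> k k1; have [H _ _] := EP _ (sg k k1); exact: H.
- move=> j k j1 k1; have [Hj _ _] := EP _ (sg j j1); have [Hk Ok _] := EP _ (sg k k1).
  have [jk|jk] := eqVneq (gamma j) (gamma k); first by rewrite jk Ok.
  have := neumann_graph_sym (Hj j (conj j1 erefl)) (Hk k (conj k1 erefl)).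
  rewrite (ipZl ipP) (ipZr ipP) => /eqP; rewrite -subr_eq0 -mulrBl mulf_eq0.
  rewrite subr_eq0 (negbTE jk)/= => /eqP ->.
  by case: eqP => // jkE; rewrite jkE eqxx in jk.
- move=> lambda u sl lu uo; have [_ _ Os] := EP _ sl; apply: Os => // k [k1 gk].
  by have := uo k k1 gk; rewrite gk.
Qed.

End eigenbasis.

(** * The variational principle *)

Section orthogonal_complement.
Context (R : realType) (V : lmodType R) (ip : V -> V -> R).
Hypothesis ipP : semi_inner ip.
Variables (J : Type) (P : set J) (e : J -> V).

Lemma orth_lin_closed : lin_closed [set u : V | forall j, P j -> ip u (e j) = 0].
Proof.
split; first by move=> j _; exact: (ip0l ipP).
by move=> a u v Hu Hv j Pj; rewrite (ip_linear ipP) Hu// Hv// mulr0 addr0.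
Qed.

Definition orth_space : subspace V := Subspace orth_lin_closed.

Definition orth_ip (u v : sub_of orth_space) := ip (sval_of u) (sval_of v).

Lemma orth_semi_inner : semi_inner orth_ip.
Proof.
split.
- by move=> u v; exact: (ipC ipP).
- by move=> a u v w; rewrite /orth_ip sub_of_linear (ip_linear ipP).
- by move=> u; exact: (ip_ge0 ipP).
Qed.

Lemma orth_complete : complete_ip ip -> complete_ip orth_ip.
Proof.
move=> Vc w cw; have [x Hx] : exists x, forall e : R, 0 < e ->
    exists N, forall k, (N <= k)%N ->
    ip (sval_of (w k) - x) (sval_of (w k) - x) <= e.
  apply: Vc => r r0; have [N HN] := cw r r0; exists N => m k Nm Nk.
  by have := HN m k Nm Nk; rewrite /orth_ip sub_ofB.
have ox : sset orth_space x.
  move=> j Pj; apply/eqP; rewrite -sqrf_eq0 eq_le sqr_ge0 andbT.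
  apply/ler_addgt0Pl => r r0; rewrite addr0.
  have p0 : 0 < ip (e j) (e j) + 1 by rewrite ltr_wpDl// (ip_ge0 ipP).
  have [|N HN] := Hx (r / (ip (e j) (e j) + 1)); first by rewrite divr_gt0.
  have := HN N (leqnn N); set y := sval_of (w N) - x => yr.
  have -> : ip x (e j) = - ip y (e j).
    by rewrite /y (ipBl ipP) (sub_ofP (w N) j Pj) sub0r opprK.
  rewrite sqrrN (le_trans (cauchy_schwarz ipP _ _))//.
  rewrite -[leRHS](divfK (lt0r_neq0 p0)) ler_pM// ?(ip_ge0 ipP)//.
  by rewrite lerDl.
exists (mk_sub ox) => r r0; have [N HN] := Hx r r0; exists N => k Nk.
by have := HN k Nk; rewrite /orth_ip sub_ofB.
Qed.

End orthogonal_complement.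

Section variational.
Context (R : realType) (n : nat) (Omega : set 'rV[R]_n).
Local Notation mu := (lebesgue_rV R n).
Hypotheses (mOmega : measurable Omega) (fOmega : (mu Omega < +oo)%E).
Local Notation V := (sub_of (sqint_space mu mOmega)).
Local Notation F := (sub_of (H1_space mOmega fOmega)).
Local Notation ip := (@l2sub _ _ _ mu Omega mOmega).
Local Notation Lap := (neumann_graph fOmega).
Local Notation H1L2 := (@H1_L2 R n Omega mOmega fOmega).
Local Notation form := (@dirichlet R n Omega mOmega fOmega).
Let ipP : semi_inner ip := @l2_semi_inner _ _ _ mu Omega mOmega.
Let formP : semi_inner form := @dirichlet_semi_inner R n Omega mOmega fOmega.

Variable gamma : nat -> R.
Hypothesis hgamma : neumann_discrete_spectrum Omega gamma.
Hypothesis gamma1 : gamma 1%N = 0.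

Lemma gamma_ge0 k : (1 <= k)%N -> 0 <= gamma k.
Proof. by move=> k1; have [_ mono _ _] := hgamma; rewrite -gamma1; exact: mono. Qed.

Lemma neg_resolvent : neumann_resolvent_set Omega (-1).
Proof.
apply: contrapT => /= s1; have [specE _ _ _] := hgamma.
have : neumann_spectrum Omega (-1) by exact: s1.
rewrite specE => -[k k1 gk]; have := gamma_ge0 k1; rewrite gk; lra.
Qed.

Lemma spectral_gap_above (eta : R) : exists2 g, eta < g &
  forall lambda, eta < lambda < g -> neumann_resolvent_set Omega lambda.
Proof.
have [specE mono goo _] := hgamma.
have ex : exists k, (1 <= k)%N && (eta < gamma k).
  have [N _ HN] := (cvgryPgt _).1 goo eta.
  by exists (maxn 1 N); rewrite leq_maxl/= HN//= leq_maxr.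
have [K /andP[K1 KG] Kmin] := ex_minnP ex.
exists (gamma K) => // lambda /andP[el lg]; apply: contrapT => /= sl.
have : neumann_spectrum Omega lambda by exact: sl.
rewrite specE => -[k /= k1 gk].
have [kK|Kk] := ltnP k K.
  by have := Kmin k; rewrite k1 gk el => /(_ isT); rewrite leqNgt kK.
by have := mono K k; rewrite K1 Kk gk => /(_ isT); rewrite leNgt lg.
Qed.

Variable e : nat -> V.
Hypothesis eL : forall k, (1 <= k)%N -> Lap (e k) (gamma k *: e k).
Hypothesis eO : forall j k, (1 <= j)%N -> (1 <= k)%N -> ip (e j) (e k) = (j == k)%:R.
Hypothesis eS : forall lambda u, neumann_spectrum Omega lambda -> Lap u (lambda *: u) ->
  (forall k, (1 <= k)%N -> gamma k = lambda -> ip u (e k) = 0) -> ip u u = 0.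

Variable z : R.
Hypothesis z0 : 0 < z.

Let P := [set k | (1 <= k)%N /\ gamma k < z].
Let V0 := sub_of (orth_space ipP P e).
Let ip0 : V0 -> V0 -> R := @orth_ip R V ip ipP nat P e.

(** H = (1 - Delta_N)^-1 maps the space V0 of functions orthogonal to the
    eigenfunctions below z into itself, and H <= (z + 1)^-1 on V0: for
    M > (z + 1)^-1 the number M^-1 - 1 is less than z, so an eigenvector of H for
    M would be an eigenfunction below z in V0, hence null, and H has a spectral
    gap below M because the spectrum is discrete.  The bound passes to the form
    b = form + ip by Cauchy-Schwarz for b, because b (H r) r = ip r r. *)
Lemma variational (r : F) : (forall k, (1 <= k)%N -> gamma k < z -> ip (H1L2 r) (e k) = 0) ->
  z * ip (H1L2 r) (H1L2 r) <= form r r.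
Proof.
move=> or; have [H HP] := exists_inverse mOmega fOmega neg_resolvent.
have Hsym := inverse_sym HP.
have HV0 (u : V0) : sset (orth_space ipP P e) (H (sval_of u)).
  move=> k [k1 kz]; have := neumann_graph_sym (HP (sval_of u)) (eL k1).
  rewrite (ipBl ipP) (sub_ofP u k (conj k1 kz)) sub0r (ipZr ipP) => E.
  have : (1 + gamma k) * ip (H (sval_of u)) (e k) = 0 by rewrite mulrDl -E; ring.
  move/eqP; rewrite mulf_eq0 gt_eqF/= => [/eqP//|].
  by rewrite ltr_pwDl// gamma_ge0.
pose H0 (u : V0) : V0 := mk_sub (HV0 u).
have z1 : 0 < z + 1 by rewrite addr_gt0.
have key : forall u, ip0 (H0 u) u <= (z + 1)^-1 * ip0 u u.
  apply: (sym_upper_bound (orth_semi_inner ipP P e)).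
  - exact/orth_complete/l2_complete.
  - by rewrite invr_gt0.
  - by move=> u v; exact: Hsym.
  - by move=> u; exact: (inverse_ge0 HP).
  - by move=> u; exact: (inverse_le1 HP).
  - move=> M mM; have M0 : 0 < M by rewrite (lt_trans _ mM)// invr_gt0.
    have [g eg Hg] := spectral_gap_above (M^-1 - 1).
    have g1 : 0 < g + 1 by rewrite (lt_trans _ (_ : M^-1 < _)) ?invr_gt0// -ltrBlDr.
    have gM : (g + 1)^-1 < M by rewrite invf_plt// -ltrBlDr.
    exists (M - (g + 1)^-1); first by rewrite subr_gt0.
    move=> t; rewrite subKr => /andP[t1 t2].
    have t0 : 0 < t by rewrite (lt_trans _ t1)// invr_gt0.
    have [|b b0 Hb] := inverse_bounded_below HP (lt0r_neq0 t0) (Hg (t^-1 - 1) _).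
      by rewrite ltrD2r ltf_pV2 ?posrE// t2/= ltrBlDr invf_plt.
    exists b => // u; have := Hb (sval_of u).
    by rewrite /ip0 /orth_ip sub_ofB sub_ofZ.
  - move=> M u mM; have M0 : 0 < M by rewrite (lt_trans _ mM)// invr_gt0.
    rewrite /ip0 /orth_ip sub_ofB sub_ofZ /=; set v := sval_of u => HM.
    have etaz : M^-1 - 1 < z by rewrite ltrBlDr invf_plt// posrE.
    have [res|spec] := pselect (neumann_resolvent_set Omega (M^-1 - 1)).
      have [b b0 Hb] := inverse_bounded_below HP (lt0r_neq0 M0) res.
      have := Hb v; rewrite HM pmulr_rle0// => v0.
      by apply/eqP; rewrite eq_le v0 (ip_ge0 ipP).
    have Hv0 : ip (H v) (H v) = 0.
      apply: (eS (lambda := M^-1 - 1)) => //.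
        apply: neumann_graph_null (HP v) _.
        have -> : v - H v - (M^-1 - 1) *: H v = - M^-1 *: (H v - M *: v).
          rewrite scalerBl scale1r scalerBr scalerA mulNr mulVf ?gt_eqF// !scaleNr scale1r.
          by rewrite opprB opprK addrA subrK addrC.
        by rewrite (ipZl ipP) (ipZr ipP) HM !mulr0.
      move=> k k1 gk; apply: (HV0 u k); split => //.
      by rewrite gk.
    move: HM; rewrite (ip_sqrB ipP) Hv0 (ip_null ipP _ Hv0) mulr0 subr0 add0r.
    rewrite (ipZl ipP) (ipZr ipP) => /eqP; rewrite !mulf_eq0 gt_eqF//=.
    by move/eqP.
pose b (U Z : F) := form U Z + ip (H1L2 U) (H1L2 Z).
have bP : semi_inner b.
  split.
  - by move=> U Z; rewrite /b (ipC formP) (ipC ipP).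
  - move=> a U Z X; rewrite /b (ip_linear formP) H1_L2_linear (ip_linear ipP).
    ring.
  - by move=> U; rewrite addr_ge0 ?(ip_ge0 formP) ?(ip_ge0 ipP).
set rho := H1L2 r in or *.
have orho : sset (orth_space ipP P e) rho by move=> k [k1 kz]; exact: or.
have := key (mk_sub orho); rewrite /ip0 /orth_ip /= => krho.
have [U UH HU] := HP rho.
have bUr : b U r = ip rho rho.
  by rewrite /b HU UH -/rho (ipBl ipP) subrK.
have bUU : b U U = ip (H rho) rho.
  by rewrite /b HU UH -/rho (ipBl ipP) subrK (ipC ipP).
have := cauchy_schwarz bP U r; rewrite bUr bUU => cs.
have f0 := ip_ge0 formP r.
have [->|rn0] := eqVneq (ip rho rho) 0; first by rewrite mulr0.
have r0 : 0 < ip rho rho by rewrite lt_def rn0 (ip_ge0 ipP).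
have brr : 0 <= b r r by exact: ip_ge0 bP _.
have : ip rho rho <= (z + 1)^-1 * b r r.
  rewrite -(ler_pM2l r0) -expr2 (le_trans cs)// (le_trans (ler_wpM2r brr krho))//.
  by rewrite -mulrA mulrCA.
rewrite mulrC ler_pdivlMr// /b -/rho; lra.
Qed.

End variational.

(** * Plane waves against eigenfunctions *)

Lemma cos_lipschitz (R : realType) (a b : R) : `|cos a - cos b| <= `|a - b|.
Proof.
wlog ab : a b / b <= a.
  move=> H; have [/H//|/ltW/H] := leP b a; by rewrite distrC (distrC b).
have [c _ ->] := @MVT_segment R cos (fun x => - sin x) b a ab
  (fun x _ => is_derive_cos x) (continuous_subspaceT (@continuous_cos R)).
by rewrite normrM normrN ler_piMl// sin_max.
Qed.

Lemma sin_lipschitz (R : realType) (a b : R) : `|sin a - sin b| <= `|a - b|.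
Proof.
wlog ab : a b / b <= a.
  move=> H; have [/H//|/ltW/H] := leP b a; by rewrite distrC (distrC b).
have [c _ ->] := @MVT_segment R sin cos b a ab
  (fun x _ => is_derive_sin x) (continuous_subspaceT (@continuous_sin R)).
by rewrite normrM ler_piMl// cos_max.
Qed.

Lemma dot_semi_inner (R : realType) (n : nat) : semi_inner (@dot R n).
Proof.
split.
- by move=> u v; apply: eq_bigr => i _; rewrite mulrC.
- move=> a u v w; rewrite /dot mulr_sumr -big_split/=; apply: eq_bigr => i _.
  by rewrite !mxE mulrDl mulrA.
- by move=> u; apply: sumr_ge0 => i _; rewrite -expr2 sqr_ge0.
Qed.

Section waves.
Context (R : realType) (n : nat) (Omega : set 'rV[R]_n).
Local Notation mu := (lebesgue_rV R n).
Hypotheses (mOmega : measurable Omega) (fOmega : (mu Omega < +oo)%E).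
Local Notation V := (sub_of (sqint_space mu mOmega)).
Local Notation F := (sub_of (H1_space mOmega fOmega)).
Local Notation ip := (@l2sub _ _ _ mu Omega mOmega).
Local Notation Lap := (neumann_graph fOmega).
Local Notation H1L2 := (@H1_L2 R n Omega mOmega fOmega).
Local Notation form := (@dirichlet R n Omega mOmega fOmega).
Let ipP : semi_inner ip := @l2_semi_inner _ _ _ mu Omega mOmega.
Let formP : semi_inner form := @dirichlet_semi_inner R n Omega mOmega fOmega.

Definition cos_wave (y : 'rV[R]_n) : F :=
  mk_sub (W := H1_space mOmega fOmega) (v := (_, _)) (H1_cos_dot mOmega fOmega y).
Definition sin_wave (y : 'rV[R]_n) : F :=
  mk_sub (W := H1_space mOmega fOmega) (v := (_, _)) (H1_sin_dot mOmega fOmega y).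

Let vol := fine (mu Omega).

Let integrable_bounded (f : 'rV[R]_n -> R) C :
  measurable_fun setT f -> (forall x, `|f x| <= C) -> mu.-integrable Omega (EFin \o f).
Proof.
by move=> mf fC; apply: (@bounded_integrable _ _ _ _ _ _ C) => //; exact: measurable_funTS.
Qed.

Lemma wave_norm y :
  ip (H1L2 (cos_wave y)) (H1L2 (cos_wave y)) +
  ip (H1L2 (sin_wave y)) (H1L2 (sin_wave y)) = vol.
Proof.
have Lc := sub_ofP (H1L2 (cos_wave y)); have Ls := sub_ofP (H1L2 (sin_wave y)).
rewrite /l2sub /l2 -(RintegralD mOmega (sqint_mul mOmega Lc Lc) (sqint_mul mOmega Ls Ls)).
transitivity (\int[mu]_(x in Omega) (1 : R)); last by rewrite Rintegral_cst// mul1r.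
by apply: eq_Rintegral => x _ /=; rewrite -!expr2 cos2Dsin2.
Qed.

Lemma wave_energy y :
  form (cos_wave y) (cos_wave y) + form (sin_wave y) (sin_wave y) = dot y y * vol.
Proof.
rewrite /dirichlet -big_split/= /dot mulr_suml; apply: eq_bigr => i _.
have Lc := sub_ofP (H1_d i (cos_wave y)); have Ls := sub_ofP (H1_d i (sin_wave y)).
rewrite /l2sub /l2 -(RintegralD mOmega (sqint_mul mOmega Lc Lc) (sqint_mul mOmega Ls Ls)).
transitivity (\int[mu]_(x in Omega) (y 0 i * y 0 i)); last by rewrite Rintegral_cst.
apply: eq_Rintegral => x _ /=.
have := cos2Dsin2 (dot y x) => E.
transitivity (y 0 i * y 0 i * (cos (dot y x) ^+ 2 + sin (dot y x) ^+ 2)); first by ring.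
by rewrite E mulr1.
Qed.

(** |exp(i y.x) - exp(i y'.x)| is at most |(y - y').x| up to a factor sqrt 2, and
    x is bounded in Omega. *)
Lemma wave_lipschitz rho y y' : (forall x, Omega x -> dot x x <= rho) ->
  ip (H1L2 (cos_wave y) - H1L2 (cos_wave y')) (H1L2 (cos_wave y) - H1L2 (cos_wave y')) +
  ip (H1L2 (sin_wave y) - H1L2 (sin_wave y')) (H1L2 (sin_wave y) - H1L2 (sin_wave y'))
  <= 2 * rho * vol * dot (y - y') (y - y').
Proof.
move=> Orho; set c := H1L2 _ - _; set s := H1L2 (sin_wave y) - _.
have Lc := sub_ofP c; have Ls := sub_ofP s.
rewrite /l2sub /l2 -(RintegralD mOmega (sqint_mul mOmega Lc Lc) (sqint_mul mOmega Ls Ls)).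
apply: (@le_trans _ _ (\int[mu]_(x in Omega) (2 * rho * dot (y - y') (y - y')))); last first.
  by rewrite Rintegral_cst// mulrAC.
apply: le_Rintegral => //.
- by have := integrableD mOmega (sqint_mul mOmega Lc Lc) (sqint_mul mOmega Ls Ls).
- by apply: (integrable_bounded (C := `|2 * rho * dot (y - y') (y - y')|)).
move=> x Ox; rewrite /c /s !sub_ofB.
have dE : dot y x - dot y' x = dot (y - y') x by rewrite dotB.
have d2 : dot (y - y') x ^+ 2 <= rho * dot (y - y') (y - y').
  rewrite (le_trans (cauchy_schwarz (dot_semi_inner R n) _ _))// mulrC.
  by rewrite ler_wpM2r ?Orho// (ip_ge0 (dot_semi_inner R n)).
have c2 : (cos (dot y x) - cos (dot y' x)) ^+ 2 <= dot (y - y') x ^+ 2.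
  by rewrite -dE -real_normK ?num_real// -[leRHS]real_normK ?num_real// lerXn2r ?nnegrE ?cos_lipschitz.
have s2 : (sin (dot y x) - sin (dot y' x)) ^+ 2 <= dot (y - y') x ^+ 2.
  by rewrite -dE -real_normK ?num_real// -[leRHS]real_normK ?num_real// lerXn2r ?nnegrE ?sin_lipschitz.
rewrite -!expr2; apply: (@le_trans _ _ (dot (y - y') x ^+ 2 + dot (y - y') x ^+ 2)).
  exact: lerD.
lra.
Qed.

Variable gamma : nat -> R.
Hypothesis hgamma : neumann_discrete_spectrum Omega gamma.
Hypothesis gamma1 : gamma 1%N = 0.
Variable e : nat -> V.
Hypothesis eL : forall k, (1 <= k)%N -> Lap (e k) (gamma k *: e k).
Hypothesis eO : forall j k, (1 <= j)%N -> (1 <= k)%N -> ip (e j) (e k) = (j == k)%:R.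
Hypothesis eS : forall lambda u, neumann_spectrum Omega lambda -> Lap u (lambda *: u) ->
  (forall k, (1 <= k)%N -> gamma k = lambda -> ip u (e k) = 0) -> ip u u = 0.
Variables (z : R) (N : nat).
Hypothesis z0 : 0 < z.
Hypothesis zN : forall k, (1 <= k)%N -> (gamma k < z) = (k <= N)%N.

(** With S the projection of U on the eigenfunctions below z, the variational
    principle applies to U - S; the mixed terms are computed from the eigenvalue
    equation. *)
Lemma projection_bound (U : F) :
  z * ip (H1L2 U) (H1L2 U) - form U U <=
  \sum_(k < N) (z - gamma k.+1) * ip (H1L2 U) (e k.+1) ^+ 2.
Proof.
have ch k : exists E : F, (1 <= k)%N -> H1L2 E = e k /\
    forall Z, form E Z = gamma k * ip (e k) (H1L2 Z).
  case: (posnP k) => [->|k1]; first by exists 0.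
  have [E Ee EZ] := eL k1; exists E => _; split => // Z.
  by rewrite EZ (ipZl ipP).
have [E EP] := choice ch.
pose w k := ip (H1L2 U) (e k).
pose S : F := \sum_(k < N) w k.+1 *: E k.+1.
have SL : H1L2 S = \sum_(k < N) w k.+1 *: e k.+1.
  rewrite /S; apply: (big_ind2 (fun (X : F) (x : V) => H1L2 X = x)).
  - exact: sub_of_inj.
  - by move=> X x Z y <- <-; rewrite -[X]scale1r H1_L2_linear !scale1r.
  - move=> k _; have [Ek _] := EP k.+1 isT.
    by rewrite -[X in H1L2 X]addr0 H1_L2_linear Ek (_ : H1L2 0 = 0) ?addr0//; exact: sub_of_inj.
set s := \sum_(k < N) w k.+1 *: e k.+1 in SL.
have es (k : 'I_N) : ip (e k.+1) s = w k.+1.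
  rewrite (ip_sumr ipP) (bigD1 k)//= (ipZr ipP) eO// eqxx mulr1 big1 ?addr0// => j jk.
  by rewrite (ipZr ipP) eO// eqSS eq_sym (inj_eq val_inj) (negbTE jk) mulr0.
pose Q := \sum_(k < N) w k.+1 ^+ 2; pose G := \sum_(k < N) gamma k.+1 * w k.+1 ^+ 2.
have us : ip (H1L2 U) s = Q.
  by rewrite (ip_sumr ipP); apply: eq_bigr => k _; rewrite (ipZr ipP) expr2.
have ss : ip s s = Q.
  by rewrite {1}/s (ip_suml ipP); apply: eq_bigr => k _; rewrite (ipZl ipP) es expr2.
have formS Z : form S Z = \sum_(k < N) w k.+1 * (gamma k.+1 * ip (e k.+1) (H1L2 Z)).
  rewrite (ip_suml formP); apply: eq_bigr => k _; rewrite (ipZl formP).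
  by have [_ ->] := EP k.+1 isT.
have SU : form S U = G.
  rewrite formS; apply: eq_bigr => k _; rewrite (ipC ipP) -/(w k.+1); ring.
have SS : form S S = G.
  rewrite formS; apply: eq_bigr => k _; rewrite SL es; ring.
pose r : F := U - S.
have rL : H1L2 r = H1L2 U - s.
  by rewrite /r addrC -scaleN1r H1_L2_linear scaleN1r SL addrC.
have := @variational _ _ _ mOmega fOmega _ hgamma gamma1 e eL eS z z0 r.
rewrite rL (ip_sqrB ipP) (ip_sqrB formP) us ss (ipC formP U) SU SS => H.
have {H} : z * (ip (H1L2 U) (H1L2 U) - 2 * Q + Q) <= form U U - 2 * G + G.
  apply: H => -[//|k] k1 kz; have kN : (k < N)%N by rewrite -zN.
  by rewrite (ipBl ipP) (ipC ipP s) (es (Ordinal kN)) subrr.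
have -> : \sum_(k < N) (z - gamma k.+1) * ip (H1L2 U) (e k.+1) ^+ 2 = z * Q - G.
  rewrite /Q /G mulr_sumr -sumrB; apply: eq_bigr => k _.
  by rewrite mulrBl.
lra.
Qed.

(** This is the function F of the introduction; the two squares together are
    |<e_k, exp(i y.x)>|^2. *)
Definition wave_sum y := \sum_(k < N) (z - gamma k.+1) *
  (ip (H1L2 (cos_wave y)) (e k.+1) ^+ 2 + ip (H1L2 (sin_wave y)) (e k.+1) ^+ 2).

Let zg (k : 'I_N) : 0 <= z - gamma k.+1.
Proof. by rewrite subr_ge0 ltW// zN. Qed.

Lemma wave_sum_ge y : (z - dot y y) * vol <= wave_sum y.
Proof.
have -> : (z - dot y y) * vol = z * vol - dot y y * vol by rewrite mulrBl.
rewrite -(wave_energy y) -(wave_norm y).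
have c := projection_bound (cos_wave y); have s := projection_bound (sin_wave y).
have -> : wave_sum y =
   \sum_(k < N) (z - gamma k.+1) * ip (H1L2 (cos_wave y)) (e k.+1) ^+ 2 +
   \sum_(k < N) (z - gamma k.+1) * ip (H1L2 (sin_wave y)) (e k.+1) ^+ 2.
  by rewrite -big_split; apply: eq_bigr => k _; rewrite mulrDr.
lra.
Qed.

Lemma wave_sum_ge0 y : 0 <= wave_sum y.
Proof.
by apply: sumr_ge0 => k _; rewrite mulr_ge0// addr_ge0// sqr_ge0.
Qed.

(** (a + b)^2 <= 2 a^2 + 2 b^2 replaces the triangle inequality for the square
    root of wave_sum, which is a seminorm of exp(i y.x) bounded by sqrt z times
    the L^2 norm. *)
Lemma wave_sum_lipschitz rho y y' : (forall x, Omega x -> dot x x <= rho) ->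
  wave_sum y <= 2 * wave_sum y' + 4 * z * rho * vol * dot (y - y') (y - y').
Proof.
move=> Orho; have := wave_lipschitz y y' Orho.
set c := H1L2 _ - _; set s := H1L2 (sin_wave y) - _ => cs.
have on (i j : 'I_N) : ip (e i.+1) (e j.+1) = (i == j)%:R.
  by rewrite eO// eqSS (inj_eq val_inj).
have bc := @bessel _ _ _ ipP _ (fun k : 'I_N => e k.+1) c on.
have bs := @bessel _ _ _ ipP _ (fun k : 'I_N => e k.+1) s on.
apply: (@le_trans _ _ (2 * wave_sum y' +
   2 * (z * (\sum_(k < N) ip c (e k.+1) ^+ 2 + \sum_(k < N) ip s (e k.+1) ^+ 2)))).
  rewrite /wave_sum mulr_sumr -big_split/= mulr_sumr mulr_sumr -big_split/=.
  apply: ler_sum => k _.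
  rewrite /c /s !(ipBl ipP); move: (ip (H1L2 (cos_wave y)) _) (ip (H1L2 (cos_wave y')) _).
  move: (ip (H1L2 (sin_wave y)) _) (ip (H1L2 (sin_wave y')) _) => p p' q q'.
  have zk := zg k; have gk : 0 <= gamma k.+1 by exact: (gamma_ge0 hgamma).
  have h1 : q ^+ 2 + p ^+ 2 <= 2 * (q' ^+ 2 + p' ^+ 2) + 2 * ((q - q') ^+ 2 + (p - p') ^+ 2).
    have := sqr_ge0 (q - 2 * q'); have := sqr_ge0 (p - 2 * p'); nra.
  have h2 := ler_wpM2l zk h1.
  have h3 : 0 <= gamma k.+1 * ((q - q') ^+ 2 + (p - p') ^+ 2).
    by rewrite mulr_ge0// addr_ge0// sqr_ge0.
  nra.
rewrite lerD2l.
have -> : 4 * z * rho * vol * dot (y - y') (y - y') =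
  2 * (z * (2 * rho * vol * dot (y - y') (y - y'))) by ring.
rewrite ler_pM2l// ler_pM2l//; apply: le_trans cs; exact: lerD.
Qed.

Lemma wave_sum_lattice L m s : 0 < L -> Omega `<=` rV_box n `[- L, L]%classic ->
  \sum_(l : {ffun 'I_n -> 'I_m}) wave_sum (lattice_point L s l) <=
  (2 * L) ^+ n * \sum_(k < N) (z - gamma k.+1).
Proof.
move=> L0 OL; rewrite exchange_big/= mulr_sumr; apply: ler_sum => k _.
rewrite -mulr_sumr mulrC ler_wpM2r//.
have Lk : L2 Omega (sval_of (e k.+1)) by exact: (sub_ofP (e k.+1)).
have := lattice_bessel L0 mOmega OL m s Lk.
rewrite -/(l2sub (e k.+1) (e k.+1)) eO// eqxx mulr1; apply: le_trans.
rewrite le_eqVlt; apply/orP; left; apply/eqP; apply: eq_bigr => l _.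
by rewrite !(ipC ipP _ (e k.+1)).
Qed.

End waves.

(** * Volumes of spherical shells *)

Section shells.
Context (R : realType) (n : nat).
Local Notation mu := (lebesgue_rV R n).
Local Notation omega := (unit_ball_volume R n).
Hypothesis omega0 : 0 < omega.

Lemma dot_sqr (y : 'rV[R]_n) : dot y y = \sum_i y 0 i ^+ 2.
Proof. by apply: eq_bigr => i _; rewrite expr2. Qed.

Definition shell (a b : R) : set 'rV[R]_n := [set y | a ^+ 2 <= dot y y < b ^+ 2].

Let ball_fin : mu [set v : 'rV[R]_n | \sum_i v 0 i ^+ 2 < 1] = omega%:E.
Proof.
rewrite /unit_ball_volume fineK// ge0_fin_numE// ltey; apply/eqP => E.
by move: omega0; rewrite /unit_ball_volume E ltxx.
Qed.

Let eball (b : R) := [set v : 'rV[R]_n | \sum_i v 0 i ^+ 2 < b ^+ 2].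

Let eballE b : 0 <= b -> (0 < n)%N -> mu (eball b) = (omega * b ^+ n)%:E.
Proof.
rewrite le_eqVlt => /predU1P[<-|b0] n0; last first.
  by rewrite /eball lebesgue_rV_euclid_ball// ball_fin -EFinM mulrC.
rewrite expr0n gtn_eqF// mulr0 (_ : eball 0 = set0) ?measure0//.
rewrite -subset0 => v; rewrite /eball/= expr0n/= ltNge.
by rewrite sumr_ge0// => i _; rewrite sqr_ge0.
Qed.

Lemma measurable_shell a b : measurable (shell a b).
Proof.
rewrite (_ : shell a b = eball b `\` eball a).
  by apply: measurableD; exact: measurable_rV_euclid_ball.
apply/seteqP; split => y; rewrite /shell /eball /= dot_sqr.
  by move=> /andP[h1 h2]; split => //; apply/negP; rewrite -leNgt.
by move=> [h1 /negP]; rewrite -leNgt => ->.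
Qed.

Lemma shell_volume a b : (0 < n)%N -> 0 <= a -> a <= b ->
  mu (shell a b) = (omega * (b ^+ n - a ^+ n))%:E.
Proof.
move=> n0 a0 ab; have b0 := le_trans a0 ab.
rewrite (_ : shell a b = eball b `\` eball a).
  rewrite measureD//; [|exact: measurable_rV_euclid_ball..|]; last first.
    by rewrite [X in (X < _)%E]eballE// ltry.
  rewrite setIidr; first by rewrite [X in (X - _)%E]eballE// [X in (_ - X)%E]eballE// -EFinB -mulrBr.
  move=> v /= /lt_le_trans; apply; by rewrite lerXn2r// ?nnegrE.
apply/seteqP; split => y; rewrite /shell /eball /= dot_sqr.
  by move=> /andP[h1 h2]; split => //; apply/negP; rewrite -leNgt.
by move=> [h1 /negP]; rewrite -leNgt => ->.
Qed.

Lemma shell_box a b : 0 <= b -> shell a b `<=` rV_box n `[- b, b]%classic.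
Proof.
move=> b0 y /andP[_ yb] i /=; rewrite in_itv/= -ler_norml.
rewrite -(ler_pXn2r (ltn0Sn 1)) ?nnegrE// real_normK ?num_real// (le_trans _ (ltW yb))//.
rewrite /dot (bigD1 i)//= -expr2 lerDl sumr_ge0// => j _.
by rewrite -expr2 sqr_ge0.
Qed.

End shells.

(** * Comparison of Riesz means *)

Section counting.
Context (R : realType) (n : nat) (Omega : set 'rV[R]_n).
Local Notation mu := (lebesgue_rV R n).
Local Notation omega := (unit_ball_volume R n).
Hypothesis hn : (5 <= n)%N.
Hypotheses (mOmega : measurable Omega) (fOmega : (mu Omega < +oo)%E).
Local Notation V := (sub_of (sqint_space mu mOmega)).
Local Notation ip := (@l2sub _ _ _ mu Omega mOmega).
Let vol := volume Omega.
Variables (L rho : R).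
Hypotheses (L0 : 0 < L) (OL : Omega `<=` rV_box n `[- L, L]%classic).
Hypotheses (rho1 : 1 <= rho) (Orho : forall x, Omega x -> dot x x <= rho).
Variable gamma : nat -> R.
Hypothesis hgamma : neumann_discrete_spectrum Omega gamma.
Hypothesis gamma1 : gamma 1%N = 0.
Variable e : nat -> V.
Hypothesis eL : forall k, (1 <= k)%N -> neumann_graph fOmega (e k) (gamma k *: e k).
Hypothesis eO : forall j k, (1 <= j)%N -> (1 <= k)%N -> ip (e j) (e k) = (j == k)%:R.
Hypothesis eS : forall lambda u, neumann_spectrum Omega lambda ->
  neumann_graph fOmega u (lambda *: u) ->
  (forall k, (1 <= k)%N -> gamma k = lambda -> ip u (e k) = 0) -> ip u u = 0.
Hypotheses (omega0 : 0 < omega) (vol0 : 0 < vol).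

(** Small enough for the Lipschitz estimate at distance 2 beta / t to cost at
    most half of the lower bound beta * vol. *)
Let beta : R := (32 * rho)^-1.
Let beta0 : 0 < beta.
Proof. by rewrite invr_gt0 mulr_gt0// (lt_le_trans _ rho1). Qed.
Let beta_rho : 32 * rho * beta = 1.
Proof. by rewrite /beta mulfV// gt_eqF// mulr_gt0// (lt_le_trans _ rho1). Qed.
Let beta1 : beta <= 1.
Proof.
have r0 : 0 < 32 * rho by rewrite mulr_gt0// (lt_le_trans _ rho1).
rewrite /beta invf_le1//; have := rho1; lra.
Qed.

Section fixed_z.
Variables (t : R) (N : nat).
Hypothesis t1 : 1 <= t.
Hypothesis tN : forall k, (1 <= k)%N -> (gamma k < t ^+ 2) = (k <= N)%N.
Let z0 : 0 < t ^+ 2. Proof. by rewrite exprn_gt0// (lt_le_trans _ t1). Qed.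
Let t0 : 0 < t. Proof. exact: lt_le_trans t1. Qed.
Let W y := wave_sum fOmega gamma e (t ^+ 2) N y.
Let W_ge y : (t ^+ 2 - dot y y) * vol <= W y :=
  wave_sum_ge hgamma gamma1 eL eO eS z0 tN y.

(** Compare y with the point p of its ray with |p| = t - beta / t, where wave_sum
    is at least beta * vol by wave_sum_ge. *)
Lemma wave_sum_outer y : t ^+ 2 <= dot y y < (t + beta / t) ^+ 2 ->
  vol * beta / 4 <= W y.
Proof.
move=> /andP[y1 y2]; pose d := beta / t; pose a := Num.sqrt (dot y y).
have d0 : 0 < d by rewrite divr_gt0.
have td : t * d = beta by rewrite /d mulrC divfK ?gt_eqF.
have y0 : 0 <= dot y y by rewrite (le_trans _ y1)// ltW.
have aa : a ^+ 2 = dot y y by rewrite sqr_sqrtr.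
have a0 : 0 <= a by rewrite sqrtr_ge0.
have ta : t <= a by rewrite -(ler_pXn2r (ltn0Sn 1)) ?nnegrE ?(ltW t0)// aa.
have ad : a < t + d.
  by rewrite -(ltr_pXn2r (ltn0Sn 1)) ?nnegrE ?addr_ge0 ?(ltW t0) ?(ltW d0)// aa.
have ap : 0 < a by exact: lt_le_trans ta.
pose tau := (t - d) / a; pose p := tau *: y.
have pp : dot p p = (t - d) ^+ 2.
  rewrite /p (ipZl (dot_semi_inner R n)) (ipZr (dot_semi_inner R n)) -aa /tau.
  by field; rewrite gt_eqF.
have yp : dot (y - p) (y - p) = (a - (t - d)) ^+ 2.
  rewrite -[X in dot (X - _) (X - _)]scale1r /p -scalerBl.
  rewrite (ipZl (dot_semi_inner R n)) (ipZr (dot_semi_inner R n)) -aa /tau.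
  by field; rewrite gt_eqF.
have h1 := W_ge p.
have h2 := @wave_sum_lipschitz _ _ _ mOmega fOmega _ hgamma gamma1 e eO _ _ z0 tN rho p y Orho.
rewrite -/(W p) -/(W y) -[fine _]/vol in h2.
have dE : dot (p - y) (p - y) = dot (y - p) (y - p).
  by rewrite -[p - y]opprB (ipNl (dot_semi_inner R n)) (ipNr (dot_semi_inner R n)) opprK.
rewrite dE yp in h2.
have h3 : (a - (t - d)) ^+ 2 <= (2 * d) ^+ 2.
  have q0 : 0 <= a - (t - d) by rewrite subr_ge0 (le_trans _ ta)// gerBl ltW.
  have q2 : a - (t - d) <= 2 * d by rewrite lerBlDr mulr_natl mulr2n addrC addrA subrK ltW.
  by rewrite lerXn2r// nnegrE (le_trans q0).
have d1 : d ^+ 2 <= beta.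
  rewrite expr2 -[leRHS]td ler_wpM2r ?(ltW d0)// /d ler_pdivrMr//.
  by rewrite (le_trans beta1)// mulr_ege1.
have h4 : 4 * t ^+ 2 * rho * vol * (a - (t - d)) ^+ 2 <= 4 * rho * vol * (4 * beta ^+ 2).
  have -> : 4 * rho * vol * (4 * beta ^+ 2) = 4 * t ^+ 2 * rho * vol * (2 * d) ^+ 2.
    by rewrite -td; ring.
  rewrite ler_wpM2l//.
  exact: mulr_ge0 (mulr_ge0 (mulr_ge0 (ler0n _ 4) (ltW z0)) (le_trans ler01 rho1)) (ltW vol0).
have h5 : (t ^+ 2 - dot p p) * vol >= beta * vol.
  rewrite ler_wpM2r ?(ltW vol0)// pp; have : t ^+ 2 - (t - d) ^+ 2 = 2 * (t * d) - d ^+ 2 by ring.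
  by move=> ->; rewrite td; lra.
have h6 : 4 * rho * vol * (4 * beta ^+ 2) = vol * beta / 2.
  have -> : 4 * rho * vol * (4 * beta ^+ 2) = (32 * rho * beta) * (vol * beta) / 2 by field.
  by rewrite beta_rho mul1r.
lra.
Qed.

Variable c : R.
Hypothesis cE : c = omega * vol / (2 * pi) ^+ n.
Variable r : nat -> R.
Hypothesis r_ge0 : forall m, 0 <= r m.
Hypothesis r_pow : forall m, r m ^+ n = m%:R / c.
Variable M : nat.
Hypothesis rM : forall m, (m <= M)%N -> r m < t.

Let n0 : (0 < n)%N. Proof. exact: leq_trans hn. Qed.
Let c0 : 0 < c.
Proof. by rewrite cE divr_gt0 ?mulr_gt0// exprn_gt0// mulr_gt0// pi_gt0. Qed.

Let r_mono m m' : (m <= m')%N -> r m <= r m'.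
Proof.
move=> mm; rewrite -(ler_pXn2r n0) ?nnegrE// !r_pow.
by rewrite ler_pM2r ?invr_gt0// ler_nat.
Qed.

(** A lower bound of wave_sum by a step function: on the j-th shell, j < M, the
    value of (t^2 - |y|^2) * vol at the outer radius r j.+1, and on the shell
    beyond radius t the constant of wave_sum_outer.  By the choice of the
    radii r m, each of the first M shells has volume (2 pi)^n / vol. *)
Lemma riesz_mean_lower :
  (2 * pi) ^+ n * \sum_(m < M) (t ^+ 2 - r m.+1 ^+ 2) +
  vol * beta / 4 * omega * ((t + beta / t) ^+ n - t ^+ n) <=
  (2 * pi) ^+ n * \sum_(k < N) (t ^+ 2 - gamma k.+1).
Proof.
(* The index M stands for the outer shell from t to t + beta / t.  The gap
   between r M and t is left out. *)
pose lo (j : nat) := if (j < M)%N then r j else t.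
pose hi (j : nat) := if (j < M)%N then r j.+1 else t + beta / t.
pose cf (j : nat) := if (j < M)%N then (t ^+ 2 - r j.+1 ^+ 2) * vol else vol * beta / 4.
pose A (j : nat) : set 'rV[R]_n := shell (lo j) (hi j).
have rt m : (m <= M)%N -> r m ^+ 2 <= t ^+ 2.
  by move=> mM; apply: lerXn2r; rewrite ?nnegrE ?r_ge0 ?(ltW t0) ?(ltW (rM mM)).
have d0 : 0 < beta / t by rewrite divr_gt0.
have cf0 j : 0 <= cf j.
  rewrite /cf; case: ifP => jM; first by rewrite mulr_ge0 ?(ltW vol0)// subr_ge0 rt.
  by rewrite divr_ge0// mulr_ge0// ltW.
have lo0 j : 0 <= lo j by rewrite /lo; case: ifP => _ //; exact: ltW.
have lohi j : lo j <= hi j.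
  rewrite /lo /hi; case: ifP => _; first exact: r_mono.
  by rewrite lerDl ltW.
have hit j : hi j <= t + beta / t.
  rewrite /hi; case: ifP => jM //; rewrite (le_trans (ltW (rM jM)))// lerDl ltW//.
have disj j k y : (j < k)%N -> (k <= M)%N -> A j y -> A k y -> False.
  move=> jk kM /andP[_ h1] /andP[h2 _].
  have jM : (j < M)%N by exact: leq_trans kM.
  have : hi j <= lo k.
    rewrite /hi /lo jM; case: ifP => _; first exact: r_mono.
    by rewrite ltW// rM.
  move=> hl; have := lt_le_trans h1 (_ : hi j ^+ 2 <= lo k ^+ 2).
  rewrite lerXn2r ?nnegrE// ?(le_trans (lo0 j))// => /(_ isT).
  by rewrite ltNge h2.
have pt y : \sum_(j < M.+1) cf j * \1_(A j) y <= W y.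
  have W0 : 0 <= W y by exact: (wave_sum_ge0 fOmega e tN).
  have [[j Aj]|nA] := pselect (exists j : 'I_M.+1, A j y); last first.
    rewrite big1// => j _; rewrite indicE memNset ?mulr0// => Aj.
    by apply: nA; exists j.
  rewrite (bigD1 j)//= indicE mem_set// mulr1 big1 ?addr0; last first.
    move=> k kj; rewrite indicE memNset ?mulr0// => Ak.
    have [jk|kj'|/val_inj jk] := ltngtP j k.
    - exact: (disj j k y jk (ltn_ord k)).
    - exact: (disj k j y kj' (ltn_ord j)).
    - by rewrite jk eqxx in kj.
  move: Aj; rewrite /A /cf /lo /hi; case: ifP => jM Aj; last exact: wave_sum_outer.
  move: Aj => /andP[_ yr]; rewrite (le_trans _ (W_ge y))// ler_wpM2r ?(ltW vol0)//.
  by rewrite lerD2l lerN2 ltW.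
have := @lattice_average R n L L0 _ (fun j : 'I_M.+1 => cf j) (fun j : 'I_M.+1 => A j)
  (t + beta / t) ((2 * L) ^+ n * \sum_(k < N) (t ^+ 2 - gamma k.+1))
  (fun j => cf0 j) (fun j => @measurable_shell R n _ _).
have Abox (j : 'I_M.+1) : A j `<=` rV_box n `[- (t + beta / t), t + beta / t]%classic.
  move=> y /andP[_ yh]; apply: (@shell_box R n 0); first by rewrite addr_ge0 ?ltW.
  rewrite /shell/= expr0n/= (ip_ge0 (dot_semi_inner R n))/= (lt_le_trans yh)//.
  have tb : 0 <= t + beta / t by rewrite addr_ge0 ?ltW.
  by apply: lerXn2r; rewrite ?nnegrE ?(le_trans (lo0 j) (lohi j)) ?hit.
move=> /(_ Abox) H.
have {H} := H _; rewrite (eq_bigr (fun j : 'I_M.+1 =>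
    (cf j * (omega * (hi j ^+ n - lo j ^+ n)))%:E)); last first.
  by move=> j _; rewrite (shell_volume omega0 n0 (lo0 j) (lohi j)) EFinM.
rewrite sumEFin lee_fin big_ord_recr/= => H.
have {}H := H (fun m s => le_trans (ler_sum _ (fun l _ => pt (lattice_point L s l)))
   (wave_sum_lattice fOmega eO tN m s L0 OL)).
(* The auxiliary side length L drops out: (2 L)^n (pi / L)^n = (2 pi)^n. *)
have LE : (2 * L) ^+ n * (\sum_(k < N) (t ^+ 2 - gamma k.+1)) * (pi / L) ^+ n =
    (2 * pi) ^+ n * \sum_(k < N) (t ^+ 2 - gamma k.+1).
  rewrite mulrAC -exprMn; congr (_ ^+ _ * _); by field; rewrite gt_eqF.
rewrite -LE (le_trans _ H)// le_eqVlt; apply/orP; left; apply/eqP; congr (_ + _); last first.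
  by rewrite /cf /hi /lo ltnn mulrA.
rewrite mulr_sumr; apply: eq_bigr => j _; rewrite /cf /hi /lo ltn_ord !r_pow.
have cc : omega * vol / c = (2 * pi) ^+ n.
  by rewrite cE; field; rewrite !gt_eqF// exprn_gt0// mulr_gt0// pi_gt0.
rewrite -cc -natr1; field; exact: lt0r_neq0 c0.
Qed.

End fixed_z.

Lemma sum_indicator_le (a : R) (K M : nat) : 0 <= a ->
  \sum_(m < M) (if (m < K)%N then a else 0) <= K%:R * a.
Proof.
move=> a0; apply: (@le_trans _ _ ((minn M K)%:R * a)); last first.
  by rewrite ler_wpM2r// ler_nat geq_minr.
elim: M => [|M IH]; first by rewrite big_ord0 min0n mul0r.
rewrite big_ord_recr/=; case: ltnP => MK.
  rewrite (minn_idPl MK) -natr1 mulrDl mul1r lerD2r (le_trans IH)//.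
  by rewrite (minn_idPl (ltnW MK)).
by rewrite addr0 (minn_idPr (leqW MK)) (le_trans IH)// (minn_idPr MK).
Qed.

Lemma eigenvalue_count (z : R) : 0 < z ->
  exists N, forall k, (1 <= k)%N -> (gamma k < z) = (k <= N)%N.
Proof.
move=> z0; have [_ mono goo _] := hgamma.
have ex : exists k, (1 <= k)%N && (z <= gamma k).
  have [N _ HN] := (cvgryPge _).1 goo z.
  by exists (maxn 1 N); rewrite leq_maxl/= HN//= leq_maxr.
have [K /andP[K1 zK] Kmin] := ex_minnP ex.
exists K.-1 => k k1; rewrite -ltnS prednK//; apply/idP/idP => [kz|kK].
  rewrite ltnNge; apply/negP => Kk; have := mono K k; rewrite K1 Kk => /(_ isT).
  by move=> /(le_trans zK); rewrite leNgt kz.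
rewrite ltNge; apply/negP => zk; have := Kmin k; rewrite k1 zk => /(_ isT).
by rewrite leqNgt kK.
Qed.

(** The eigenvalue gamma 1 = 0 accounts for one term t^2 and the indices below K'
    for at most K' more, so a failure for all k >= K' bounds a quantity of order
    t^(n-2) >= t^3 by a multiple of t^2. *)
Lemma polya_frequently (c : R) (K : nat) : c = omega * vol / (2 * pi) ^+ n ->
  exists2 k, (K <= k)%N /\ (1 <= k)%N & c * gamma k `^ (n%:R / 2) <= k%:R - 1.
Proof.
move=> cE; apply: contrapT => no.
have n0 : (0 < n)%N by exact: leq_trans hn.
have nR : n%:R != 0 :> R by rewrite pnatr_eq0 -lt0n.
have pi0 : 0 < (2 * pi : R) ^+ n by rewrite exprn_gt0// mulr_gt0// pi_gt0.
have c0 : 0 < c by rewrite cE divr_gt0 ?mulr_gt0.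
pose K' := maxn 1 K.
pose r (m : nat) : R := (m%:R / c) `^ n%:R^-1.
have r_ge0 m : 0 <= r m by exact: powR_ge0.
have mc0 (m : nat) : 0 <= m%:R / c by rewrite divr_ge0// ltW.
have r_pow m : r m ^+ n = m%:R / c.
  by rewrite -powR_mulrn// -powRrM mulVf// powRr1.
have r_mono m m' : (m <= m')%N -> r m <= r m'.
  move=> mm; rewrite -(ler_pXn2r n0) ?nnegrE// !r_pow.
  by rewrite ler_pM2r ?invr_gt0// ler_nat.
have above k : (K' <= k)%N -> r k.-1 ^+ 2 < gamma k.
  rewrite geq_max => /andP[k1 Kk]; have gk := gamma_ge0 hgamma gamma1 k1.
  have bad : k%:R - 1 < c * gamma k `^ (n%:R / 2).
    by rewrite ltNge; apply/negP => H; apply: no; exists k.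
  have gE : gamma k `^ (n%:R / 2) = Num.sqrt (gamma k) ^+ n.
    by rewrite -powR12_sqrt// -powR_mulrn ?powR_ge0// -powRrM mulrC.
  have : r k.-1 < Num.sqrt (gamma k).
    rewrite -(ltr_pXn2r n0) ?nnegrE ?sqrtr_ge0// r_pow -gE ltr_pdivrMr//.
    by rewrite mulrC -subn1 natrB.
  by move=> rk; rewrite -[X in _ < X](sqr_sqrtr gk) ltrXn2r// ?nnegrE// sqrtr_ge0.
pose c1 := vol * beta / 4 * omega * beta.
have c10 : 0 < c1 by rewrite !mulr_gt0// invr_gt0.
pose X := (2 * pi) ^+ n * K'.+1%:R / c1.
have X0 : 0 <= X by rewrite divr_ge0 ?(ltW c10)// mulr_ge0// ltW.
have gK : 0 <= gamma K'.+1 by exact: (gamma_ge0 hgamma gamma1).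
(* X is the value of t up to which the final inequality c1 t^3 <= C t^2 could
   hold; gamma K'.+1 makes sure that K' < N. *)
pose t := 1 + gamma K'.+1 + X.
have t1 : 1 <= t by rewrite /t -addrA lerDl addr_ge0.
have t0 : 0 < t by exact: lt_le_trans t1.
have z0 : 0 < t ^+ 2 by rewrite exprn_gt0.
have [N tN] := eigenvalue_count z0.
have KN : (K' < N)%N.
  rewrite -tN// (@lt_le_trans _ _ t)//; last by rewrite expr2 ler_peMl// ltW.
  by rewrite /t -addrA addrC -addrA ltrDl ltr_wpDl.
pose M := N.-1.
have MN : N = M.+1 by rewrite prednK// (leq_ltn_trans _ KN).
have KM : (K' <= M)%N by rewrite -ltnS -MN.
have rM m : (m <= M)%N -> r m < t.
  move=> mM; apply: (le_lt_trans (r_mono _ _ mM)).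
  rewrite -(ltr_pXn2r (ltn0Sn 1)) ?nnegrE ?(ltW t0)//.
  by apply: (lt_trans (above M.+1 (leqW KM))); rewrite tN// MN.
have low := riesz_mean_lower t1 tN cE r_ge0 r_pow rM.
have up : \sum_(k < N) (t ^+ 2 - gamma k.+1) <=
    \sum_(m < M) (t ^+ 2 - r m.+1 ^+ 2) + K'.+1%:R * t ^+ 2.
  rewrite MN big_ord_recl/= gamma1 subr0 -natr1 mulrDl mul1r addrA [leLHS]addrC lerD2r.
  have si := sum_indicator_le K' M (ltW z0).
  apply: (@le_trans _ _ (\sum_(m < M) ((t ^+ 2 - r m.+1 ^+ 2) +
      (if (m < K')%N then t ^+ 2 else 0)))); last first.
    by rewrite big_split/= lerD2l.
  apply: ler_sum => m _; case: ltnP => mK; last first.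
    rewrite addr0 lerD2l lerN2 ltW// (above m.+2)// (leq_trans mK)//.
    by rewrite (leq_trans (leqnSn _)).
  have rm : r m.+1 ^+ 2 <= t ^+ 2.
    apply: lerXn2r; rewrite ?nnegrE ?(ltW t0)// ltW// rM//.
  have gm : 0 <= gamma m.+2 by exact: (gamma_ge0 hgamma gamma1).
  lra.
have bt : 0 <= beta / t by rewrite divr_ge0// ltW.
have pw : beta * t ^+ 3 <= (t + beta / t) ^+ n - t ^+ n.
  have [p pE] : exists p, n = p.+4.+1.
    by exists (n - 5)%N; rewrite -[LHS](subnK hn) !addnS addn0.
  rewrite pE exprS [X in _ <= _ - X]exprS.
  apply: (@le_trans _ _ (beta / t * t ^+ p.+4)).
    have -> : beta / t * t ^+ p.+4 = beta * t ^+ 3 * t ^+ p.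
      by rewrite !exprS; field; rewrite gt_eqF.
    have b3 : 0 <= beta * t ^+ 3 := mulr_ge0 (ltW beta0) (exprn_ge0 3 (ltW t0)).
    by rewrite ler_peMr// exprn_ege1.
  have tt : t ^+ p.+4 <= (t + beta / t) ^+ p.+4.
    by apply: lerXn2r; rewrite ?nnegrE ?addr_ge0 ?(ltW t0)// lerDl.
  have tb0 : 0 <= t + beta / t by rewrite addr_ge0// ltW.
  have := ler_wpM2l tb0 tt.
  rewrite [X in X <= _]mulrDl lerBrDl; exact.
have h1 := ler_wpM2l (ltW pi0) up.
have q0 : 0 <= vol * beta / 4 * omega by rewrite !mulr_ge0// ?ltW// invr_ge0.
have h2 := ler_wpM2l q0 pw.
have h3 : c1 * t ^+ 3 <= (2 * pi) ^+ n * K'.+1%:R * t ^+ 2.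
  rewrite /c1 -mulrA (le_trans h2)//.
  by have := le_trans low h1; rewrite [leRHS]mulrDr lerD2l mulrA.
have : t <= X.
  rewrite /X ler_pdivlMr// -(ler_pM2r z0) (le_trans _ h3)//.
  by rewrite le_eqVlt; apply/orP; left; apply/eqP; ring.
rewrite leNgt /t => /negP; apply.
by rewrite ltrDr ltr_pwDl.
Qed.

End counting.

Theorem corollary1p4 (R : realType) (n : nat) (hn : (5 <= n)%N)
    (Omega : set 'rV[R]_n) (Omega0 : Omega !=set0) (oOmega : open Omega)
    (bOmega : bounded_set Omega)
    (gamma : nat -> R) (hgamma : neumann_discrete_spectrum Omega gamma)
    (gamma1 : gamma 1%N = 0) :
  exists k : nat -> nat,
    [/\ forall j, (1 <= k j)%N,
        forall i j, (i < j)%N -> (k i < k j)%N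
      & forall j, (k j)%:R - 1 >=
          unit_ball_volume R n * volume Omega / (2 * pi) ^+ n
            * gamma (k j) `^ (n%:R / 2)].
Proof.
set c := unit_ball_volume R n * volume Omega / (2 * pi) ^+ n.
suff freq K : exists2 k, (K <= k)%N /\ (1 <= k)%N &
    c * gamma k `^ (n%:R / 2) <= k%:R - 1.
  have ch K : exists k : nat, [/\ (K <= k)%N, (1 <= k)%N &
      c * gamma k `^ (n%:R / 2) <= k%:R - 1].
    by have [k [Kk k1] H] := freq K; exists k.
  have [f fP] := choice ch.
  pose k := fix k j := if j is i.+1 then f (k i).+1 else f 1%N.
  have kS j : (k j < k j.+1)%N by have [] := fP (k j).+1.
  exists k; split.
  - by case=> [|j]; [have [] := fP 1%N|have [] := fP (k j).+1].
  - by move=> i j; exact: (homo_ltn ltn_trans kS).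
  - by case=> [|j]; [have [] := fP 1%N|have [] := fP (k j).+1].
have [L L0 OL] := bounded_rV_box bOmega.
have mOmega : measurable Omega by exact: measurable_rV_open.
have fOmega : (lebesgue_rV R n Omega < +oo)%E.
  apply: le_lt_trans (lebesgue_cube_lty L0 n); apply: le_measure => //; rewrite inE//.
  by apply: measurable_rV_box; exact: measurable_itv.
have vol_ge0 : 0 <= volume Omega by rewrite fine_ge0.
have om_ge0 : 0 <= unit_ball_volume R n by rewrite fine_ge0.
(* Where c = 0 the inequality is trivial. *)
have [om0|om0] := eqVneq (unit_ball_volume R n) 0.
  exists K.+1 => //; by rewrite /c om0 !mul0r -natr1 addrK.
have [vol0|vol0] := eqVneq (volume Omega) 0.
  exists K.+1 => //; by rewrite /c vol0 mulr0 !mul0r -natr1 addrK.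
have [e [eL eO eS]] := eigenbasis mOmega fOmega hgamma.
apply: (@polya_frequently R n Omega hn mOmega fOmega L (1 + n%:R * L ^+ 2) L0 OL _ _
  gamma hgamma gamma1 e eL eO eS) => //.
- by rewrite lerDl mulr_ge0// sqr_ge0.
- move=> x Ox; rewrite dot_sqr (@le_trans _ _ (\sum_(i < n) L ^+ 2))//; last first.
    by rewrite sumr_const card_ord mulr_natl lerDr.
  apply: ler_sum => i _; have := OL x Ox i; rewrite /= in_itv/= -ler_norml => xL.
  by rewrite -real_normK ?num_real// lerXn2r// nnegrE ltW.
- by rewrite lt_def om0.
- by rewrite lt_def vol0.
Qed.
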